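(* For $\lambda=(\lambda_1,\dots,\lambda_r)\vdash n$, \[ \mathrm{Imm}_{\epsilon_{q,\mathrm{LLT}}^{\lambda}}(t)=\sum_{(I_1,\dots,I_r)}(t_{I_1,I_1})^{e,e}\cdots(t_{I_r,I_r})^{e,e}, \] and \[ \mathrm{Imm}_{\eta_{q,\mathrm{LLT}}^{\lambda}}(t)=\sum_{(I_1,\dots,I_r)}(t_{I_r,I_r})^{w_0,w_0}\cdots(t_{I_1,I_1})^{w_0,w_0}, \] where both sums are over all ordered set partitions $(I_1,\dots,I_r)$ of $[n]$ of type $\lambda$.
   Context: $H_n(q)$ is the Hecke algebra of $\mathfrak{S}_n$ over $\mathbb{Z}[q^{1/2},q^{-1/2}]$ with natural basis $\{T_w\}$ ($T_{s_i}^2=(q-1)T_{s_i}+q$ plus braid relations); $\ell(w)$ is the length. The quantum matrix bialgebra $\mathcal{A}_n(q)$ is the noncommutative $\mathbb{Z}[q^{1/2},q^{-1/2}]$-algebra generated by $t_{i,j}$, $i,j\in[n]$, subject to, for all $i<j$ and $k<\ell$: $t_{i,\ell}t_{i,k}=q^{1/2}t_{i,k}t_{i,\ell}$, $t_{j,k}t_{i,k}=q^{1/2}t_{i,k}t_{j,k}$, $t_{j,k}t_{i,\ell}=t_{i,\ell}t_{j,k}$, $t_{j,\ell}t_{i,k}=t_{i,k}t_{j,\ell}+(q^{1/2}-q^{-1/2})t_{i,\ell}t_{j,k}$. For $u,v\in\mathfrak{S}_n$, $t^{u,v}=t_{u_1,v_1}\cdots t_{u_n,v_n}$. For a linear functional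 $\theta$ on $H_n(q)$, $\mathrm{Imm}_\theta(t)=\sum_{w\in\mathfrak{S}_n}q^{-\ell(w)/2}\theta(T_w)\,t^{e,w}$. For $I=\{i_1<\cdots<i_k\}\subseteq[n]$, $(t_{I,I})^{e,e}=t_{i_1,i_1}t_{i_2,i_2}\cdots t_{i_k,i_k}$ and $(t_{I,I})^{w_0,w_0}=t_{i_k,i_k}\cdots t_{i_2,i_2}t_{i_1,i_1}$. An ordered set partition of type $\lambda$ is a sequence $(I_1,\dots,I_r)$ of pairwise disjoint sets with union $[n]$ and $|I_j|=\lambda_j$. Traces: linear functionals with $\theta(DD')=\theta(D'D)$. For $\lambda\vdash n$, $\epsilon_q^\lambda$ (resp. $\eta_q^\lambda$) is the character induced from the parabolic subalgebra $H_{\lambda_1}(q)\otimes\cdots\otimes H_{\lambda_r}(q)$ of $T_v\mapsto(-1)^{\ell(v)}$ (resp. $T_v\mapsto q^{\ell(v)}$); the $\epsilon_q^\lambda$ form a basis of traces over $\mathbb{Q}(q^{1/2})$. Let $Y_q(D)=\sum_\lambda\epsilon_q^\lambda(D)m_\lambda$, $Z_q(D)=(q-1)^nY_q(D)[X/(q-1)]$ (plethysm $p_k\mapsto p_k/(q^k-1)$), $\epsilon_{q,\mathrm{LLT}}^\lambda(D)$ the coefficient of $m_\lambda$ in $Z_q(D)$, and for $\theta_q=\sum_\lambda b_\lambda\epsilon_q^\lambda$ set $\theta_{q,\mathrm{LLT}}=\sum_\lambda b_\lambda\epsilon_{q,\mathrm{LLT}}^\lambda$; $\eta_{q,\mathrm{LLT}}^\lambda$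 is obtained this way from $\eta_q^\lambda$. *)

(* Defs.v *)
From HB Require Import structures.
From mathcomp Require Import all_boot all_order all_fingroup all_algebra.
From mathcomp Require Import generic_quotient ring_quotient.
From mathcomp Require Import zify.
From mathcomp Require Import boolp.
From mathcomp Require Import monalg.

Set Implicit Arguments.
Unset Strict Implicit.
Unset Printing Implicit Defensive.

Import GRing.Theory.

Local Open Scope ring_scope.

(* The product of 'S_n satisfies
   (s * w) i = w (s i), so that left multiplication by a simple transposition
   exchanges two neighbouring letters of the one-line notation of w. *)

Section Length.
Variable n : nat.
Implicit Types (w u : 'S_n) (i j k : 'I_n) (p : 'I_n * 'I_n).

Definition inversions w : {set 'I_n * 'I_n} :=
  [set p : 'I_n * 'I_n | (p.1 < p.2)%N && (w p.2 < w p.1)%N].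

Definition len w : nat := #|inversions w|.

Definition adj i j : bool := j == i.+1 :> nat.

Lemma adj_neq i j : adj i j -> i != j.
Proof. by move=> /eqP e; apply/eqP => h; rewrite h in e; move: e => /n_Sn. Qed.

(* The swap of two adjacent positions preserves the order of any other pair. *)
Lemma tperm_adj_lt i j k l : adj i j -> (k, l) != (i, j) -> (k < l)%N ->
  (tperm i j k < tperm i j l)%N.
Proof.
move=> /eqP ij; rewrite xpair_eqE -!val_eqE /= => kl lt.
have tE m : tperm i j m =
    (if m == i :> nat then j else if m == j :> nat then i else m) :> nat.
  case: tpermP => [->|->|/eqP mi /eqP mj]; rewrite ?eqxx //.
    by case: eqP => // ->.
  by rewrite -!val_eqE /= in mi mj; rewrite (negPf mi) (negPf mj).
rewrite !tE; case: ifP; case: ifP; try (case: ifP); try (case: ifP); lia.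
Qed.

Lemma len_lmul i j w : adj i j -> (w j < w i)%N ->
  len w = (len (tperm i j * w)).+1.
Proof.
move=> ij wji; rewrite /len.
have ijin : (i, j) \in inversions w by rewrite inE /= wji andbT (eqP ij).
rewrite (cardsD1 (i, j)) ijin add1n; congr S.
pose f p := (tperm i j p.1, tperm i j p.2).
have fK : involutive f by move=> [a b]; rewrite /f /= !tpermK.
rewrite -(card_imset _ (inv_inj fK)); apply: eq_card => -[a b].
have -> : ((a, b) \in [set f x | x in inversions w :\ (i, j)]) =
          (f (a, b) \in inversions w :\ (i, j)).
  by rewrite -{1}(fK (a, b)) mem_imset //; apply: inv_inj.
rewrite !inE /f /= !permM; case: (boolP (w _ < w _)%N) => lt; rewrite ?andbF //.
rewrite !andbT; apply/andP/idP => [[ne lt']|ab].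
  by have := tperm_adj_lt ij ne lt'; rewrite !tpermK.
case: (eqVneq (a, b) (i, j)) => [[ea eb]|ne].
  by move: lt; rewrite ea eb tpermL tpermR ltnNge ltnW.
split; last exact: tperm_adj_lt.
apply: contraTneq ab => -[ea eb].
have -> : a = j by rewrite -(tpermK i j a) ea tpermL.
have -> : b = i by rewrite -(tpermK i j b) eb tpermR.
by rewrite (eqP ij) ltnNge leqnSn.
Qed.

Lemma mono_perm1 w : (forall i j, adj i j -> (w i < w j)%N) -> w = 1%g.
Proof.
move=> mono.
have step (u : 'S_n) : (forall i j, (i < j)%N -> (u i < u j)%N) ->
    forall i, (i <= u i)%N.
  move=> um [m]; elim: m => [//|m IH] lt /=.
  exact: leq_ltn_trans (IH (ltnW lt)) (um (Ordinal (ltnW lt)) _ _).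
have wm i j : (i < j)%N -> (w i < w j)%N.
  case: j => m lt; elim: m lt => // m IH lt.
  rewrite /= ltnS leq_eqVlt => /orP[/eqP e|im].
    by apply: mono; rewrite /adj /= e.
  have lt' := ltnW lt.
  by apply: ltn_trans (IH lt' im) _; apply: mono; rewrite /adj.
have wVm i j : (i < j)%N -> ((w^-1)%g i < (w^-1)%g j)%N.
  move=> lt; case: (ltngtP ((w^-1)%g i) ((w^-1)%g j)) => // [/wm|/val_inj e].
    by rewrite !permKV ltnNge ltnW.
  by move: lt; rewrite (perm_inj e) ltnn.
apply/permP => i; rewrite perm1; apply/val_inj/anti_leq/andP; split.
  by have := step _ wVm (w i); rewrite permK.
exact: step _ wm i.
Qed.

End Length.

(* H_n(q), over any commutative ring R, realised on the free R-module with
   basis (T_w): T_s T_w is given by the usual rule for s simple, and T_w acts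
   through a reduced word of w. *)

Definition hecke (R : comUnitRingType) (q : R) (n : nat) : Type :=
  {ffun 'S_n -> R^o}.

Section Hecke.
Variables (R : comUnitRingType) (q : R) (n : nat).
Local Notation H := (hecke q n).

HB.instance Definition _ := GRing.Lmodule.copy H {ffun 'S_n -> R^o}.
HB.instance Definition _ := Vector.copy H {ffun 'S_n -> R^o}.

Implicit Types (x y : H) (w u : 'S_n) (i j k l : 'I_n).

Definition T w : H := [ffun u => (u == w)%:R].

Definition Ts_mulT i j u : H :=
  if (u i < u j)%N then T (tperm i j * u)
  else q *: T (tperm i j * u) + (q - 1) *: T u.

Definition Ts_mul i j x : H := \sum_u x u *: Ts_mulT i j u.

Fixpoint T_mul_rec (m : nat) w x : H :=
  if m is m'.+1 then
    if [pick p : 'I_n * 'I_n | adj p.1 p.2 && (w p.2 < w p.1)%N] is Some p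
    then Ts_mul p.1 p.2 (T_mul_rec m' (tperm p.1 p.2 * w) x)
    else x
  else x.

Definition T_mul w x : H := T_mul_rec (len w) w x.

Definition hecke_mul x y : H := \sum_w x w *: T_mul w y.

(* Right multiplication, used to prove associativity. *)

Definition mulT_Ts i j u : H :=
  if ((u^-1)%g i < (u^-1)%g j)%N then T (u * tperm i j)
  else q *: T (u * tperm i j) + (q - 1) *: T u.

Definition mul_Ts i j x : H := \sum_u x u *: mulT_Ts i j u.

Fixpoint mul_T_rec (m : nat) w x : H :=
  if m is m'.+1 then
    if [pick p : 'I_n * 'I_n |
         adj p.1 p.2 && ((w^-1)%g p.2 < (w^-1)%g p.1)%N] is Some p
    then mul_Ts p.1 p.2 (mul_T_rec m' (w * tperm p.1 p.2) x)
    else x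
  else x.

Definition mul_T w x : H := mul_T_rec (len w) w x.

Lemma hecke_sum x : x = \sum_w x w *: T w.
Proof.
apply/ffunP => u; rewrite sum_ffunE (bigD1 u) //= big1 ?addr0.
  by rewrite !ffunE eqxx; rewrite /GRing.scale /= mulr1.
by move=> w /negPf ne; rewrite !ffunE eq_sym ne scaler0.
Qed.

Section Extend.
Variable f : 'S_n -> H.
Let g x : H := \sum_u x u *: f u.

Lemma extend_linear a x y : g (a *: x + y) = a *: g x + g y.
Proof.
rewrite /g scaler_sumr -big_split; apply: eq_bigr => w _ /=.
by rewrite !ffunE scalerDl -scalerA.
Qed.

Lemma extend_T w : g (T w) = f w.
Proof.
rewrite /g (bigD1 w) //= big1 ?addr0; first by rewrite ffunE eqxx scale1r.
by move=> u /negPf ne; rewrite ffunE ne scale0r.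
Qed.
End Extend.

HB.instance Definition _ i j := GRing.isLinear.Build R H H *:%R (Ts_mul i j)
  (extend_linear (Ts_mulT i j)).
HB.instance Definition _ i j := GRing.isLinear.Build R H H *:%R (mul_Ts i j)
  (extend_linear (mulT_Ts i j)).

Lemma T_mul_rec_linear m w : linear (T_mul_rec m w).
Proof.
elim: m w => [//|m IH] w a x y /=; case: pickP => // p _.
by rewrite IH linearP.
Qed.
Lemma mul_T_rec_linear m w : linear (mul_T_rec m w).
Proof.
elim: m w => [//|m IH] w a x y /=; case: pickP => // p _.
by rewrite IH linearP.
Qed.

HB.instance Definition _ w :=
  GRing.isLinear.Build R H H *:%R (T_mul w) (@T_mul_rec_linear _ w).
HB.instance Definition _ w :=
  GRing.isLinear.Build R H H *:%R (mul_T w) (@mul_T_rec_linear _ w).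

Lemma Ts_mulDZ i j a b u w :
  Ts_mul i j (a *: T u + b *: T w) = a *: Ts_mulT i j u + b *: Ts_mulT i j w.
Proof. by rewrite (linearD (Ts_mul i j)) !(linearZ_LR (Ts_mul i j)) /= /Ts_mul !extend_T. Qed.
Lemma mul_TsDZ i j a b u w :
  mul_Ts i j (a *: T u + b *: T w) = a *: mulT_Ts i j u + b *: mulT_Ts i j w.
Proof. by rewrite (linearD (mul_Ts i j)) !(linearZ_LR (mul_Ts i j)) /= /mul_Ts !extend_T. Qed.

Lemma Ts_mul_T i j u : Ts_mul i j (T u) = Ts_mulT i j u.
Proof. exact: extend_T. Qed.
Lemma mul_Ts_T i j u : mul_Ts i j (T u) = mulT_Ts i j u.
Proof. exact: extend_T. Qed.

Lemma hecke_ext (f g : {linear H -> H}) : (forall w, f (T w) = g (T w)) ->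
  forall x, f x = g x.
Proof.
move=> fg x; rewrite [x]hecke_sum !linear_sum; apply: eq_bigr => w _.
by rewrite !linearZ /= fg.
Qed.

Lemma tpermM_desc i j k l u : adj i j -> adj k l ->
  (tperm i j * u != u * tperm k l)%g ->
  ((u * tperm k l)%g i < (u * tperm k l)%g j)%N = (u i < u j)%N.
Proof.
move=> ij kl ne.
have h (v : 'S_n) : (v i, v j) != (k, l) -> (v i < v j)%N ->
    ((v * tperm k l)%g i < (v * tperm k l)%g j)%N.
  by move=> vne lt; rewrite !permM; apply: tperm_adj_lt.
have ne' (v : 'S_n) : (tperm i j * v != v * tperm k l)%g -> (v i, v j) != (k, l).
  apply: contraNneq => -[vi vj].
  by rewrite -vi -vj -tpermJ conjgE mulgA mulgA mulgV mul1g.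
apply/idP/idP => [lt|]; last by apply: h; apply: ne'.
have := h (u * tperm k l)%g; rewrite -mulgA tperm2 mulg1; apply => //.
apply: ne'; rewrite mulgA; apply: contraNneq ne => e.
by move/(congr1 (mulg^~ (tperm k l))): e; rewrite -!mulgA tperm2 !mulg1 => ->.
Qed.

Lemma tperm_ltN i j u : adj i j ->
  ((tperm i j * u)%g i < (tperm i j * u)%g j)%N = ~~ (u i < u j)%N.
Proof.
move=> ij; rewrite !permM tpermL tpermR -leqNgt [RHS]leq_eqVlt val_eqE.
by rewrite (inj_eq perm_inj) eq_sym (negPf (adj_neq ij)).
Qed.

Lemma Ts_mulC i j k l x : adj i j -> adj k l ->
  Ts_mul i j (mul_Ts k l x) = mul_Ts k l (Ts_mul i j x).
Proof.
move=> ij kl.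
suff: (Ts_mul i j \o mul_Ts k l) x = (mul_Ts k l \o Ts_mul i j) x by [].
apply: (@hecke_ext (Ts_mul i j \o mul_Ts k l) (mul_Ts k l \o Ts_mul i j)) => u.
rewrite /= mul_Ts_T Ts_mul_T.
have [e|ne] := eqVneq (tperm i j * u)%g (u * tperm k l)%g.
  have ab : ((u^-1)%g k < (u^-1)%g l)%N = (u i < u j)%N.
    have uj : u j = tperm k l (u i) by rewrite -permM -e permM tpermL.
    have ui : u i = tperm k l (u j) by rewrite -permM -e permM tpermR.
    have kl' : (k < l)%N by rewrite (eqP kl).
    have ij' : (i < j)%N by rewrite (eqP ij).
    case: (tpermP k l (u i)) uj => [uik|uil|_ _] uj.
    - by rewrite -uj -uik !permK uik uj kl' ij'.
    - by rewrite -uj -uil !permK uil uj; apply/idP/idP => lt; lia.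
    - by move/perm_inj: uj => h; have := adj_neq ij; rewrite h eqxx.
  have ss : (tperm i j * (tperm i j * u))%g = u by rewrite mulgA tperm2 mul1g.
  have tt : (u * tperm k l * tperm k l)%g = u by rewrite -mulgA tperm2 mulg1.
  rewrite /mulT_Ts /Ts_mulT ab; case: ifP => lt.
    rewrite Ts_mul_T mul_Ts_T /Ts_mulT /mulT_Ts -e ss tperm_ltN // lt /=.
    rewrite e tt invMg tpermV.
    have := tperm_ltN (u^-1)%g kl.
    have <- : (u^-1 * tperm i j = tperm k l * u^-1)%g.
      by apply: invg_inj; rewrite !invMg !invgK !tpermV.
    by move=> ->; rewrite ab lt.
  rewrite Ts_mulDZ mul_TsDZ /Ts_mulT /mulT_Ts.
  rewrite -e ss tperm_ltN // lt /= ab lt e tt invMg tpermV.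
  have := tperm_ltN (u^-1)%g kl.
  have <- : (u^-1 * tperm i j = tperm k l * u^-1)%g.
    by apply: invg_inj; rewrite !invMg !invgK !tpermV.
  by move=> ->; rewrite ab lt.
have d1 := tpermM_desc ij kl ne.
have d2 : (((tperm i j * u)^-1)%g k < ((tperm i j * u)^-1)%g l)%N =
          ((u^-1)%g k < (u^-1)%g l)%N.
  rewrite invMg tpermV; apply: tpermM_desc => //.
  by apply: contraNneq ne => h; apply/eqP/invg_inj; rewrite !invMg !tpermV.
rewrite /mulT_Ts /Ts_mulT; case: ifP => b; case: ifP => a;
  rewrite ?Ts_mulDZ ?mul_TsDZ ?Ts_mul_T ?mul_Ts_T /Ts_mulT /mulT_Ts ?d1 ?d2 a b
    ?mulgA; [by []|by []|by []|].
have DZ (c d : R) (A B C D : H) :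
  c *: (c *: A + d *: B) + d *: (c *: C + d *: D) =
  c *: (c *: A + d *: C) + d *: (c *: B + d *: D).
  by rewrite !scalerDr !scalerA [d * c]mulrC addrACA.
exact: DZ.
Qed.

Lemma T_mulC w k l x : adj k l -> T_mul w (mul_Ts k l x) = mul_Ts k l (T_mul w x).
Proof.
move=> kl; rewrite /T_mul; move: (len w) => m; elim: m w => [//|m IH] v /=.
case: pickP => [p /andP[p_adj _]|_]; last by [].
by rewrite IH; apply: Ts_mulC.
Qed.

Lemma T_mul_mul_T w u x : T_mul w (mul_T u x) = mul_T u (T_mul w x).
Proof.
rewrite /mul_T; move: (len u) => m; elim: m u => [//|m IH] v /=.
by case: pickP => // p /andP[p_adj _]; rewrite T_mulC // IH.
Qed.

Lemma len1P w : (forall i j, adj i j -> ~~ (w j < w i)%N) -> w = 1%g.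
Proof.
move=> h; apply: mono_perm1 => i j ij; have := h i j ij.
by rewrite -leqNgt leq_eqVlt val_eqE (inj_eq perm_inj) (negPf (adj_neq ij)).
Qed.

Lemma T_mul1 w : T_mul w (T 1) = T w.
Proof.
suff h m (x : 'S_n) : (len x <= m)%N -> T_mul_rec m x (T 1) = T x by exact: h.
elim: m x => [|m IH] {}w /=.
  rewrite leqn0 => /eqP w0; rewrite (@len1P w) // => i j ij.
  by apply/negP => lt; have := len_lmul ij lt; rewrite w0.
case: pickP => [p /andP[p_adj lt]|no] le.
  rewrite IH; last by move: le; rewrite (len_lmul p_adj lt) ltnS.
  by rewrite Ts_mul_T /Ts_mulT !permM tpermL tpermR lt mulgA tperm2 mul1g.
by rewrite (@len1P w) // => i j ij; have := no (i, j); rewrite /= ij /= => ->.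
Qed.

Lemma lenV w : len w^-1 = len w.
Proof.
pose f (p : 'I_n * 'I_n) := (w p.2, w p.1).
have fI : injective f by move=> [a b] [c d] [/perm_inj -> /perm_inj ->].
rewrite {2}/len -(card_imset _ fI); apply: eq_card => -[a b].
rewrite -[a](permKV w) -[b](permKV w).
have -> : (w ((w^-1)%g a), w ((w^-1)%g b)) = f ((w^-1)%g b, (w^-1)%g a) by [].
by rewrite mem_imset // !inE /= !permKV andbC.
Qed.

Lemma mul_T1 w : mul_T w (T 1) = T w.
Proof.
suff h m (x : 'S_n) : (len x <= m)%N -> mul_T_rec m x (T 1) = T x by exact: h.
elim: m x => [|m IH] {}w /=.
  rewrite leqn0 => /eqP w0; rewrite (@len1P w) // => i j ij.
  by apply/negP => lt; have := len_lmul ij lt; rewrite w0.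
case: pickP => [p /andP[p_adj lt]|no] le.
  rewrite IH; last first.
    move: le; rewrite -lenV (len_lmul p_adj lt) ltnS -lenV invMg invgK tpermV.
    by [].
  rewrite mul_Ts_T /mulT_Ts invMg tpermV !permM tpermL tpermR lt.
  by rewrite -mulgA tperm2 mulg1.
apply/esym; rewrite -[w]invgK (@len1P w^-1) ?invg1 // => i j ij.
by have := no (i, j); rewrite /= ij /= => ->.
Qed.

Lemma hecke_mulTl w x : hecke_mul (T w) x = T_mul w x.
Proof. exact: (extend_T (T_mul^~ x)). Qed.

Lemma hecke_mul_linearl y : linear (hecke_mul^~ y).
Proof. by move=> a x z; apply: (extend_linear (T_mul^~ y)). Qed.

Lemma hecke_mul_linearr x : linear (hecke_mul x).
Proof.
move=> a y z; rewrite /hecke_mul scaler_sumr -big_split; apply: eq_bigr => w _.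
by rewrite linearP scalerDr /= !scalerA [a * _]mulrC.
Qed.

HB.instance Definition _ x :=
  GRing.isLinear.Build R H H *:%R (hecke_mul x) (@hecke_mul_linearr x).

Lemma hecke_mulTr x u : hecke_mul x (T u) = mul_T u x.
Proof.
rewrite {2}[x]hecke_sum linear_sum; apply: eq_bigr => w _.
by rewrite linearZ /= -(mul_T1 u) T_mul_mul_T T_mul1.
Qed.

Lemma hecke_mulA : associative hecke_mul.
Proof.
move=> x y z.
have e u : hecke_mul x (hecke_mul y (T u)) = hecke_mul (hecke_mul x y) (T u).
  rewrite !hecke_mulTr /hecke_mul linear_sum; apply: eq_bigr => w _.
  by rewrite linearZ /= T_mul_mul_T.
exact: (@hecke_ext (hecke_mul x \o hecke_mul y) (hecke_mul (hecke_mul x y)) e).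
Qed.

Lemma hecke_mul1l : left_id (T 1) hecke_mul.
Proof.
move=> x; rewrite hecke_mulTl /T_mul.
have -> : len (1%g : 'S_n) = 0%N; last by [].
apply: eq_card0 => p; rewrite !inE !perm1.
by apply/negP => /andP[/ltnW]; rewrite leqNgt => /negP.
Qed.

Lemma hecke_mul1r : right_id (T 1) hecke_mul.
Proof.
move=> x; rewrite {2}[x]hecke_sum; apply: eq_bigr => w _.
by rewrite T_mul1.
Qed.

Lemma hecke_mulDl : left_distributive hecke_mul +%R.
Proof.
move=> x y z; have := hecke_mul_linearl z 1 x y.
by rewrite !scale1r.
Qed.

Lemma hecke_mulDr : right_distributive hecke_mul +%R.
Proof. by move=> x y z; rewrite linearD. Qed.

Lemma hecke_1neq0 : T 1 != 0.
Proof. by apply/eqP => /ffunP/(_ 1%g)/eqP; rewrite !ffunE eqxx oner_eq0. Qed.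

HB.instance Definition _ := GRing.Zmodule_isNzRing.Build H
  hecke_mulA hecke_mul1l hecke_mul1r hecke_mulDl hecke_mulDr hecke_1neq0.

Lemma hecke_scaleAl (a : R) x y : a *: (x * y) = (a *: x) * y.
Proof.
rewrite -[LHS]/(a *: hecke_mul x y) -[RHS]/(hecke_mul (a *: x) y) /hecke_mul.
by rewrite scaler_sumr; apply: eq_bigr => w _; rewrite ffunE -scalerA.
Qed.

HB.instance Definition _ := GRing.Lmodule_isLalgebra.Build R H hecke_scaleAl.

Lemma hecke_scaleAr (a : R) x y : a *: (x * y) = x * (a *: y).
Proof. by rewrite -[RHS]/(hecke_mul x (a *: y)) linearZ. Qed.

HB.instance Definition _ := GRing.Lalgebra_isAlgebra.Build R H hecke_scaleAr.

Lemma TsT i j w : adj i j ->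
  T (tperm i j) * T w = if (len w < len (tperm i j * w))%N
    then T (tperm i j * w) else q *: T (tperm i j * w) + (q - 1) *: T w.
Proof.
move=> ij.
have Ts : T (tperm i j) = Ts_mul i j (T 1).
  by rewrite Ts_mul_T /Ts_mulT !perm1 (eqP ij) ltnSn mulg1.
have Tsw : T (tperm i j) * T w = Ts_mulT i j w.
  rewrite -[LHS]/(hecke_mul _ _) hecke_mulTr Ts -Ts_mul_T -[in RHS](mul_T1 w).
  rewrite /mul_T; move: (len w) => m; elim: m w => [//|m IH] v /=.
  case: pickP => [p /andP[p_adj _]|_]; last by [].
  by rewrite (Ts_mulC _ ij p_adj) IH.
rewrite Tsw /Ts_mulT; case: (boolP (w i < w j)%N) => lt.
  have := @len_lmul _ i j (tperm i j * w)%g ij.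
  rewrite mulgA tperm2 mul1g !permM tpermL tpermR => /(_ lt) ->.
  by rewrite ltnSn.
have wlt : (w j < w i)%N.
  by move: (tperm_ltN w ij); rewrite !permM tpermL tpermR lt.
by rewrite (len_lmul ij wlt) ltnNge leqnSn.
Qed.

End Hecke.

Section TwoSidedIdeal.
Variables (A : nzRingType) (rel : A -> Prop).
Implicit Types x y z : A.

Definition ideal_spec x : Prop := exists s : seq (A * A * A),
  (forall p, p \in s -> rel p.1.2) /\ x = \sum_(p <- s) p.1.1 * p.1.2 * p.2.

Definition ideal_gen : {pred A} := fun x => `[< ideal_spec x >].

Lemma ideal_genP x : reflect (ideal_spec x) (x \in ideal_gen).
Proof. exact: asboolP. Qed.

Lemma ideal_gen_mul x y z : y \in ideal_gen -> x * y * z \in ideal_gen.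
Proof.
move=> /ideal_genP[s [rs ->]]; apply/ideal_genP.
exists [seq (x * p.1.1, p.1.2, p.2 * z) | p <- s]; split.
  by move=> _ /mapP[p /rs ? ->].
rewrite big_map mulr_sumr mulr_suml; apply: eq_bigr => p _ /=.
by rewrite !mulrA.
Qed.

Lemma ideal_gen_mull x y : y \in ideal_gen -> x * y \in ideal_gen.
Proof. by move=> /(ideal_gen_mul x 1); rewrite mulr1. Qed.

Lemma ideal_gen_mulr x y : x \in ideal_gen -> x * y \in ideal_gen.
Proof. by move=> /(ideal_gen_mul 1 y); rewrite mul1r. Qed.

Lemma mem_ideal_gen x : rel x -> x \in ideal_gen.
Proof.
move=> rx; apply/ideal_genP; exists [:: (1, x, 1)]; split.
  by move=> p; rewrite inE => /eqP ->.
by rewrite big_seq1 mul1r mulr1.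
Qed.

Lemma ideal_gen_zmod : zmod_closed ideal_gen.
Proof.
split; first by apply/ideal_genP; exists [::]; rewrite big_nil.
move=> x y /ideal_genP[s [rs ->]] /(ideal_gen_mull (-1)).
rewrite mulN1r => /ideal_genP[u [ru ->]].
apply/ideal_genP; exists (s ++ u); rewrite big_cat; split=> // p.
by rewrite mem_cat => /orP[/rs|/ru].
Qed.

HB.instance Definition _ := GRing.isZmodClosed.Build A ideal_gen ideal_gen_zmod.

Local Open Scope quotient_scope.
Local Notation Q := (Quotient.quot ideal_gen).
Implicit Types X Y Z : Q.

Lemma quot_eqP x y : reflect (\pi_Q x = \pi_Q y) (x - y \in ideal_gen).
Proof. by rewrite Quotient.idealrBE; apply: eqP. Qed.

Definition quot_mul : Q -> Q -> Q := lift_op2 Q *%R.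

Lemma quot_mul_pi x y : quot_mul (\pi_Q x) (\pi_Q y) = \pi_Q (x * y).
Proof.
have h z : z - repr (\pi_Q z) \in ideal_gen by apply/quot_eqP; rewrite reprK.
rewrite /quot_mul; unlock; apply/esym/quot_eqP.
rewrite -(subrK (x * repr (\pi_Q y)) (x * y)) -mulrBr -addrA -mulrBl.
apply: rpredD; [exact: ideal_gen_mull | exact: ideal_gen_mulr].
Qed.

Lemma quot_mulA : associative quot_mul.
Proof.
move=> X Y Z; rewrite -[X]reprK -[Y]reprK -[Z]reprK !quot_mul_pi.
by rewrite mulrA.
Qed.

Lemma quot_mul1r : left_id (\pi_Q 1) quot_mul.
Proof. by move=> X; rewrite -[X]reprK !quot_mul_pi mul1r. Qed.

Lemma quot_mulr1 : right_id (\pi_Q 1) quot_mul.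
Proof. by move=> X; rewrite -[X]reprK !quot_mul_pi mulr1. Qed.

Lemma quot_mulDl : left_distributive quot_mul +%R.
Proof.
move=> X Y Z; rewrite -[X]reprK -[Y]reprK -[Z]reprK -raddfD !quot_mul_pi.
by rewrite mulrDl raddfD.
Qed.

Lemma quot_mulDr : right_distributive quot_mul +%R.
Proof.
move=> X Y Z; rewrite -[X]reprK -[Y]reprK -[Z]reprK -raddfD !quot_mul_pi.
by rewrite mulrDr raddfD.
Qed.

Lemma quot_1neq0 : 1 \notin ideal_gen -> \pi_Q 1 != 0.
Proof.
apply: contraNneq => e; rewrite -[1]subr0; apply/quot_eqP.
by rewrite e raddf0.
Qed.

End TwoSidedIdeal.

Section TwoSidedIdealScale.
Variables (R : comNzRingType) (A : lalgType R) (rel : A -> Prop).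
Local Open Scope quotient_scope.
Local Notation Q := (Quotient.quot (ideal_gen rel)).
Implicit Types (a b : R) (X Y : Q) (x : A).

Definition quot_scale a : Q -> Q := lift_op1 Q ( *:%R a).

Lemma quot_scale_pi a x : quot_scale a (\pi_Q x) = \pi_Q (a *: x).
Proof.
rewrite /quot_scale; unlock; apply/esym/quot_eqP; rewrite -scalerBr -mulr_algl; apply: ideal_gen_mull.
by apply/quot_eqP; rewrite reprK.
Qed.

Lemma quot_scaleA a b X : quot_scale a (quot_scale b X) = quot_scale (a * b) X.
Proof. by rewrite -[X]reprK !quot_scale_pi scalerA. Qed.

Lemma quot_scale1 : left_id 1 quot_scale.
Proof. by move=> X; rewrite -[X]reprK quot_scale_pi scale1r. Qed.

Lemma quot_scaleDr : right_distributive quot_scale +%R.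
Proof.
move=> a X Y; rewrite -[X]reprK -[Y]reprK -raddfD !quot_scale_pi.
by rewrite scalerDr raddfD.
Qed.

Lemma quot_scaleDl X : {morph quot_scale^~ X : a b / a + b}.
Proof.
by move=> a b; rewrite -[X]reprK !quot_scale_pi scalerDl raddfD.
Qed.

Lemma quot_scaleAl a X Y :
  quot_scale a (quot_mul X Y) = quot_mul (quot_scale a X) Y.
Proof.
rewrite -[X]reprK -[Y]reprK !(quot_scale_pi, quot_mul_pi).
by rewrite scalerAl.
Qed.

Lemma quot_scaleAr : (forall a (x y : A), a *: (x * y) = x * (a *: y)) ->
  forall a X Y, quot_scale a (quot_mul X Y) = quot_mul X (quot_scale a Y).
Proof.
move=> ax a X Y; rewrite -[X]reprK -[Y]reprK !(quot_scale_pi, quot_mul_pi).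
by rewrite ax.
Qed.

End TwoSidedIdealScale.

(* The quantum matrix bialgebra A_n(q), with v = q^{1/2}, over any commutative
   ring R containing q^{1/2}: the quotient of the
   free algebra on the t_{i,j} by the two-sided ideal generated by [qrel]. *)

Section QuantumRelations.
Variables (R : comUnitRingType) (v : R) (n : nat) (A : lalgType R).
Variable g : 'I_n -> 'I_n -> A.
Implicit Types (i j k l : 'I_n).

Variant qrel : A -> Prop :=
| Qrow i k l of (k < l)%N :
    qrel (g i l * g i k - v *: (g i k * g i l))
| Qcol i j k of (i < j)%N :
    qrel (g j k * g i k - v *: (g i k * g j k))
| Qanti i j k l of (i < j)%N & (k < l)%N :
    qrel (g j k * g i l - g i l * g j k)
| Qdiag i j k l of (i < j)%N & (k < l)%N :
    qrel (g j l * g i k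
          - (g i k * g j l + (v - v^-1) *: (g i l * g j k))).

Lemma qrel_augmentation (c : A -> R) :
    {morph c : x y / x * y} -> {morph c : x y / x + y} ->
    (forall a x, c (a *: x) = a * c x) -> c 1 = 1 ->
  (forall i j, c (g i j) = 0) -> 1 \notin ideal_gen qrel.
Proof.
move=> cM cD cZ c1 cg; have c0 : c 0 = 0 by rewrite -(scale0r 0) cZ mul0r.
have cN x : c (- x) = - c x by rewrite -scaleN1r cZ mulN1r.
apply/ideal_genP => -[s [rs e]].
have: c 1 = 0.
  rewrite e (big_morph c cD c0) big_seq big1 // => p /rs r.
  rewrite !cM (_ : c p.1.2 = 0) ?mulr0 ?mul0r //.
  by case: r => *; rewrite !(cM, cD, cN, cZ, cg, mulr0, mul0r, oppr0, addr0).
by apply/eqP; rewrite c1 oner_eq0.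
Qed.

Local Open Scope quotient_scope.
Local Notation Q := (Quotient.quot (ideal_gen qrel)).
Local Notation t i j := (\pi_Q (g i j)).
Local Notation "X ** Y" := (quot_mul X Y) (at level 40).

Lemma quot_qrel x y : qrel (x - y) -> \pi_Q x = \pi_Q y.
Proof. by move=> /mem_ideal_gen/quot_eqP. Qed.

Lemma quot_row i k l : (k < l)%N ->
  t i l ** t i k = quot_scale v (t i k ** t i l).
Proof. by move=> /(Qrow i)/quot_qrel; rewrite !quot_mul_pi quot_scale_pi. Qed.

Lemma quot_col i j k : (i < j)%N ->
  t j k ** t i k = quot_scale v (t i k ** t j k).
Proof. by move=> /(Qcol k)/quot_qrel; rewrite !quot_mul_pi quot_scale_pi. Qed.

Lemma quot_anti i j k l : (i < j)%N -> (k < l)%N ->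
  t j k ** t i l = t i l ** t j k.
Proof. by move=> ij /(Qanti ij)/quot_qrel; rewrite !quot_mul_pi. Qed.

Lemma quot_diag i j k l : (i < j)%N -> (k < l)%N ->
  t j l ** t i k = t i k ** t j l + quot_scale (v - v^-1) (t i l ** t j k).
Proof.
move=> ij /(Qdiag ij)/quot_qrel.
by rewrite !quot_mul_pi quot_scale_pi raddfD.
Qed.

End QuantumRelations.

Notation free_alg R n := {malg R[{fmonom ('I_n * 'I_n)%type}]}.

Section QuantumMatrices.
Variables (R : comUnitRingType) (v : R) (n : nat).
Local Notation Fr := (free_alg R n).

Implicit Types (i j k l : 'I_n) (x y z : Fr) (a : R).

Definition gen i j : Fr := << fmu (i, j) >>.

Local Notation rel := (@qrel R v n Fr gen).

Lemma free_scaleAr a x y : a *: (x * y) = x * (a *: y).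
Proof.
have aC z : malgC a * z = z * malgC a.
  rewrite !malgM_def fgmulUg fgmulgU; apply: eq_bigr => m _.
  by rewrite mul1m mulm1 mulrC.
by rewrite -!mul_malgC mulrA aC -mulrA.
Qed.

Lemma qrel_proper : 1 \notin ideal_gen rel.
Proof.
pose c : Fr -> R := mcoeff (mone : {fmonom ('I_n * 'I_n)%type}).
apply: (@qrel_augmentation R v n Fr gen c).
- exact: (mcoeff1g_is_multiplicative _ _).1.
- exact: mcoeffD.
- by move=> a x; apply: mcoeffZ.
- by rewrite /c mcoeffU1 eqxx.
- by move=> i j; rewrite /c mcoeffU1 fm1_eq1.
Qed.

Definition qmat : Type := Quotient.quot (ideal_gen rel).

HB.instance Definition _ := GRing.Zmodule.on qmat.
HB.instance Definition _ := GRing.Zmodule_isNzRing.Build qmat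
  (@quot_mulA _ rel) (@quot_mul1r _ rel) (@quot_mulr1 _ rel)
  (@quot_mulDl _ rel) (@quot_mulDr _ rel) (quot_1neq0 qrel_proper).
HB.instance Definition _ := GRing.Zmodule_isLmodule.Build R qmat
  (@quot_scaleA _ _ rel) (@quot_scale1 _ _ rel) (@quot_scaleDr _ _ rel)
  (@quot_scaleDl _ _ rel).
HB.instance Definition _ := GRing.Lmodule_isLalgebra.Build R qmat
  (@quot_scaleAl _ _ rel).
HB.instance Definition _ := GRing.Lalgebra_isAlgebra.Build R qmat
  (@quot_scaleAr _ _ rel free_scaleAr).

Definition tgen i j : qmat :=
  (\pi_(Quotient.quot (ideal_gen rel)) (gen i j))%qT.

Lemma tgen_row i k l : (k < l)%N ->
  tgen i l * tgen i k = v *: (tgen i k * tgen i l).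
Proof. exact: quot_row. Qed.

Lemma tgen_col i j k : (i < j)%N ->
  tgen j k * tgen i k = v *: (tgen i k * tgen j k).
Proof. exact: quot_col. Qed.

Lemma tgen_anti i j k l : (i < j)%N -> (k < l)%N ->
  tgen j k * tgen i l = tgen i l * tgen j k.
Proof. exact: quot_anti. Qed.

Lemma tgen_diag i j k l : (i < j)%N -> (k < l)%N ->
  tgen j l * tgen i k =
  tgen i k * tgen j l + (v - v^-1) *: (tgen i l * tgen j k).
Proof. exact: quot_diag. Qed.

End QuantumMatrices.

Section Immanants.
Variables (R : comUnitRingType) (v : R) (n : nat).
Local Notation H := (hecke (v ^+ 2) n).
Local Notation A := (qmat v n).
Local Notation t i j := (tgen v i j).

(* t^{e,w}; products over ordinals are taken in increasing order. *)
Definition monomial (w : 'S_n) : A := \prod_(i < n) t i (w i).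

Definition Imm (theta : H -> R) : A :=
  \sum_(w : 'S_n) (v ^- len w * theta (T (v ^+ 2) w)) *: monomial w.

(* (t_{I,I})^{e,e} and (t_{I,I})^{w_0,w_0}; [enum I] is increasing. *)
Definition diag_up (I : {set 'I_n}) : A := \prod_(i <- enum I) t i i.
Definition diag_down (I : {set 'I_n}) : A := \prod_(i <- rev (enum I)) t i i.

End Immanants.

(* A partition of n has at most n parts, all at most n,
   whence the finite carrier of [intpart n]. *)

Definition is_part (n : nat) (lam : seq nat) : bool :=
  [&& sorted geq lam, 0%N \notin lam & sumn lam == n].

Definition intpart (n : nat) : Type :=
  {b : {bseq n of 'I_n.+1} | is_part n [seq val i | i <- b]}.

HB.instance Definition _ n := Finite.on (intpart n).

Definition parts (n : nat) (mu : intpart n) : seq nat :=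
  [seq nat_of_ord i | i <- val mu].

(* Sequences (I_1, ..., I_r) of disjoint sets covering [n], |I_j| = lam_j. *)
Definition is_osp (n : nat) (lam : seq nat) (I : seq {set 'I_n}) : bool :=
  [&& [seq #|J| | J : {set 'I_n} <- I] == lam,
      pairwise (fun J K : {set 'I_n} => [disjoint J & K]) I
    & \bigcup_(J <- I) J == [set: 'I_n]].

Section InducedCharacters.
Variables (R : comUnitRingType) (q : R) (n : nat).
Local Notation H := (hecke q n).
Implicit Types (lam : seq nat) (w u : 'S_n) (psi : 'S_n -> R) (D : H).

(* The Young subgroup of lam: [reshape_index lam i] is the index of the block
   of consecutive integers, of lengths lam_1, lam_2, ..., containing i. *)
Definition young lam : {set 'S_n} :=
  [set w : 'S_n | [forall i : 'I_n, reshape_index lam (w i) == reshape_index lam i]].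

Definition coset_min lam : {set 'S_n} :=
  [set u : 'S_n | [forall w in young lam, (len u <= len (u * w))%N]].

(* The elements of coset_min lam represent the left cosets u * young lam, and
   H is a free right module over H_lam = <T_w | w in young lam>, with basis the
   T_u for u in coset_min lam, and T_u T_w = T_{uw}. For psi a character
   T_w |-> psi w of H_lam, the induced module H (x)_{H_lam} psi has thus basis
   the T_u (x) 1, and this is the matrix of D in that basis. *)
Definition ind_mx psi lam D : 'M[R]_#|coset_min lam| :=
  \matrix_(i, j) \sum_(w in young lam)
    (D * T q (enum_val j)) (enum_val i * w)%g * psi w.

Definition ind_char psi lam D : R^o := \tr (ind_mx psi lam D).

Lemma ind_char_linear psi lam : linear (ind_char psi lam).
Proof.
move=> a x y; rewrite /ind_char /mxtrace scaler_sumr -big_split.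
apply: eq_bigr => i _; rewrite !mxE /= scaler_sumr -big_split.
apply: eq_bigr => w _ /=.
by rewrite mulrDl -scalerAl !ffunE mulrDl /GRing.scale /= mulrA.
Qed.

HB.instance Definition _ psi lam :=
  GRing.isLinear.Build R H R^o *:%R (ind_char psi lam) (ind_char_linear psi lam).

Definition epsilon lam : 'Hom(H, R^o) :=
  linfun (ind_char (fun w => (-1) ^+ len w) lam).

Definition eta lam : 'Hom(H, R^o) :=
  linfun (ind_char (fun w => q ^+ len w) lam).

End InducedCharacters.


(* Not imported earlier: mpoly and monalg share many names, among them
   {mpoly F[n]}, which is therefore written mpoly n F below. *)
From mathcomp Require Import mpoly.

(* Symmetric functions of degree n are represented by symmetric polynomials in
   n variables; in this degree nothing is lost. *)

Section SymmetricFunctions.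
Variables (F : fieldType) (n : nat).
Implicit Types f g P : mpoly n F.

Definition powersum (k : nat) : mpoly n F := \sum_(i < n) 'X_i ^+ k.

(* m_lam, for lam a partition of n: the sum of the monomials whose multiset of
   nonzero exponents is lam. *)
Definition msymfun (lam : seq nat) : mpoly n F :=
  \sum_(m : 'X_{1..n < n.+1} | perm_eq [seq k <- val m | k != 0%N] lam) 'X_[m].

(* The coefficient of m_lam in a symmetric f is that of
   X_1^{lam_1} X_2^{lam_2} ... *)
Definition coef_msymfun (lam : seq nat) f : F :=
  f@_[multinom nth 0%N lam i | i < n].

(* f |-> g under the algebra morphism p_k |-> c_k p_k; in characteristic 0 the
   power sums p_1, ..., p_n are free
   generators of the ring of symmetric polynomials in n variables. *)
Definition is_plethysm (c : nat -> F) f g : Prop :=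
  exists P, f = P \mPo [tuple powersum i.+1 | i < n] /\
            g = P \mPo [tuple c i.+1 *: powersum i.+1 | i < n].

Definition plethysm (c : nat -> F) f : mpoly n F :=
  if pselect (exists g, is_plethysm c f g) is left fg then projT1 (cid fg) else 0.

End SymmetricFunctions.

Section LLT.
Variables (F : fieldType) (q : F) (n : nat).
Local Notation H := (hecke q n).
Implicit Types (D : H) (lam : seq nat).

Definition Yq D : mpoly n F :=
  \sum_(mu : intpart n) epsilon q n (parts mu) D *: msymfun F n (parts mu).

Definition Zq D : mpoly n F :=
  (q - 1) ^+ n *: plethysm (fun k => (q ^+ k - 1)^-1) (Yq D).

Definition epsilon_LLT lam D : F := coef_msymfun lam (Zq D).

Definition epsilon_tuple : #|{: intpart n}|.-tuple 'Hom(H, F^o) :=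
  [tuple epsilon q n (parts (enum_val i)) | i < #|{: intpart n}|].

(* theta = \sum_mu b_mu epsilon^mu |-> \sum_mu b_mu epsilon_LLT^mu *)
Definition LLT (theta : 'Hom(H, F^o)) D : F :=
  \sum_(mu : intpart n)
    coord epsilon_tuple (enum_rank mu) theta * epsilon_LLT (parts mu) D.

End LLT.

(* The field Q(q^{1/2}), and q^{1/2} in it. *)
Definition Qv : fieldType := {fraction {poly rat}}.
Definition qhalf : Qv := tofrac 'X.

(* Main.v *)
(* Consider the functions from the subsets J of [n] to the quantum matrix
   algebra, with the convolution over splittings of J, and let E_k, H_k, D_k, D'_k
   be those supported on the k-subsets with values the principal quantum minor,
   the principal quantum permanent, the increasing and the decreasing product of
   the t_{i,i}. The immanants of epsilon^lam and eta^lam are the values at [n] of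
   the products of the E_{lam_i} and of the H_{lam_i}. The E_k commute, so that
   e_k |-> E_k defines a morphism on symmetric functions, and the plethysm
   defining epsilon_LLT^lam amounts to replacing e_k by
   d_k = (q-1)^k e_k[X/(q-1)]. The recursion
   q^k D_k = \sum_j (q-1)^j D_{k-j} E_j then says that d_k |-> D_k, whence the
   first formula; similarly h_k |-> H_k. The D_k are thus polynomials in the E_k
   and commute. As the t^{e,w} are independent, h_lam = \sum_mu b_mu e_mu yields
   eta^lam = \sum_mu b_mu epsilon^mu, and the immanant of eta_LLT^lam is the image
   of h_lam under e_k |-> D_k; there h_k |-> D'_k since
   \sum_j (-1)^j D_j D'_{k-j} = 0 for k > 0. *)

From HB Require Import structures.
Require Import Defs.
From mathcomp Require Import all_boot all_order all_fingroup all_algebra.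
From mathcomp Require Import generic_quotient ring_quotient.
From mathcomp Require Import zify ring.
From mathcomp Require monalg.
From mathcomp Require Import mpoly.

Set Implicit Arguments.
Unset Strict Implicit.
Unset Printing Implicit Defensive.

Import GRing.Theory.

Local Open Scope ring_scope.

(** * Lengths and multiplication in the Hecke algebra *)

(** Minors and permanents are treated together: T_s has the eigenvalues c = -1 and c = q, and z = c
    / q^{1/2} is a root of z^2 = (q^{1/2} - q^{-1/2}) z + 1, the relation that lets columns of a
    minor of weight z be exchanged. For either root, z^{-2k} D_k = \sum_j (z^{-2} - 1)^j D_{k-j} E_j
    with E_j taken for that root. The root for c = -1 determines D, and the one for c = q then
    determines the image of h_k. The E_k commute because the characters induced from types (a, b)
    and (b, a) agree. Convolution needs this on every subset of [n], whence a relabelling of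
    subsets. On the symmetric side each recursion is an identity between logarithmic derivatives,
    whose coefficients the plethysm merely rescales. Two independence facts give the definitions
    their meaning: that of the power sums, which makes the plethysm single-valued, and that of the
    epsilon^mu, checked at q = 1, which makes their coordinates the expected ones. The independence
    of the t^{e,w} comes from functionals on the free algebra whose values on words are read off the
    Hecke algebra. *)

Section HeckeFacts.
Variables (n : nat).
Implicit Types (i j k : 'I_n) (u w y x : 'S_n).

Lemma adj_lt i j : adj i j -> (i < j)%N.
Proof. by move/eqP->. Qed.

Lemma perm_ltN w i j : i != j -> (w i < w j)%N = ~~ (w j < w i)%N.
Proof.
by move=> ij; rewrite -leqNgt [RHS]leq_eqVlt val_eqE (inj_eq perm_inj) (negPf ij).
Qed.

Lemma len_sl i j w : adj i j ->
  len (tperm i j * w) = if (w i < w j)%N then (len w).+1 else (len w).-1.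
Proof.
move=> ij; case: ifPn => lt.
  have := @len_lmul _ i j (tperm i j * w)%g ij.
  by rewrite mulgA tperm2 mul1g !permM tpermL tpermR => /(_ lt).
have lt' : (w j < w i)%N by rewrite perm_ltN // eq_sym adj_neq.
by rewrite (len_lmul ij lt').
Qed.

Lemma len_sr i j w : adj i j ->
  len (w * tperm i j) =
    if ((w^-1)%g i < (w^-1)%g j)%N then (len w).+1 else (len w).-1.
Proof. by move=> ij; rewrite -lenV invMg tpermV len_sl // lenV. Qed.

Lemma len_gt0_desc i j w : adj i j -> (w j < w i)%N -> (0 < len w)%N.
Proof. by move=> ij lt; rewrite (len_lmul ij lt). Qed.

Lemma len_eq0 w : (len w == 0%N) = (w == 1%g).
Proof.
apply/eqP/eqP => [w0|->]; last first.
  apply: eq_card0 => p; rewrite !inE !perm1.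
  by apply/negP => /andP[/ltnW]; rewrite leqNgt => /negP.
apply: len1P => i j ij; apply/negP => lt.
by have := len_lmul ij lt; rewrite w0.
Qed.

Lemma len1 : len (1%g : 'S_n) = 0%N.
Proof. by apply/eqP; rewrite len_eq0. Qed.

Lemma exists_desc w : w != 1%g ->
  exists i j, adj i j /\ (w j < w i)%N.
Proof.
move=> w1; case: (pickP (fun p : 'I_n * 'I_n => adj p.1 p.2 && (w p.2 < w p.1)%N)).
  by move=> [i j] /andP[? ?]; exists i, j.
move=> no; case/eqP: w1; apply: len1P => i j ij.
by have := no (i, j); rewrite /= ij /= => ->.
Qed.

Lemma perm_ind_left (P : 'S_n -> Prop) :
  P 1%g ->
  (forall i j w, adj i j -> (w i < w j)%N -> P w -> P (tperm i j * w)%g) ->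
  forall w, P w.
Proof.
move=> P1 PS w; have [m] := ubnP (len w); elim: m w => // m IH w le.
have [->//|/exists_desc[i [j [ij lt]]]] := eqVneq w 1%g.
rewrite -[w]mul1g -(tperm2 i j) -mulgA; apply: PS => //.
  by rewrite !permM tpermL tpermR.
by apply: IH; move: le; rewrite (len_lmul ij lt).
Qed.

Lemma perm_ind_right (P : 'S_n -> Prop) :
  P 1%g ->
  (forall i j w, adj i j -> ((w^-1)%g i < (w^-1)%g j)%N -> P w ->
     P (w * tperm i j)%g) ->
  forall w, P w.
Proof.
move=> P1 PS w; rewrite -[w]invgK; elim/perm_ind_left: (w^-1)%g => [|i j u ij lt].
  by rewrite invg1.
by rewrite invMg tpermV => Pu; apply: PS; rewrite ?invgK.
Qed.

Variables (R : comUnitRingType) (q : R).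
Local Notation H := (hecke q n).
Local Notation T := (@T R q n).
Implicit Types (Z D : H).

Lemma T_mulTs i j w : adj i j -> T w * T (tperm i j) = mulT_Ts q i j w.
Proof.
move=> ij.
have -> : T (tperm i j) = mul_Ts i j (T 1).
  by rewrite mul_Ts_T /mulT_Ts invg1 !perm1 (eqP ij) ltnSn mul1g.
rewrite -[LHS]/(hecke_mul _ _) hecke_mulTl T_mulC // T_mul1.
exact: mul_Ts_T.
Qed.

Lemma T_Tsmul i j w : adj i j -> T (tperm i j) * T w = Ts_mulT q i j w.
Proof.
move=> ij; rewrite TsT // /Ts_mulT len_sl //.
case: (boolP (w i < w j)%N) => lt; first by rewrite leqnn.
have lt' : (w j < w i)%N by rewrite perm_ltN ?lt // eq_sym adj_neq.
by rewrite (len_lmul ij lt') ltnNge leqnSn.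
Qed.

(** Dual form of the rule for T_w T_s: only the coefficients of Z at y s and at y reach the
    coefficient at y. *)
Lemma T_mul_coef Z i j y : adj i j ->
  (Z * T (tperm i j)) y =
    if ((y^-1)%g i < (y^-1)%g j)%N then q * Z (y * tperm i j)%g
    else Z (y * tperm i j)%g + (q - 1) * Z y.
Proof.
move=> ij; rewrite {1}(hecke_sum Z) mulr_suml sum_ffunE.
rewrite (eq_bigr (fun w => Z w * mulT_Ts q i j w y)); last first.
  by move=> w _; rewrite -scalerAl T_mulTs // !ffunE.
pose s := tperm i j; have sK (w : 'S_n) : (w * s * s = w)%g.
  by rewrite -mulgA tperm2 mulg1.
have ys : (y * s)%g != y.
  by apply/eqP => /(congr1 (fun x => y^-1 * x)%g); rewrite mulKg mulVg => /permP/(_ i);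
    rewrite tpermL perm1 => e; move: (adj_neq ij); rewrite e eqxx.
have lt (w : 'S_n) : (((w * s)^-1)%g i < ((w * s)^-1)%g j)%N =
     ~~ ((w^-1)%g i < (w^-1)%g j)%N.
  by rewrite invMg tpermV tperm_ltN.
rewrite (bigD1 (y * s)%g) //= (bigD1 y) 1?eq_sym //= big1 ?addr0; last first.
  move=> w /andP[wys wy]; rewrite /mulT_Ts.
  have ne1 : (y == w * s)%g = false.
    by apply: contra_neqF wys => /eqP ->; rewrite sK.
  by case: ifP => _; rewrite !ffunE ne1 ?[y == w]eq_sym ?(negPf wy) ?scaler0 ?addr0 ?mulr0.
rewrite /mulT_Ts lt -/s; case: (boolP (_ < _)%N) => h /=; rewrite !ffunE /= sK;
  rewrite eqxx [y == (y * s)%g]eq_sym (negPf ys) /GRing.scale /=.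
- by rewrite ?mulr0 ?mulr1 ?addr0 mulrC.
- by rewrite ?mulr0 ?mulr1 ?add0r [Z y * _]mulrC.
Qed.

Lemma T_mulS i j w : adj i j -> (w i < w j)%N ->
  T (tperm i j * w) = T (tperm i j) * T w.
Proof. by move=> ij lt; rewrite T_Tsmul // /Ts_mulT lt. Qed.

Lemma T_mulSr i j w : adj i j -> ((w^-1)%g i < (w^-1)%g j)%N ->
  T (w * tperm i j) = T w * T (tperm i j).
Proof. by move=> ij lt; rewrite T_mulTs // /mulT_Ts lt. Qed.

(** Z |-> Z 1 is the symmetrizing trace of the Hecke algebra, for which T_u and T_{u^-1} are dual up
    to q^{l(u)}. *)
Lemma T_mul_coef1 Z u : (Z * T u) 1%g = q ^+ len u * Z (u^-1)%g.
Proof.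
elim/perm_ind_left: u Z => [|i j u ij lt IH] Z.
  by rewrite mulr1 invg1 len1 mul1r.
rewrite T_mulS // mulrA IH len_sl // lt T_mul_coef // invgK lt invMg tpermV.
by rewrite mulrA -exprSr.
Qed.

End HeckeFacts.

(** * Young subgroups *)

Section Young.
Variables (n : nat) (lam : seq nat).
Implicit Types (i j k : 'I_n) (u w y x : 'S_n).
Local Notation blk := (reshape_index lam).

(** Right multiplication by the Young subgroup permutes the values of u inside each block, so the
    condition bears on their positions, that is on u^-1. *)
Definition block_increasing u :=
  forall i j, (i < j)%N -> blk i = blk j -> ((u^-1)%g i < (u^-1)%g j)%N.

Lemma reshape_index_mono i j : (i <= j)%N -> (blk i <= blk j)%N.
Proof.
by rewrite (reshape_leq lam) => /orP[/ltnW//|/andP[/eqP-> _]].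
Qed.

Lemma youngP w : reflect (forall i, blk (w i) = blk i) (w \in young n lam).
Proof. by rewrite inE; apply: (iffP forallP) => h i; apply/eqP. Qed.

Lemma young1 : 1%g \in young n lam.
Proof. by apply/youngP => i; rewrite perm1. Qed.

Lemma youngM w x : w \in young n lam -> x \in young n lam -> (w * x)%g \in young n lam.
Proof. by move=> /youngP hw /youngP hx; apply/youngP => i; rewrite permM hx hw. Qed.

Lemma youngV w : w \in young n lam -> (w^-1)%g \in young n lam.
Proof. by move=> /youngP hw; apply/youngP => i; rewrite -hw permKV. Qed.

Lemma young_desc w i j : adj i j -> w \in young n lam -> (w j < w i)%N -> blk i = blk j.
Proof.
move=> ij /youngP hw lt; apply/eqP; rewrite eqn_leq.
rewrite reshape_index_mono ?(ltnW (adj_lt ij)) //=.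
by rewrite -(hw i) -(hw j) reshape_index_mono // ltnW.
Qed.

Lemma tperm_young i j : blk i = blk j -> tperm i j \in young n lam.
Proof. by move=> e; apply/youngP => k; case: tpermP => [->|->|]. Qed.

(** The inversions of (u w)^-1 are of two disjoint kinds: those of w^-1, whose two indices share a
    block, and the pairs that w^-1 sends to an inversion of u^-1, whose indices lie in different
    blocks. *)
Lemma len_block_increasing u w : block_increasing u -> w \in young n lam ->
  len (u * w) = (len u + len w)%N.
Proof.
move=> uinc wy; rewrite -lenV invMg -[len u]lenV -[len w]lenV.
set u' := (u^-1)%g; set w' := (w^-1)%g.
have /youngP w'y : w' \in young n lam by apply: youngV.
have sameblk i j : (i < j)%N -> (w' j < w' i)%N -> blk i = blk j.
  move=> ij lt; apply/eqP; rewrite eqn_leq reshape_index_mono ?(ltnW ij) //=.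
  by rewrite -(w'y i) -(w'y j) reshape_index_mono // ltnW.
pose f (p : 'I_n * 'I_n) := (w' p.1, w' p.2).
have fI : injective f by move=> [a b] [c d] [/perm_inj -> /perm_inj ->].
pose S := f @^-1: inversions u'.
have cS : #|S| = len u'.
  rewrite /S -(card_imset _ fI) /len; congr #|pred_of_set _|.
  apply/setP => p; apply/imsetP/idP => [[r]|pin]; first by rewrite inE => ? ->.
  exists ((w'^-1)%g p.1, (w'^-1)%g p.2); last by rewrite /f /= !permKV -surjective_pairing.
  by rewrite inE /f /= !permKV -surjective_pairing.
have dblk i j : (i < j)%N -> (u' j < u' i)%N -> (blk i < blk j)%N.
  move=> ij lt; rewrite ltn_neqAle reshape_index_mono ?(ltnW ij) // andbT.
  by apply/eqP => e; have := uinc _ _ ij e; rewrite ltnNge (ltnW lt).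
have w'lt i j : (blk i < blk j)%N -> (i < j)%N.
  by move=> lt; rewrite ltnNge; apply/negP => /reshape_index_mono; rewrite leqNgt lt.
have dis : [disjoint S & inversions w'].
  rewrite -setI_eq0; apply/eqP/setP => -[i j]; rewrite !inE /=.
  apply/negP => /andP[/andP[h1 h2]] /andP[h3 h4].
  by have := ltn_trans h1 h4; rewrite ltnn.
rewrite -cS /len -cardsUI.
have -> : S :&: inversions w' = set0 by apply/eqP; rewrite setI_eq0.
rewrite cards0 addn0; congr #|pred_of_set _|; apply/setP => -[i j].
rewrite !inE /= !permM; apply/andP/orP => [[ij lt]|].
  case: (ltngtP (w' i) (w' j)) => [h|h|/val_inj/perm_inj e].
  - by left; rewrite lt.
  - by right; rewrite ij.
  - by rewrite e ltnn in ij.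
case=> /andP[h1 h2].
  by split=> //; apply: w'lt; have := dblk _ _ h1 h2; rewrite !w'y.
split=> //; apply: uinc => //; by rewrite !w'y (sameblk _ _ h1 h2).
Qed.

(** Minimality is only tested on the simple transpositions of the Young subgroup; larger distances
    follow because the indices between two members of a block belong to it. *)
Lemma coset_minP u : reflect (block_increasing u) (u \in coset_min n lam).
Proof.
apply: (iffP idP) => [|uinc]; last first.
  rewrite inE; apply/forall_inP => w wy.
  by rewrite len_block_increasing // leq_addr.
rewrite inE => /forall_inP umin.
have adjinc i j : adj i j -> blk i = blk j -> ((u^-1)%g i < (u^-1)%g j)%N.
  move=> ij e; have := umin _ (tperm_young e); rewrite len_sr //.
  case: ifP => // lt; have lt' : ((u^-1)%g j < (u^-1)%g i)%N.
    by rewrite perm_ltN ?lt // eq_sym adj_neq.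
  by rewrite -lenV (len_lmul ij lt') ltnn.
move=> i [m lt]; elim: m lt => // m IH lt.
rewrite /= ltnS leq_eqVlt => /orP[/eqP e|im] eb.
  by apply: adjinc => //; rewrite /adj /= e.
have lt' := ltnW lt.
have eb' : blk i = blk (Ordinal lt') :> nat.
  apply/eqP; rewrite eqn_leq reshape_index_mono ?(ltnW im) //= eb.
  exact: (reshape_index_mono (i := Ordinal lt') (j := Ordinal lt)).
apply: ltn_trans (IH lt' im eb') _.
by apply: adjinc => /=; rewrite ?/adj /= -?eb'.
Qed.

Lemma coset_min_decomp y :
  exists u w, [/\ u \in coset_min n lam, w \in young n lam & y = (u * w)%g].
Proof.
pose w := [arg min_(w < 1%g in young n lam) len (y * w)].
have [w0 w0y w0min] : exists2 w, w \in young n lam &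
    forall x, x \in young n lam -> (len (y * w) <= len (y * x))%N.
  by case: (arg_minnP (fun w => len (y * w)) young1) => x xy xm; exists x.
exists (y * w0)%g, (w0^-1)%g; rewrite youngV // -mulgA mulgV mulg1; split=> //.
rewrite inE; apply/forall_inP => x xy.
by rewrite -mulgA; apply: w0min; apply: youngM.
Qed.

Lemma coset_min_inj u u' w w' : u \in coset_min n lam -> u' \in coset_min n lam ->
  w \in young n lam -> w' \in young n lam -> (u * w)%g = (u' * w')%g -> u = u' /\ w = w'.
Proof.
move=> /coset_minP ui /coset_minP ui' wy wy' e.
suff eu : u = u' by split=> //; apply: (mulgI u); rewrite {2}eu.
pose x := (w * w'^-1)%g; have xy : x \in young n lam by rewrite youngM ?youngV.
have ux : u' = (u * x)%g by rewrite mulgA e mulgK.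
have ux' : u = (u' * x^-1)%g by rewrite ux mulgK.
have := len_block_increasing ui' (youngV xy).
have := len_block_increasing ui xy; rewrite -ux -ux' => -> => /eqP.
rewrite -addnA -{1}[len u]addn0 eqn_add2l eq_sym addn_eq0 len_eq0 => /andP[/eqP x1 _].
by rewrite ux x1 mulg1.
Qed.

End Young.

(** * Induced characters *)

Section InducedTrace.
Variables (n : nat) (lam : seq nat) (R : comUnitRingType) (q c : R).
Hypothesis c_quad : c ^+ 2 = (q - 1) * c + q.
Local Notation H := (hecke q n).
Local Notation T := (@T R q n).
Local Notation blk := (reshape_index lam).
Implicit Types (i j k : 'I_n) (u w y x : 'S_n) (Z D : H).

Lemma ind_charE (psi : 'S_n -> R) D :
  ind_char psi lam D =
  \sum_(u in coset_min n lam) \sum_(w in young n lam) (D * T u) (u * w)%g * psi w.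
Proof. by rewrite [RHS]big_enum_val /=; apply: eq_bigr => i _; rewrite mxE. Qed.

(** As c is a root of the quadratic relation of T_s, this is a character of H_lam; c = -1 and c = q
    give those inducing epsilon and eta. *)
Let psi w : R := c ^+ len w.
(** The coefficient of T_u (x) 1 in Z (x) 1, in the induced module. *)
Let pr Z u : R := \sum_(w in young n lam) Z (u * w)%g * psi w.

Lemma pr_sum (I : Type) (r : seq I) (F : I -> H) u :
  pr (\sum_(k <- r) F k) u = \sum_(k <- r) pr (F k) u.
Proof.
rewrite /pr exchange_big; apply: eq_bigr => w _.
by rewrite sum_ffunE mulr_suml.
Qed.

Lemma pr_scale a Z u : pr (a *: Z) u = a * pr Z u.
Proof.
rewrite /pr mulr_sumr; apply: eq_bigr => w _.
by rewrite ffunE /GRing.scale /= mulrA.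
Qed.

Lemma pr_Ts Z u i j : u \in coset_min n lam -> adj i j -> blk i = blk j ->
  pr (Z * T (tperm i j)) u = c * pr Z u.
Proof.
move=> /coset_minP ui ij eb; set s := tperm i j.
have sy : s \in young n lam by apply: tperm_young.
have sK : involutive (fun w => w * s)%g by move=> w; rewrite /= -mulgA tperm2 mulg1.
have syM w : ((w * s)%g \in young n lam) = (w \in young n lam).
  apply/idP/idP => h; last exact: youngM.
  by rewrite -[w]sK youngM.
have desc w : w \in young n lam ->
    (((u * w)^-1)%g i < ((u * w)^-1)%g j)%N = ((w^-1)%g i < (w^-1)%g j)%N.
  move=> /youngV/youngP wy; rewrite invMg !permM.
  have eb' : blk ((w^-1)%g i) = blk ((w^-1)%g j) by rewrite !wy.
  case: (ltngtP ((w^-1)%g i) ((w^-1)%g j)) => [h|h|/val_inj/perm_inj e].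
  - by rewrite ui.
  - by apply/negbTE; rewrite -leqNgt ltnW // ui.
  - by have := adj_neq ij; rewrite e eqxx.
pose up w := ((w^-1)%g i < (w^-1)%g j)%N.
have upS w : up (w * s)%g = ~~ up w by rewrite /up invMg tpermV tperm_ltN.
rewrite /pr mulr_sumr.
transitivity (\sum_(w in young n lam) (Z (u * (w * s))%g * ((if up w then q else 1) * psi w)) +
   \sum_(w in young n lam) Z (u * w)%g * ((if up w then 0 else q - 1) * psi w)).
  rewrite -big_split; apply: eq_bigr => w wy /=.
  rewrite T_mul_coef // desc // -/(up w) -mulgA -/s; case: ifP => _; ring.
(* Replacing w by w s in the first sum makes both sums carry Z (u w); the coefficients then agree
   term by term, by [c_quad] when w has the descent s. *)
rewrite (reindex_inj (inv_inj sK)) /= (eq_bigl _ _ syM) -big_split /=.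
apply: eq_bigr => w wy; rewrite sK upS /psi len_sr // -/(up w).
case: (boolP (up w)) => h /=; first by rewrite exprS; ring.
have : (0 < len w)%N.
  rewrite -lenV; apply: (len_gt0_desc ij); rewrite perm_ltN // eq_sym.
  exact: adj_neq.
case: (len w) => // l _; rewrite /= !exprS.
have : c * (c * c ^+ l) = c ^+ 2 * c ^+ l by ring.
rewrite c_quad; move: (c ^+ l) (Z _) => cl z.
move=> e; rewrite [RHS](_ : _ = z * (c * (c * cl))); last by ring.
rewrite e; ring.
Qed.

Lemma T_coset u w : u \in coset_min n lam -> w \in young n lam ->
  T (u * w) = T u * T w.
Proof.
move=> uc; have [m] := ubnP (len w); elim: m w => // m IH w le wy.
have [->|] := eqVneq w 1%g; first by rewrite mulg1 mulr1.
rewrite -(inj_eq invg_inj) invg1 => /exists_desc[i [j [ij lt]]].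
have sy := tperm_young (young_desc ij (youngV wy) lt).
set s := tperm i j in sy.
have sK : (w * s * s)%g = w by rewrite -mulgA tperm2 mulg1.
have lt' : (((w * s)^-1)%g i < ((w * s)^-1)%g j)%N.
  by rewrite invMg tpermV !permM tpermL tpermR.
have lws : len w = (len (w * s)).+1 by rewrite -{1}sK len_sr // lt'.
have wsy : (w * s)%g \in young n lam by rewrite youngM.
rewrite -{1}sK mulgA T_mulSr //; last first.
  have := len_sr (u * (w * s))%g ij; rewrite -!mulgA tperm2 mulg1.
  have lu x := len_block_increasing (coset_minP _ _ uc) (w := x).
  by rewrite (lu _ wy) (lu _ wsy); case: ifP => // _; rewrite lws; lia.
rewrite IH //; last by rewrite -ltnS -lws.
by rewrite -mulrA -T_mulSr // sK.
Qed.

Lemma pr_T Z u w : u \in coset_min n lam -> w \in young n lam ->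
  pr (Z * T w) u = psi w * pr Z u.
Proof.
move=> uc; have [m] := ubnP (len w); elim: m w Z => // m IH w Z le wy.
have [->|] := eqVneq w 1%g; first by rewrite mulr1 /psi len1 mul1r.
move=> /exists_desc[i [j [ij lt]]].
have eb := young_desc ij wy lt.
have sy := tperm_young eb.
have lw := len_lmul ij lt.
have -> : T w = T (tperm i j) * T (tperm i j * w).
  by rewrite -T_mulS ?mulgA ?tperm2 ?mul1g // !permM tpermL tpermR.
rewrite mulrA IH ?youngM //; last by rewrite -ltnS -lw.
by rewrite pr_Ts // mulrA -exprSr -lw.
Qed.

Lemma pr_T1 u u' w : u \in coset_min n lam -> u' \in coset_min n lam ->
  w \in young n lam -> pr (T (u' * w)) u = if u == u' then psi w else 0.
Proof.
move=> uc uc' wy; rewrite /pr.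
case: eqVneq => [->|ne].
  rewrite (bigD1 w) //= big1 ?addr0 => [|x /andP[_ xw]]; rewrite ffunE.
    by rewrite eqxx mul1r.
  by rewrite (inj_eq (mulgI _)) (negPf xw) mul0r.
rewrite big1 // => x xy; rewrite ffunE; case: eqP => [e|]; last by rewrite mul0r.
by have [eu _] := coset_min_inj uc uc' xy wy e; rewrite eu eqxx in ne.
Qed.

(** Expand Z over T_y = T_u' T_w with u' minimal and w in the Young subgroup: the right factor T_w
    acts by the scalar psi w. This is the multiplicativity of the matrices [ind_mx]. *)
Lemma pr_mul D Z u : u \in coset_min n lam ->
  pr (D * Z) u = \sum_(u' in coset_min n lam) pr (D * T u') u * pr Z u'.
Proof.
move=> uc.
have -> : pr (D * Z) u = \sum_y Z y * pr (D * T y) u.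
  rewrite {1}[Z]hecke_sum mulr_sumr pr_sum; apply: eq_bigr => y _.
  by rewrite -scalerAr pr_scale.
have ZE u' : pr Z u' = \sum_y Z y * pr (T y) u'.
  rewrite {1}[Z]hecke_sum pr_sum; apply: eq_bigr => y _.
  by rewrite pr_scale.
rewrite [RHS](eq_bigr (fun u' => \sum_y pr (D * T u') u * (Z y * pr (T y) u')));
  last by move=> u' _; rewrite ZE mulr_sumr.
rewrite exchange_big /=; apply: eq_bigr => y _.
have [u1 [w [hu hw ->]]] := coset_min_decomp lam y.
rewrite T_coset // mulrA pr_T //.
rewrite (bigD1 u1) //= big1 ?addr0 => [|u2 /andP[h2 ne]].
  by rewrite -T_coset // pr_T1 // eqxx /=; ring.
by rewrite -T_coset // pr_T1 // (negPf ne) !mulr0.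
Qed.

Lemma ind_mxM D D' : ind_mx psi lam (D * D') = ind_mx psi lam D *m ind_mx psi lam D'.
Proof.
apply/matrixP => i j; rewrite !mxE -mulrA -/(pr (D * (D' * T (enum_val j))) (enum_val i)).
rewrite pr_mul ?enum_valP // big_enum_val /=; apply: eq_bigr => k _.
by rewrite !mxE.
Qed.

Lemma ind_char_trace D D' : ind_char psi lam (D * D') = ind_char psi lam (D' * D).
Proof. by rewrite /ind_char !ind_mxM mxtrace_mulC. Qed.

End InducedTrace.

(** * Conjugation by the longest element *)

Section LongestConjugation.
Variables (n : nat) (R : comUnitRingType) (q : R).
Hypothesis q_unit : q \is a GRing.unit.
Local Notation H := (hecke q n).
Local Notation T := (@T R q n).
Implicit Types (i j k : 'I_n) (u w y x : 'S_n) (Z D : H).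

Lemma T_unit w : exists V : H, T w * V = 1 /\ V * T w = 1.
Proof.
elim/perm_ind_left: w => [|i j w ij lt [V [V1 V2]]].
  by exists 1; rewrite !mulr1.
pose S : H := q^-1 *: (T (tperm i j) - (q - 1) *: 1).
have TT : T (tperm i j) * T (tperm i j) = q *: 1 + (q - 1) *: T (tperm i j).
  rewrite T_Tsmul // /Ts_mulT tpermL tpermR ltnNge ltnW ?adj_lt //=.
  by rewrite tperm2.
have S1 : T (tperm i j) * S = 1.
  by rewrite -scalerAr mulrBr TT -scalerAr mulr1 addrK scalerA mulVr ?scale1r.
have S2 : S * T (tperm i j) = 1.
  by rewrite -scalerAl mulrBl TT -scalerAl mul1r addrK scalerA mulVr ?scale1r.
exists (V * S); rewrite T_mulS //; split.
  by rewrite -mulrA [T w * _]mulrA V1 mul1r S1.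
by rewrite -mulrA [S * _]mulrA S2 mul1r V2.
Qed.

Definition w0 : 'S_n := perm (@rev_ord_inj n).

(* Conjugation by T_{w_0} exchanges the parabolic subalgebras of types (a, b)
   and (b, a). *)
Definition w0J x : 'S_n := (w0 * x * w0)%g.

Lemma w0E i : w0 i = rev_ord i. Proof. by rewrite permE. Qed.

Lemma w0K : (w0 * w0 = 1)%g.
Proof. by apply/permP => i; rewrite permM !w0E rev_ordK perm1. Qed.

Lemma w0V : (w0^-1 = w0)%g.
Proof. by apply: (mulgI w0); rewrite mulgV w0K. Qed.

Lemma w0JK : involutive w0J.
Proof. by move=> x; rewrite /w0J !mulgA w0K mul1g -mulgA w0K mulg1. Qed.

Lemma w0JM x y : w0J (x * y) = (w0J x * w0J y)%g.
Proof.
rewrite /w0J -!mulgA; congr (_ * (_ * _))%g.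
by rewrite !mulgA w0K mul1g.
Qed.

Lemma w0J_V x : w0J (x^-1) = ((w0J x)^-1)%g.
Proof. by rewrite /w0J !invMg !w0V mulgA. Qed.

Lemma w0JE x i : w0J x i = rev_ord (x (rev_ord i)).
Proof. by rewrite /w0J !permM !w0E. Qed.

Lemma rev_ord_lt i j : (rev_ord i < rev_ord j)%N = (j < i)%N.
Proof. by rewrite /=; have := ltn_ord i; have := ltn_ord j; lia. Qed.

Lemma len_w0J x : len (w0J x) = len x.
Proof.
pose f (p : 'I_n * 'I_n) := (rev_ord p.2, rev_ord p.1).
have fK : involutive f by move=> [a b]; rewrite /f /= !rev_ordK.
rewrite /len -(card_imset _ (inv_inj fK)); apply: eq_card => -[a b].
have -> : ((a, b) \in [set f p | p in inversions (w0J x)]) =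
          (f (a, b) \in inversions (w0J x)).
  by rewrite -{1}(fK (a, b)) mem_imset //; apply: inv_inj.
rewrite !inE /f /= !w0JE !rev_ordK /=.
have := ltn_ord (x a); have := ltn_ord (x b).
by have := ltn_ord a; have := ltn_ord b; lia.
Qed.

(** Every simple transposition is a descent of w_0 on both sides, so for x simple both products fall
    in the quadratic case and have the same two terms. *)
Lemma T_w0_comm x : T w0 * T x = T (w0J x) * T w0.
Proof.
have Ts i j : adj i j ->
    T w0 * T (tperm i j) = T (tperm (rev_ord i) (rev_ord j)) * T w0.
  move=> ij; have ji : adj (rev_ord j) (rev_ord i).
    by rewrite /adj /= (eqP ij); have := ltn_ord j; rewrite (eqP ij) => h; apply/eqP; lia.
  rewrite [tperm (rev_ord i) _]tpermC T_mulTs // T_Tsmul // /mulT_Ts /Ts_mulT.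
  have h1 : ((w0^-1)%g i < (w0^-1)%g j)%N = false.
    by rewrite w0V !w0E rev_ord_lt ltnNge ltnW ?adj_lt.
  have h2 : (w0 (rev_ord j) < w0 (rev_ord i))%N = false.
    by rewrite !w0E !rev_ordK ltnNge ltnW ?adj_lt.
  rewrite h1 h2.
  have -> : (w0 * tperm i j = tperm (rev_ord j) (rev_ord i) * w0)%g.
    apply/permP => k; rewrite !permM !w0E tpermC.
    case: tpermP => [<-|<-|h3 h4]; rewrite ?rev_ordK ?tpermL ?tpermR ?rev_ordK //.
    by rewrite tpermD ?w0E // eq_sym -(inj_eq rev_ord_inj) rev_ordK; apply/eqP => e;
      [case: h3|case: h4].
  by [].
elim/perm_ind_left: x => [|i j x ij lt IH].
  by rewrite /w0J mulg1 w0K mul1r mulr1.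
rewrite T_mulS // mulrA Ts // -mulrA IH mulrA; congr (_ * _).
have ji : adj (rev_ord j) (rev_ord i).
  by rewrite /adj /= (eqP ij); have := ltn_ord j; rewrite (eqP ij) => h; apply/eqP; lia.
have -> : w0J (tperm i j * x) = (tperm (rev_ord j) (rev_ord i) * w0J x)%g.
  rewrite w0JM; congr (_ * _)%g; rewrite /w0J -{1}w0V tpermC.
  by rewrite -mulgA -[(_^-1 * _)%g]/(tperm j i ^ w0)%g tpermJ !w0E.
rewrite [tperm (rev_ord i) _]tpermC T_mulS //.
by rewrite !w0JE !rev_ordK rev_ord_lt.
Qed.

Variables (c : R).
Hypothesis c_quad : c ^+ 2 = (q - 1) * c + q.

Lemma reshape_index2 (a b i : nat) : (i < a + b)%N ->
  reshape_index [:: a; b] i = (a <= i)%N.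
Proof.
rewrite /reshape_index /= => lt; rewrite subn_eq0.
case: (leqP a i) => h; last by [].
by rewrite (_ : (_ == 0%N) = true) //; lia.
Qed.

Lemma reshape_index2_rev a b i j : (a + b = n)%N ->
  (reshape_index [:: b; a] (rev_ord i) == reshape_index [:: b; a] (rev_ord j)) =
  (reshape_index [:: a; b] i == reshape_index [:: a; b] j).
Proof.
move=> e; have := ltn_ord i; have := ltn_ord j => hj hi.
by rewrite !reshape_index2 ?e 1?addnC ?e ?ltn_ord //=; lia.
Qed.

(** By the trace property D may be replaced by its conjugate K D. As K only relabels the basis by x
    |-> w_0 x w_0, it carries the representatives and the Young subgroup of type (a, b) to those of
    type (b, a). Through [split_sum_ind] this yields the commutation of the E_k. *)
Lemma ind_char_swap a b D : (a + b = n)%N ->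
  ind_char (fun w => c ^+ len w) [:: a; b] D =
  ind_char (fun w => c ^+ len w) [:: b; a] D.
Proof.
move=> ab; have [V [V1 V2]] := T_unit w0.
pose K Z : H := T w0 * Z * V.
have KT x : K (T x) = T (w0J x) by rewrite /K T_w0_comm -mulrA V1 mulr1.
have KM Z Z' : K (Z * Z') = K Z * K Z'.
  by rewrite /K !mulrA -[T w0 * Z * V * _]mulrA V2 mulr1.
have Kc Z x : K Z (w0J x) = Z x.
  rewrite [Z]hecke_sum /K mulr_sumr mulr_suml !sum_ffunE; apply: eq_bigr => y _.
  rewrite -scalerAr -scalerAl -/(K (T y)) KT !ffunE.
  by rewrite (inj_eq (inv_inj w0JK)).
have -> : ind_char (fun w => c ^+ len w) [:: b; a] D =
    ind_char (fun w => c ^+ len w) [:: b; a] (K D).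
  by rewrite [RHS]ind_char_trace // mulrA V2 mul1r.
have yJ w : (w0J w \in young n [:: b; a]) = (w \in young n [:: a; b]).
  apply/youngP/youngP => h i.
    have /eqP := h (rev_ord i).
    by rewrite w0JE rev_ordK reshape_index2_rev // => /eqP.
  by apply/eqP; rewrite w0JE -{2}[i]rev_ordK reshape_index2_rev // h.
have cJ u : (w0J u \in coset_min n [:: b; a]) = (u \in coset_min n [:: a; b]).
  apply/coset_minP/coset_minP => h i j ij e.
    have := h (rev_ord j) (rev_ord i); rewrite -w0J_V !w0JE !rev_ordK !rev_ord_lt.
    by apply=> //; apply/eqP; rewrite reshape_index2_rev // e.
  rewrite -w0J_V !w0JE rev_ord_lt; apply: h; first by rewrite rev_ord_lt.
  by apply/eqP; rewrite -reshape_index2_rev // !rev_ordK e.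
rewrite !ind_charE [RHS](reindex_inj (inv_inj w0JK)) /=.
rewrite (eq_bigl _ _ cJ); apply: eq_bigr => u _.
rewrite [RHS](reindex_inj (inv_inj w0JK)) /= (eq_bigl _ _ yJ).
by apply: eq_bigr => w _; rewrite len_w0J -KT -KM -w0JM Kc.
Qed.

End LongestConjugation.

(** * Straightening words in the quantum matrix bialgebra *)

Section Value.
Variables (F : fieldType) (v : F) (n : nat).
Hypothesis v_neq0 : v != 0.
Local Notation H := (hecke (v ^+ 2) n).
Local Notation T := (@T F (v ^+ 2) n).
Implicit Types (i j k : 'I_n) (u w y x : 'S_n) (Z : H).

(* Normalized so that hval Z (y, u) and the words t_{y^-1, u^-1} below obey the same
   exchange rule; any word can thus be reduced to y = 1. *)
Definition hval Z y u : F := v ^+ len y * v ^- len u * (Z * T u) y.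

Lemma hval1 Z u : hval Z 1%g u = v ^+ len u * Z (u^-1)%g.
Proof.
rewrite /hval len1 expr0 mul1r T_mul_coef1 mulrA; congr (_ * _).
by rewrite -exprM mulnC exprM expr2 mulKf // expf_neq0.
Qed.

Lemma hval_swap Z y u i j : adj i j -> ((y^-1)%g i < (y^-1)%g j)%N ->
  hval Z (y * tperm i j) u =
    hval Z y (u * tperm i j)
    + (if ((u^-1)%g i < (u^-1)%g j)%N then 0 else (v - v^-1) * hval Z y u).
Proof.
move=> ij lty; set s := tperm i j.
have e : (Z * T u) (y * s)%g = v ^- 2 * (Z * (T u * T s)) y.
  by rewrite mulrA T_mul_coef // lty mulKf // expf_neq0.
rewrite /hval e T_mulTs // /mulT_Ts !len_sr // lty; case: ifPn => ltu.
  rewrite -/s addr0 !exprS expr0.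
  by field; rewrite v_neq0 expf_neq0.
have : (0 < len u)%N.
  by rewrite -lenV; apply: (len_gt0_desc ij); rewrite perm_ltN // eq_sym adj_neq.
rewrite -/s mulrDr -!scalerAr !ffunE /GRing.scale /=.
move: ((Z * T (u * s)) y) ((Z * T u) y) => a b.
case: (len u) => // l _ /=; rewrite !exprS.
by field; rewrite v_neq0 expf_neq0.
Qed.

End Value.

(** The lists are chosen before f, so that several words can be cut at the same two neighbouring
    places. *)
Lemma prod_adj (n : nat) (A : nzRingType) (i j : 'I_n) : adj i j ->
  exists s1 s2 : seq 'I_n, (forall k, k \in s1 ++ s2 -> k != i /\ k != j) /\
   forall f : 'I_n -> A, \prod_k f k =
     \prod_(k <- s1) f k * (f i * f j) * \prod_(k <- s2) f k.
Proof.
move=> ij; have ji : (j < n)%N by [].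
have e1 : enum 'I_n = take i (enum 'I_n) ++ i :: j :: drop j.+1 (enum 'I_n).
  rewrite -{1}(cat_take_drop i (enum 'I_n)); congr (_ ++ _).
  have sz : size (enum 'I_n) = n by rewrite size_enum_ord.
  rewrite (drop_nth i) ?sz // nth_ord_enum -(eqP ij) (drop_nth i) ?sz //.
  by rewrite nth_ord_enum.
exists (take i (enum 'I_n)), (drop j.+1 (enum 'I_n)); split.
  move=> k; have := enum_uniq 'I_n; rewrite {1}e1 mem_cat.
  rewrite cat_uniq => /and3P[_ /hasPn h1 /andP[h2 /andP[h3 _]]] /orP[hk|hk].
    split; apply: contraTneq hk => ->; apply: h1; rewrite !inE eqxx ?orbT //.
  split; first by apply: contraNneq h2 => <-; rewrite inE hk orbT.
  by apply: contraTneq hk => ->.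
move=> f; transitivity (\prod_(k <- enum 'I_n) f k); first by rewrite enumT.
by rewrite {1}e1 big_cat !big_cons /= !mulrA.
Qed.

Section Words.
Variables (F : fieldType) (v : F) (n : nat) (A : algType F).
Variable t : 'I_n -> 'I_n -> A.
Hypothesis v_neq0 : v != 0.
Hypothesis t_anti : forall i j k l : 'I_n, (i < j)%N -> (k < l)%N ->
  t j k * t i l = t i l * t j k.
Hypothesis t_diag : forall i j k l : 'I_n, (i < j)%N -> (k < l)%N ->
  t j l * t i k = t i k * t j l + (v - v^-1) *: (t i l * t j k).
Local Notation H := (hecke (v ^+ 2) n).
Local Notation T := (@T F (v ^+ 2) n).
Implicit Types (i j k : 'I_n) (u w y x : 'S_n) (Z : H).

Definition perm_word y u : A := \prod_k t ((y^-1)%g k) ((u^-1)%g k).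

Lemma perm_word1 u : perm_word 1 u = \prod_k t k ((u^-1)%g k).
Proof. by apply: eq_bigr => k _; rewrite invg1 perm1. Qed.

(** The letters at places i and j are exchanged by [t_anti] if their columns increase in [u], and by
    [t_diag] otherwise. *)
Lemma perm_word_swap y u i j : adj i j -> ((y^-1)%g i < (y^-1)%g j)%N ->
  perm_word (y * tperm i j) u =
    perm_word y (u * tperm i j)
    + (if ((u^-1)%g i < (u^-1)%g j)%N then 0 else (v - v^-1) *: perm_word y u).
Proof.
move=> ij lty; have [s1 [s2 [hs hp]]] := prod_adj A ij.
rewrite /perm_word !hp !invMg tpermV !permM tpermL tpermR.
pose f x k := (x^-1)%g k.
have ts (x : 'S_n) (k : 'I_n) : k \in s1 ++ s2 -> (tperm i j * x)%g k = x k.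
  by move=> /hs[h1 h2]; rewrite permM tpermD // eq_sym.
have e1 (x x' : 'S_n) (s : seq 'I_n) : {subset s <= s1 ++ s2} ->
    \prod_(k <- s) t ((tperm i j * x)%g k) (x' k) = \prod_(k <- s) t (x k) (x' k).
  by move=> sub; rewrite !big_seq; apply: eq_bigr => k /sub hk; rewrite ts.
have e2 (x x' : 'S_n) (s : seq 'I_n) : {subset s <= s1 ++ s2} ->
    \prod_(k <- s) t (x k) ((tperm i j * x')%g k) = \prod_(k <- s) t (x k) (x' k).
  by move=> sub; rewrite !big_seq; apply: eq_bigr => k /sub hk; rewrite ts.
have sub1 : {subset s1 <= s1 ++ s2} by move=> k h; rewrite mem_cat h.
have sub2 : {subset s2 <= s1 ++ s2} by move=> k h; rewrite mem_cat h orbT.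
rewrite !e1 // !e2 //; case: ifPn => ltu.
  by rewrite addr0 (t_anti lty ltu).
have ltu' : ((u^-1)%g j < (u^-1)%g i)%N by rewrite perm_ltN // eq_sym adj_neq.
rewrite (t_diag lty ltu') mulrDr mulrDl; congr (_ + _).
by rewrite -scalerAr -scalerAl.
Qed.

(** Straightening of any word into the t^{e,w}: both sides obey the same exchange rule in y, and at
    y = 1 only the term w = u^-1 is left. *)
Lemma perm_word_expand y u :
  \sum_w (v ^- len w * hval (T w : H) y u) *: \prod_k t k (w k) = perm_word y u.
Proof.
elim/perm_ind_right: y u => [|i j y ij lty IH] u.
  rewrite perm_word1 (bigD1 (u^-1)%g) //= [X in _ + X]big1 ?addr0 => [|w /negPf ne].
    by rewrite hval1 // ffunE eqxx mulr1 lenV mulVf ?expf_neq0 // scale1r.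
  by rewrite hval1 // ffunE eq_sym ne !mulr0 scale0r.
rewrite perm_word_swap // -!IH; case: ifP => ltu.
  by rewrite addr0; apply: eq_bigr => w _; rewrite hval_swap // ltu addr0.
rewrite scaler_sumr -big_split; apply: eq_bigr => w _ /=.
by rewrite hval_swap // ltu scalerA -scalerDl; congr (_ *: _); ring.
Qed.

End Words.

(** * Quantum minors *)

Section OrdinalSets.
Variable n : nat.
Implicit Types (i j k m a b : 'I_n) (J K : {set 'I_n}).

Definition nlt K a := #|[set k in K | (k < a)%N]|.
Definition ngt K a := #|[set k in K | (a < k)%N]|.

Lemma nltD1 K a b : b \in K -> nlt K a = ((b < a) + nlt (K :\ b) a)%N.
Proof.
move=> bK; rewrite /nlt (cardsD1 b) !inE bK /=; congr (_ + _)%N.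
by apply: eq_card => k; rewrite !inE andbA.
Qed.

Lemma ngtD1 K a b : b \in K -> ngt K a = ((a < b) + ngt (K :\ b) a)%N.
Proof.
move=> bK; rewrite /ngt (cardsD1 b) !inE bK /=; congr (_ + _)%N.
by apply: eq_card => k; rewrite !inE andbA.
Qed.

Lemma nlt_ngt_exchange K a b : a \in K -> b \in K ->
  (nlt K a + ngt (K :\ a) b = ngt K b + nlt (K :\ b) a)%N.
Proof. by move=> aK bK; rewrite (nltD1 a bK) (ngtD1 b aK); lia. Qed.

Lemma nltU1 K m a : (a <= m)%N -> nlt (m |: K) a = nlt K a.
Proof.
move=> am; apply: eq_card => k; rewrite !inE.
by case: eqVneq => //= ->; rewrite ltnNge am andbF.
Qed.

Lemma nlt_max K m : (forall k, k \in K -> (k < m)%N) -> nlt K m = #|K|.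
Proof.
move=> Km; apply: eq_card => k; rewrite !inE.
by case: (boolP (k \in K)) => // /Km ->.
Qed.

Lemma ngt_max K m : (forall k, k \in K -> (k < m)%N) -> ngt K m = 0%N.
Proof.
move=> Km; apply/eqP; rewrite cards_eq0; apply/eqP/setP => k; rewrite !inE.
by case: (boolP (k \in K)) => // /Km lt; rewrite ltnNge ltnW.
Qed.

Lemma sum_setD1_exchange (V : nmodType) K (G : 'I_n -> 'I_n -> V) :
  \sum_(a in K) \sum_(b in K :\ a) G a b = \sum_(b in K) \sum_(a in K :\ b) G a b.
Proof.
rewrite (exchange_big_dep (mem K)) /=; last by move=> a b _; rewrite !inE => /andP[].
apply: eq_bigr => b bK; apply: eq_bigl => a.
by rewrite !inE bK andbT eq_sym andbC.
Qed.

Lemma sum_setD1_pairs (V : nmodType) K (G : 'I_n -> 'I_n -> V) :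
  \sum_(a in K) \sum_(b in K :\ a) G a b =
  \sum_(a in K) \sum_(b in K | (a < b)%N) (G a b + G b a).
Proof.
pose S := \sum_(a in K) \sum_(b in K | (a < b)%N) G b a.
transitivity (\sum_(a in K) \sum_(b in K | (a < b)%N) G a b + S); last first.
  by rewrite -big_split; apply: eq_bigr => a aK; rewrite big_split.
have -> : S = \sum_(a in K) \sum_(b in K | (b < a)%N) G a b.
  rewrite /S (exchange_big_dep (mem K)) //=; last by move=> a b _ /andP[].
  apply: eq_bigr => b bK; apply: eq_bigl => a.
  by rewrite bK.
rewrite -big_split; apply: eq_bigr => a aK /=.
rewrite (bigID (fun b => (a < b)%N)) /=; congr (_ + _); apply: eq_bigl => b; rewrite !inE.
  by case: (ltngtP a b) => [lt|lt|/val_inj ->] //=; rewrite ?andbF ?andbT //;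
    apply: andb_idl => _; apply: contraTneq lt => ->; rewrite ltnn.
case: (ltngtP a b) => [lt|lt|/val_inj ->] //=; rewrite ?andbF ?andbT ?eqxx //.
by apply: andb_idl => _; apply: contraTneq lt => ->; rewrite ltnn.
Qed.

Lemma enum_set_sorted K : sorted (fun i j : 'I_n => (i < j)%N) (enum K).
Proof.
rewrite /enum_mem -enumT; apply: sorted_filter; first by move=> a b c; apply: ltn_trans.
have := iota_ltn_sorted 0 n; rewrite -val_enum_ord.
by rewrite sorted_map.
Qed.

Lemma eq_enum_set K (s : seq 'I_n) :
  sorted (fun i j : 'I_n => (i < j)%N) s -> s =i K -> enum K = s.
Proof.
move=> ss sK; apply: (@irr_sorted_eq _ (fun i j : 'I_n => (i < j)%N)) => //.
- by move=> a b c; apply: ltn_trans.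
- by move=> a; rewrite ltnn.
- exact: enum_set_sorted.
- by move=> k; rewrite mem_enum sK.
Qed.

Lemma enum_setU1_max K m : (forall k, k \in K -> (k < m)%N) ->
  enum (m |: K) = rcons (enum K) m.
Proof.
move=> Km; apply: eq_enum_set => [|k]; last by rewrite mem_rcons !inE mem_enum.
have tr : transitive (fun i j : 'I_n => (i < j)%N) by move=> a b c; apply: ltn_trans.
rewrite sorted_pairwise // pairwise_rcons -sorted_pairwise // enum_set_sorted andbT.
by apply/allP => k; rewrite mem_enum; apply: Km.
Qed.

Lemma set_max_ind (P : {set 'I_n} -> Prop) : P set0 ->
  (forall m K, (forall k, k \in K -> (k < m)%N) -> P K -> P (m |: K)) ->
  forall K, P K.
Proof.
move=> P0 PU K; have [c] := ubnP #|K|; elim: c K => // c IH K le.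
have [->//|[x xK]] := set_0Vmem K.
case: (@arg_maxnP _ x (mem K) (fun k : 'I_n => k : nat) xK) => m mK mmax.
have mK' : m \in K by [].
rewrite -(setD1K mK'); apply: PU => [k|].
  rewrite !inE => /andP[ne kK]; have : (k <= m)%N by apply: mmax.
  by rewrite leq_eqVlt val_eqE (negPf ne).
by apply: IH; move: le; rewrite (cardsD1 m) mK' add1n ltnS.
Qed.

Lemma sum_subsetU1 (V : nmodType) m J (G : {set 'I_n} -> V) : m \notin J ->
  \sum_(K : {set 'I_n} | K \subset m |: J) G K =
  \sum_(K : {set 'I_n} | K \subset J) G K + \sum_(K : {set 'I_n} | K \subset J) G (m |: K).
Proof.
move=> mJ; rewrite (bigID (fun K : {set 'I_n} => m \in K)) /= addrC; congr (_ + _).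
  apply: eq_bigl => K; rewrite -subsetD1 setU1K //.
rewrite (reindex_onto (fun K => m |: K) (fun K => K :\ m)) /=; last first.
  by move=> K /andP[_ mK]; rewrite setD1K.
apply: eq_bigl => K; rewrite setU11 andbT.
apply/andP/idP => [[sub /eqP <-]|sub].
  by rewrite subDset.
by rewrite setUS // setU1K //; apply: contra mJ; apply: (subsetP sub).
Qed.

End OrdinalSets.

(** * Laplace expansions, and the recursion between diagonal words and minors *)

Section Minors.
Variables (F : fieldType) (kap z : F) (n : nat) (A : algType F).
Variable t : 'I_n -> 'I_n -> A.
Hypothesis z_quad : z ^+ 2 = kap * z + 1.
Hypothesis t_anti : forall i j k l : 'I_n, (i < j)%N -> (k < l)%N ->
  t j k * t i l = t i l * t j k.
Hypothesis t_diag : forall i j k l : 'I_n, (i < j)%N -> (k < l)%N ->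
  t j l * t i k = t i k * t j l + kap *: (t i l * t j k).
Implicit Types (i j k m a b c d : 'I_n) (J K : {set 'I_n}) (cs : seq 'I_n).

(* The minor with row set K and column sequence cs: for z = - q^{-1/2} a
   quantum minor, for z = q^{1/2} a quantum permanent. *)
Fixpoint minor cs K : A :=
  if cs is c :: cs' then \sum_(a in K) z ^+ nlt K a *: (t a c * minor cs' (K :\ a))
  else 1.

(** Laplace expansion along the last column, whereas the definition expands along the first one.
    Both are performed, and [nlt_ngt_exchange] shows that the weight does not depend on their
    order. *)
Lemma minor_rcons cs m K : #|K| = (size cs).+1 ->
  minor (rcons cs m) K = \sum_(b in K) z ^+ ngt K b *: (minor cs (K :\ b) * t b m).
Proof.
elim: cs K => [|c cs IH] K /= sK.
  have /cards1P[x ->] : #|K| == 1%N by rewrite sK.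
  rewrite !big_set1 mulr1 mul1r; congr (_ ^+ _ *: _).
  rewrite /nlt /ngt; apply: eq_card => k; rewrite !inE.
  by case: eqVneq => // ->; rewrite ltnn.
transitivity (\sum_(a in K) \sum_(b in K :\ a)
    z ^+ (nlt K a + ngt (K :\ a) b) *: (t a c * minor cs (K :\ a :\ b) * t b m)).
  apply: eq_bigr => a aK; rewrite IH; last first.
    by apply/eqP; move: sK; rewrite (cardsD1 a) aK add1n => -[->].
  rewrite mulr_sumr scaler_sumr; apply: eq_bigr => b bK.
  by rewrite -scalerAr scalerA exprD mulrA.
rewrite sum_setD1_exchange; apply: eq_bigr => b bK.
rewrite mulr_suml scaler_sumr; apply: eq_bigr => a; rewrite !inE => /andP[ab aK].
by rewrite -scalerAl scalerA -exprD nlt_ngt_exchange // setDDl setUC -setDDl.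
Qed.

(** Grouping the rows of the two columns in pairs a < b reduces the claim to a 2 x 2 minor; after
    [t_diag] and [t_anti] it is the relation z^2 = kap z + 1. *)
Lemma minor_swap c d cs K : (d < c)%N ->
  minor (c :: d :: cs) K = z *: minor (d :: c :: cs) K.
Proof.
move=> dc.
pose M a b := minor cs (K :\ a :\ b).
have MC a b : M a b = M b a by rewrite /M setDDl setUC -setDDl.
have E2 c' d' : minor (c' :: d' :: cs) K = \sum_(a in K) \sum_(b in K | (a < b)%N)
    z ^+ (nlt K a + nlt (K :\ a) b) *: ((t a c' * t b d' + z *: (t b c' * t a d')) * M a b).
  rewrite /=.
  transitivity (\sum_(a in K) \sum_(b in K :\ a) z ^+ (nlt K a + nlt (K :\ a) b) *:
      (t a c' * t b d' * M a b)).
    apply: eq_bigr => a aK; rewrite mulr_sumr scaler_sumr.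
    by apply: eq_bigr => b bK; rewrite -scalerAr scalerA exprD mulrA.
  rewrite sum_setD1_pairs; apply: eq_bigr => a aK.
  apply: eq_bigr => b /andP[bK ab].
  have -> : (nlt K b + nlt (K :\ b) a = (nlt K a + nlt (K :\ a) b).+1)%N.
    by rewrite (nltD1 b aK) (nltD1 a bK) ab [(b < a)%N]ltnNge (ltnW ab) /= add0n add1n addSn addnC.
  by rewrite (MC b a) exprSr mulrDl scalerDr -scalerAl scalerA.
rewrite !E2 scaler_sumr; apply: eq_bigr => a aK.
rewrite scaler_sumr; apply: eq_bigr => b /andP[bK ab].
rewrite scalerA mulrC -scalerA; congr (_ *: _).
rewrite [RHS]scalerAl; congr (_ * _).
rewrite (t_diag ab dc) (t_anti ab dc) !scalerDr !scalerA addrC -addrA; congr (_ + _).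
by rewrite -[X in _ + X]scale1r -scalerDl -expr2 z_quad [z * kap]mulrC.
Qed.

Lemma minor_move m cs K : (forall c, c \in cs -> (c < m)%N) ->
  minor (m :: cs) K = z ^+ size cs *: minor (rcons cs m) K.
Proof.
elim: cs K => [|c cs IH] K cm; first by rewrite scale1r.
rewrite minor_swap ?cm ?inE ?eqxx // exprS -scalerA; congr (_ *: _).
rewrite rcons_cons [LHS]/= [in RHS]/= scaler_sumr; apply: eq_bigr => a aK.
rewrite -/(minor (m :: cs) (K :\ a)) IH; last by move=> x h; apply: cm; rewrite inE h orbT.
by rewrite -scalerAr !scalerA mulrC.
Qed.

(** The corner t_{m,m} is moved through the minor one column at a time, each passage leaving a
    correction by [t_diag]. *)
Lemma corner_minor m cs K : (forall k, k \in K -> (k < m)%N) ->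
  (forall c, c \in cs -> (c < m)%N) -> #|K| = size cs ->
  t m m * minor cs K = minor cs K * t m m +
    kap *: \sum_(b in K) z ^+ ngt K b *: (minor cs (m |: (K :\ b)) * t b m).
Proof.
elim: cs K => [|c cs IH] K Km cm sK.
  have -> : K = set0 by apply: cards0_eq.
  by rewrite big_set0 scaler0 addr0 /= mul1r mulr1.
have cm' : c \in c :: cs by rewrite inE eqxx.
have csm x : x \in cs -> (x < m)%N by move=> h; apply: cm; rewrite inE h orbT.
have sD a : a \in K -> #|K :\ a| = size cs.
  by move=> aK; move: sK; rewrite (cardsD1 a) aK add1n => -[].
have mK : m \notin K by apply/negP => /Km; rewrite ltnn.
(* By [t_anti] the corrections t_{a,m} t_{m,c} become t_{m,c} t_{a,m}, and collect into a minor
   whose first column is m; that column is then moved to the end. *)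
transitivity (\sum_(a in K) z ^+ nlt K a *: (t a c * (t m m * minor cs (K :\ a)))
   + kap *: (t m c * minor (m :: cs) K)).
  rewrite /= !mulr_sumr scaler_sumr -big_split; apply: eq_bigr => a aK /=.
  rewrite -!scalerAr [t m m * (_ * _)]mulrA (t_diag (Km _ aK) (cm _ cm')).
  rewrite mulrDl scalerDr -[t a c * _ * _]mulrA; congr (_ + _).
  rewrite -(t_anti (Km _ aK) (cm _ cm')) -scalerAl !scalerA mulrA.
  by rewrite [kap * _]mulrC.
rewrite minor_move // minor_rcons //.
transitivity (minor (c :: cs) K * t m m + kap *: (
    \sum_(a in K) \sum_(b in K :\ a) z ^+ (nlt K a + ngt (K :\ a) b) *:
       (t a c * minor cs (m |: (K :\ a :\ b)) * t b m) +
    z ^+ size cs *: \sum_(b in K) z ^+ ngt K b *: (t m c * minor cs (K :\ b) * t b m))).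
  rewrite scalerDr addrA; congr (_ + _); last first.
    congr (_ *: _); rewrite -scalerAr mulr_sumr; congr (_ *: _).
    by apply: eq_bigr => b bK; rewrite -scalerAr mulrA.
  rewrite /= mulr_suml scaler_sumr -big_split; apply: eq_bigr => a aK /=.
  rewrite IH ?sD //; last by move=> k; rewrite !inE => /andP[_ /Km].
  rewrite mulrDr scalerDr -scalerAl mulrA; congr (_ + _).
  rewrite -scalerAr scalerA mulrC -scalerA; congr (_ *: _).
  rewrite mulr_sumr scaler_sumr; apply: eq_bigr => b bK.
  by rewrite -scalerAr scalerA exprD mulrA.
congr (_ + _ *: _); rewrite sum_setD1_exchange scaler_sumr -big_split.
apply: eq_bigr => b bK /=.
have mKb : m \notin K :\ b by rewrite !inE (negPf mK) andbF.
(* Row m exceeds all other rows, hence carries the weight z^(size cs); the other rows account for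
   the double sum. *)
rewrite (big_setU1 _ mKb) /= mulrDl scalerDr addrC; congr (_ + _).
  rewrite nltU1 // nlt_max ?sD // => [|k]; last by rewrite !inE => /andP[_ /Km].
  by rewrite setU1K // -scalerAl !scalerA mulrC.
rewrite mulr_suml scaler_sumr; apply: eq_bigr => a; rewrite !inE => /andP[ab aK].
rewrite nltU1 ?(ltnW (Km _ aK)) // -scalerAl scalerA -exprD nlt_ngt_exchange //.
congr (_ *: (_ * minor _ _ * _)); apply/setP => k; rewrite !inE.
case: (eqVneq k m) => [->|_] /=; last by rewrite andbCA.
by rewrite andbT (_ : m != a) //; apply: contraNneq mK => ->.
Qed.

Definition diag_word (s : seq 'I_n) : A := \prod_(i <- s) t i i.

Definition principal K : A := minor (enum K) K.

(** Let m be the maximum of the set. Moving t_{m,m} through the principal minor of K leaves kap S,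
    and expanding the principal minor of m |: K along column m leaves y z S beside y times the main
    term; the choice of y makes the two corrections cancel, and the main terms combine to the factor
    1 + y. *)
Lemma minor_diag_sum (y : F) J : y * z = - kap ->
  \sum_(K : {set 'I_n} | K \subset J)
     y ^+ #|K| *: (diag_word (enum (J :\: K)) * principal K) =
  (1 + y) ^+ #|J| *: diag_word (enum J).
Proof.
move=> yz; elim/set_max_ind: J => [|m J Jm IH].
  rewrite (big_pred1 set0) => [|K]; last by rewrite /= subset0.
  rewrite cards0 !expr0 !scale1r setD0 /principal /diag_word.
  by rewrite enum_set0 big_nil mul1r.
have mJ : m \notin J by apply/negP => /Jm; rewrite ltnn.
rewrite sum_subsetU1 // -big_split /=.
have diagU (L : {set 'I_n}) : L \subset J -> diag_word (enum (m |: L)) = diag_word (enum L) * t m m.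
  move=> /subsetP LJ; rewrite enum_setU1_max; last by move=> k /LJ /Jm.
  by rewrite /diag_word -cats1 big_cat big_seq1.
transitivity (\sum_(K : {set 'I_n} | K \subset J)
    (1 + y) *: (y ^+ #|K| *: (diag_word (enum (J :\: K)) * principal K) * t m m)).
  apply: eq_bigr => K KJ; have /subsetP KJ' := KJ.
  have Km k : k \in K -> (k < m)%N by move=> /KJ' /Jm.
  have mK : m \notin K by apply/negP => /Km; rewrite ltnn.
  have -> : (m |: J) :\: K = m |: (J :\: K).
    by apply/setP => k; rewrite !inE; case: eqVneq => [->|_] //=; rewrite mK.
  have -> : (m |: J) :\: (m |: K) = J :\: K.
    by apply/setP => k; rewrite !inE; case: eqVneq => [->|_] //=; rewrite (negPf mJ) andbF.
  rewrite diagU ?subsetDl // cardsU1 mK add1n -mulrA.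
  rewrite {1 2}/principal corner_minor //; last first.
  - by rewrite -cardE.
  - by move=> c; rewrite mem_enum; apply: Km.
  rewrite enum_setU1_max // minor_rcons; last by rewrite cardsU1 mK -cardE.
  rewrite (big_setU1 _ mK) /= setU1K //.
  have ngtm : ngt (m |: K) m = 0%N.
    rewrite (@ngtD1 _ _ _ m) ?setU11 // setU1K // ltnn ngt_max //.
  rewrite ngtm scale1r.
  set S := \sum_(b in K) _; set S' := \sum_(b in K) _.
  (* The extra row m is larger than every b in K, hence one more factor z. *)
  have -> : S' = z *: S.
    rewrite scaler_sumr; apply: eq_bigr => b bK.
    have bm := Km _ bK; have nbm : b != m by apply: contraTneq bm => ->; rewrite ltnn.
    rewrite (@ngtD1 _ (m |: K) b m) ?setU11 // setU1K // bm exprS scalerA.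
    congr (_ *: (minor _ _ * _)); apply/setP => k; rewrite !inE.
    by case: (eqVneq k m) => [->|//]; rewrite eq_sym nbm.
  rewrite exprS /principal; clear -yz.
  move: (diag_word _) (minor _ _) (t m m) (y ^+ _) => d p tm yk.
  rewrite !mulrDr !scalerDr -!scalerAr !scalerA addrACA.
  rewrite [y * yk]mulrC -[yk * y * z]mulrA yz mulrN scaleNr addrN addr0 -scalerDl.
  by rewrite mulrA -scalerAl scalerA; congr (_ *: _); ring.
rewrite -scaler_sumr -mulr_suml IH -scalerAl scalerA -exprS cardsU1 mJ add1n.
by rewrite diagU.
Qed.

Definition rev_diag_word (s : seq 'I_n) : A := \prod_(i <- rev s) t i i.

(** Sign-reversing involution: the maximum m of J ends the increasing word or begins the decreasing
    one, giving the same word with opposite signs. *)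
Lemma diag_rev_diag_sum J : J != set0 ->
  \sum_(K : {set 'I_n} | K \subset J)
     (-1) ^+ #|K| *: (diag_word (enum K) * rev_diag_word (enum (J :\: K))) = 0.
Proof.
elim/set_max_ind: J => [|m J Jm _ _]; first by rewrite eqxx.
have mJ : m \notin J by apply/negP => /Jm; rewrite ltnn.
rewrite sum_subsetU1 // -big_split big1 //= => K KJ.
have /subsetP KJ' := KJ.
have Km k : k \in K -> (k < m)%N by move=> /KJ' /Jm.
have mK : m \notin K by apply/negP => /Km; rewrite ltnn.
have -> : (m |: J) :\: K = m |: (J :\: K).
  by apply/setP => k; rewrite !inE; case: eqVneq => [->|_] //=; rewrite mK.
have -> : (m |: J) :\: (m |: K) = J :\: K.
  by apply/setP => k; rewrite !inE; case: eqVneq => [->|_] //=; rewrite (negPf mJ) andbF.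
rewrite cardsU1 mK add1n !enum_setU1_max //; last first.
  by move=> k; rewrite inE => /andP[_ /Jm].
rewrite /rev_diag_word rev_rcons big_cons /diag_word -cats1 big_cat big_seq1 /=.
by rewrite mulrA exprS mulN1r scaleNr addrN.
Qed.

End Minors.

(** * Block-increasing words *)

Section ListInversions.
Variable n : nat.
Implicit Types (i j k a b : 'I_n) (r s : seq 'I_n) (J K : {set 'I_n}) (x y u w : 'S_n).

Fixpoint seq_inv s : nat :=
  if s is a :: s' then count (fun b : 'I_n => (b < a)%N) s' + seq_inv s' else 0%N.

Lemma seq_inv_sorted s : sorted (fun i j : 'I_n => (i < j)%N) s -> seq_inv s = 0%N.
Proof.
have tr : transitive (fun i j : 'I_n => (i < j)%N) by move=> a b c; apply: ltn_trans.
rewrite sorted_pairwise //; elim: s => //= a s IH /andP[/allP h /IH ->].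
rewrite addn0; apply/eqP; rewrite eqn0Ngt -has_count; apply/hasPn => b /h.
by rewrite -leqNgt => /ltnW.
Qed.

Lemma seq_inv_cat r s : seq_inv (r ++ s) =
  (seq_inv r + seq_inv s + sumn [seq count (fun b : 'I_n => (b < a)%N) s | a <- r])%N.
Proof. by elim: r => [|a r IH] /=; rewrite ?addn0 // IH count_cat; lia. Qed.

(** The inversions between the two halves depend only on their contents; the equality is written
    without subtraction. *)
Lemma seq_inv_perm_cat r r' s s' : perm_eq r r' -> perm_eq s s' ->
  (seq_inv (r ++ s) + seq_inv r' + seq_inv s' =
   seq_inv (r' ++ s') + seq_inv r + seq_inv s)%N.
Proof.
move=> pr ps; rewrite !seq_inv_cat.
have -> : sumn [seq count (fun b : 'I_n => (b < a)%N) s | a <- r] =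
          sumn [seq count (fun b : 'I_n => (b < a)%N) s' | a <- r'].
  rewrite (eq_map (g := fun a => count (fun b : 'I_n => (b < a)%N) s')); last first.
    by move=> a; apply: (seq.permP ps).
  by apply: perm_sumn; apply: perm_map.
by lia.
Qed.

Definition perm_seq y : seq 'I_n := [seq y k | k <- enum 'I_n].

Lemma perm_seq_inj : injective perm_seq.
Proof.
move=> x y e; apply/permP => k.
by move/eq_in_map: e => -> //; rewrite mem_enum.
Qed.

Lemma size_perm_seq y : size (perm_seq y) = n.
Proof. by rewrite size_map size_enum_ord. Qed.

Lemma perm_seq_perm y : perm_eq (perm_seq y) (enum 'I_n).
Proof.
apply: uniq_perm; rewrite ?enum_uniq //.
  by rewrite map_inj_uniq ?enum_uniq //; apply: perm_inj.
move=> k; rewrite mem_enum; apply/mapP; exists ((y^-1)%g k); rewrite ?mem_enum //.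
by rewrite permKV.
Qed.

Lemma perm_seqP s : perm_eq s (enum 'I_n) -> exists y, s = perm_seq y.
Proof.
move=> ps; have sz : size s = n by rewrite (perm_size ps) size_enum_ord.
have us : uniq s by rewrite (perm_uniq ps) enum_uniq.
pose f k := nth k s k.
have fI : injective f.
  move=> a b; rewrite /f (set_nth_default a b) ?sz //.
  by move/eqP; rewrite nth_uniq ?sz // => /eqP/val_inj.
exists (perm fI); case: (posnP n) => [n0|n_gt0].
  by rewrite (size0nil (etrans sz n0)) (size0nil (etrans (size_perm_seq _) n0)).
pose k0 := Ordinal n_gt0; apply: (@eq_from_nth _ k0); first by rewrite size_perm_seq.
move=> i; rewrite sz => lt; rewrite (nth_map k0) ?size_enum_ord //.
have -> : nth k0 (enum 'I_n) i = Ordinal lt.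
  by apply: val_inj; rewrite /= nth_enum_ord.
by rewrite permE /f (set_nth_default k0) ?sz.
Qed.

Lemma nth_perm_seq y k0 k : nth k0 (perm_seq y) k = y k.
Proof. by rewrite (nth_map k0) ?size_enum_ord // nth_ord_enum. Qed.

Lemma len_perm_seq y : len y = seq_inv (perm_seq y).
Proof.
have h s : sorted (fun i j : 'I_n => (i < j)%N) s ->
    seq_inv [seq y k | k <- s] = (\sum_(i <- s) \sum_(j <- s) ((i < j) && (y j < y i)))%N.
  have tr : transitive (fun i j : 'I_n => (i < j)%N) by move=> a b c; apply: ltn_trans.
  rewrite sorted_pairwise //; elim: s => [|a s IH] /=; first by rewrite big_nil.
  move=> /andP[/allP h /IH ->]; rewrite !big_cons ltnn /= add0n; congr (_ + _)%N.
    rewrite count_map -sum1_count big_mkcond /= big_seq [RHS]big_seq.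
    by apply: eq_bigr => b /h ->.
  rewrite big_seq [RHS]big_seq; apply: eq_bigr => b /h lt.
  by rewrite big_cons [(b < a)%N]ltnNge (ltnW lt).
rewrite /perm_seq h; last first.
  have := iota_ltn_sorted 0 n; rewrite -val_enum_ord.
  by rewrite sorted_map.
rewrite big_enum /= (eq_bigr (fun i => (\sum_(j < n) ((i < j) && (y j < y i)))%N)); last first.
  by move=> i _; rewrite big_enum.
rewrite pair_big /= /len -sum1_card big_mkcond /=; apply: eq_bigr => -[i j] _.
by rewrite inE /=; case: ifP.
Qed.

End ListInversions.

Section BlockLists.
Variable n : nat.
Implicit Types (i j k : 'I_n) (a : nat) (R C r s : seq 'I_n) (J K : {set 'I_n}).
Implicit Types (al : seq nat) (x y u w : 'S_n).
Local Notation blk := reshape_index.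

(* The pairs (rows, columns) of words met when expanding a product of principal
   minors of sizes al over all splittings of J. *)
Definition block_heads a J : seq ({set 'I_n} * seq 'I_n) :=
  [seq (K, r) | K <- enum [set K : {set 'I_n} | (K \subset J) && (#|K| == a)],
                r <- permutations (enum K)].

Definition block_join (q : {set 'I_n} * seq 'I_n) (p : seq 'I_n * seq 'I_n) :=
  (q.2 ++ p.1, enum q.1 ++ p.2).

Fixpoint block_lists al J : seq (seq 'I_n * seq 'I_n) :=
  if al is a :: al' then
    [seq block_join q p | q <- block_heads a J, p <- block_lists al' (J :\: q.1)]
  else if J == set0 then [:: ([::], [::])] else [::].

Lemma block_lists_perm al J p : p \in block_lists al J ->
  [/\ perm_eq p.1 p.2, perm_eq p.2 (enum J) & (seq_inv p.2 <= seq_inv p.1)%N].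
Proof.
elim: al J p => [|a al IH] J p /=.
  by case: eqP => // ->; rewrite inE => /eqP -> /=; rewrite enum_set0.
case/allpairsPdep => q [[R C] [/allpairsPdep[K [r [+ + ->]]] /IH/= [h1 h2 h3] ->]] /=.
rewrite mem_enum inE mem_permutations => /andP[KJ _] pr; split.
- by rewrite perm_cat.
- apply: perm_trans (perm_cat (perm_refl _) h2) _.
  apply: uniq_perm; rewrite ?enum_uniq ?cat_uniq ?enum_uniq //= ?andbT.
    by apply/hasPn => k; rewrite !mem_enum !inE => /andP[].
  move=> k; rewrite mem_cat !mem_enum !inE; case: (boolP (k \in K)) => //= kK.
  by rewrite (subsetP KJ).
- have := seq_inv_perm_cat pr h1.
  rewrite (seq_inv_sorted (enum_set_sorted K)) addn0 => e.
  have aux (x y c d f : nat) : (x + c = y + d + f -> c <= f -> y <= x)%N by lia.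
  exact: aux e h3.
Qed.

Lemma block_lists_uniq al J : uniq (block_lists al J).
Proof.
elim: al J => [|a al IH] J /=; first by case: ifP.
apply: allpairs_uniq_dep => //.
  apply: allpairs_uniq_dep; rewrite ?enum_uniq //.
    by move=> K _; apply: permutations_uniq.
  by move=> [K r] [K' r'] _ _ /= [-> ->].
have sz K r : K \in enum [set K : {set 'I_n} | (K \subset J) && (#|K| == a)] ->
    r \in permutations (enum K) -> size (enum K) = a /\ size r = a.
  rewrite mem_enum inE mem_permutations => /andP[_ /eqP ca] /perm_size ->.
  by rewrite -cardE.
move=> p1 p2 /allpairsPdep[q1 [f1 [hq1 _ ->]]] /allpairsPdep[q2 [f2 [hq2 _ ->]]].
case/allpairsPdep: hq1 f1 => K [r [hK hr ->]] [R C].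
case/allpairsPdep: hq2 f2 => K' [r' [hK' hr' ->]] [R' C'].
have [s1 s2] := sz _ _ hK hr; have [s3 s4] := sz _ _ hK' hr'.
move=> /= [/eqP e1 /eqP e2]; move: e1 e2; rewrite !eqseq_cat ?s1 ?s2 //.
move=> /andP[/eqP -> /eqP ->] /andP[/eqP e /eqP ->].
have -> // : K = K' by apply/setP => k; rewrite -[LHS]mem_enum -[RHS]mem_enum e.
Qed.

(** Recognizes the members of [block_lists] by position, as a bridge to the description by Young
    subgroups and coset representatives. *)
Fixpoint blocks_ok al R C : bool :=
  if al is a :: al' then
    [&& sorted (fun i j : 'I_n => (i < j)%N) (take a C), size (take a C) == a,
        perm_eq (take a R) (take a C) & blocks_ok al' (drop a R) (drop a C)]
  else (R == [::]) && (C == [::]).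

Lemma mem_block_lists al J R C :
  ((R, C) \in block_lists al J) = blocks_ok al R C && perm_eq C (enum J).
Proof.
elim: al J R C => [|a al IH] J R C /=.
  apply/idP/idP => [|/andP[/andP[/eqP -> /eqP ->]]].
    by case: eqP => // ->; rewrite inE enum_set0 => /eqP[-> ->].
  move=> /perm_size/esym/size0nil e; case: eqP => [_|]; first by rewrite inE.
  by case; apply/setP => k; rewrite -mem_enum e inE.
apply/idP/idP.
  move=> h; have /= := @block_lists_perm (a :: al) J _ h; case=> _ -> _; rewrite andbT.
  case/allpairsPdep: h => q [[R' C'] [/allpairsPdep[K [r [hK hr ->]]]]] /=.
  rewrite IH => /andP[ok _] [-> ->].
  move: hK hr; rewrite mem_enum inE mem_permutations => /andP[KJ /eqP ca] pr.
  have sK : size (enum K) = a by rewrite -cardE.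
  have sr : size r = a by rewrite (perm_size pr).
  by rewrite !take_size_cat // !drop_size_cat // sK eqxx enum_set_sorted pr.
case/andP => /and4P[so /eqP sC pR ok] pC.
pose K := [set k in take a C].
have eK : enum K = take a C by apply: eq_enum_set => // k; rewrite inE.
have KJ : K \subset J.
  by apply/subsetP => k; rewrite inE => /mem_take; rewrite (perm_mem pC) mem_enum.
have uC : uniq C by rewrite (perm_uniq pC) enum_uniq.
apply/allpairsPdep; exists (K, take a R), (drop a R, drop a C).
rewrite /block_join /= eK !cat_take_drop; split=> //.
  apply/allpairsPdep; exists K, (take a R); rewrite mem_enum inE KJ mem_permutations eK pR.
  by rewrite cardE eK sC eqxx.
rewrite IH ok /=; apply: uniq_perm; rewrite ?drop_uniq ?enum_uniq // => k.
rewrite mem_enum !inE -[k \in J]mem_enum -(perm_mem pC) -{3}(cat_take_drop a C) mem_cat.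
have := uC; rewrite -{1}(cat_take_drop a C) cat_uniq => /and3P[_ /hasPn h _].
case: (boolP (k \in drop a C)) => [/h ->|_]; rewrite ?orbT //.
by rewrite orbF andNb.
Qed.

Lemma reshape_index_cons a al (i : nat) : reshape_index (a :: al) i =
  if (i < a)%N then 0%N else (reshape_index al (i - a)).+1.
Proof.
rewrite /reshape_index /= subn_eq0; case: (ltnP i a) => h //.
by rewrite subSn.
Qed.

Lemma blocks_okP al R C (k0 : 'I_n) : uniq R -> uniq C ->
  size R = sumn al -> size C = sumn al ->
  reflect
   ((forall i j : nat, (i < j)%N -> (j < sumn al)%N -> blk al i = blk al j ->
       (nth k0 C i < nth k0 C j)%N) /\
    (forall i : nat, (i < sumn al)%N -> exists j : nat, [/\ (j < sumn al)%N, blk al j = blk al i &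
       nth k0 R i = nth k0 C j]))
   (blocks_ok al R C).
Proof.
have tr : transitive (fun i j : 'I_n => (i < j)%N) by move=> x y z; apply: ltn_trans.
elim: al R C => [|a al IH] R C uR uC sR sC.
  by move: sR sC => /size0nil -> /size0nil -> /=; left; split=> // i j.
move: sR sC => /= sR sC.
have sR' : size (drop a R) = sumn al by rewrite size_drop sR addKn.
have sC' : size (drop a C) = sumn al by rewrite size_drop sC addKn.
have sRa : size (take a R) = a by rewrite size_takel // sR leq_addr.
have sCa : size (take a C) = a by rewrite size_takel // sC leq_addr.
have {}IH := IH _ _ (drop_uniq a uR) (drop_uniq a uC) sR' sC'.
rewrite sCa eqxx /=; apply: (iffP and3P) => [[so pe /IH[c1 c2]]|[c1 c2]].
  split=> [i j ij lt|i lt].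
    rewrite !reshape_index_cons; case: (ltnP j a) => ja; case: (ltnP i a) => ia //.
    - move=> _; rewrite -(nth_take k0 ia) -(nth_take k0 ja).
      by apply: (sorted_ltn_nth tr k0 so) => //; rewrite inE sCa.
    - case=> e; have := c1 (i - a)%N (j - a)%N.
      by rewrite !nth_drop !subnKC //; apply; rewrite ?e //; lia.
  rewrite reshape_index_cons; case: (ltnP i a) => ia.
    have : nth k0 R i \in take a C.
      by rewrite -(perm_mem pe) -(nth_take k0 ia) mem_nth // sRa.
    move=> /(nthP k0)[j]; rewrite sCa => ja e; exists j.
    by rewrite reshape_index_cons ja -e nth_take // ltn_addr.
  have [|j [h1 h2 h3]] := c2 (i - a)%N; first by lia.
  exists (a + j)%N; rewrite ltn_add2l reshape_index_cons [(a + j < a)%N]ltnNge leq_addr /= addKn h2.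
  by move: h3; rewrite !nth_drop subnKC.
split.
- rewrite sorted_pairwise //; apply/(pairwiseP k0) => i j; rewrite !inE sCa => ia ja ij.
  rewrite !nth_take //; apply: c1 => //; first by rewrite ltn_addr.
  by rewrite !reshape_index_cons ia ja.
- have sub : {subset take a R <= take a C}.
    move=> x /(nthP k0)[i]; rewrite sRa => ia <-; rewrite nth_take //.
    have [|j [h1 + ->]] := c2 i; first by rewrite ltn_addr.
    rewrite !reshape_index_cons ia; case: (ltnP j a) => // ja _.
    by rewrite -(nth_take k0 ja) mem_nth // sCa.
  apply: uniq_perm; rewrite ?take_uniq //.
  by have [] := uniq_min_size (take_uniq a uR) sub _; rewrite ?sCa ?sRa.
- apply/IH; split=> [i j ij lt e|i lt].
    rewrite !nth_drop; apply: c1; rewrite ?ltn_add2l // !reshape_index_cons.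
    by rewrite !ltnNge !leq_addr /= !addKn e.
  have [|j [h1 h2 h3]] := c2 (a + i)%N; first by rewrite ltn_add2l.
  move: h2; rewrite !reshape_index_cons [(a + i < a)%N]ltnNge leq_addr /= addKn.
  case: (ltnP j a) => // ja [e]; exists (j - a)%N; rewrite e !nth_drop subnKC //.
  by split=> //; lia.
Qed.

(** A column word increasing on the blocks is u^-1 with u a minimal representative, and a row word
    rearranging it inside the blocks is (u w)^-1 with w in the Young subgroup. *)
Lemma block_lists_perms al : sumn al = n ->
  perm_eq (block_lists al [set: 'I_n])
    [seq (perm_seq ((q.1 * q.2)^-1)%g, perm_seq (q.1^-1)%g)
      | q <- [seq (u, w) | u <- enum (coset_min n al), w <- enum (young n al)]].
Proof.
move=> sal; apply: uniq_perm; first exact: block_lists_uniq.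
  rewrite map_inj_uniq ?allpairs_uniq ?enum_uniq //.
    by move=> [? ?] [? ?] _ _ [-> ->].
  move=> [u w] [u' w'] /= [/perm_seq_inj/invg_inj e /perm_seq_inj/invg_inj eu].
  by move: e; rewrite eu => /mulgI ->.
have uP y : uniq (perm_seq y) by rewrite (perm_uniq (perm_seq_perm y)) enum_uniq.
have sP y : size (perm_seq y) = sumn al by rewrite size_perm_seq.
have nthP y (k0 k : 'I_n) : nth k0 (perm_seq y) k = y k by apply: nth_perm_seq.
move=> [R C]; rewrite mem_block_lists.
have eT : enum [set: 'I_n] = enum 'I_n by apply: eq_enum => k; rewrite !inE.
(* The case n = 0 is apart: [blocks_okP] reads letters with [nth], which takes a default index. *)
rewrite eT; case: (posnP n) => [n0|n_gt0].
  have nilE (s : seq 'I_n) : s = [::] by case: s => // x s; have := ltn_ord x; rewrite {2}n0.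
  have ok0 be : sumn be = 0%N -> blocks_ok be ([::] : seq 'I_n) [::].
    by elim: be => // b be IH /= /eqP; rewrite addn_eq0 => /andP[/eqP -> /eqP /IH].
  rewrite (nilE R) (nilE C) (nilE (enum _)) ok0 ?sal //=; apply/esym/mapP.
  exists (1%g, 1%g); last by rewrite (nilE (perm_seq _)) (nilE (perm_seq _)).
  apply/allpairsP; exists (1%g, 1%g); rewrite !mem_enum young1; split=> //=.
  by apply/coset_minP => i; have := ltn_ord i; rewrite {2}n0.
pose k0 := Ordinal n_gt0.
apply/idP/mapP => [/andP[ok pC]|].
  have pR : perm_eq R (enum 'I_n).
    have : (R, C) \in block_lists al [set: 'I_n] by rewrite mem_block_lists ok eT.
    by move=> /block_lists_perm[/= h _ _]; apply: perm_trans h pC.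
  have [y eR] := perm_seqP pR; have [u eC] := perm_seqP pC; subst R C.
  have [c1 c2] := blocks_okP k0 (uP y) (uP u) (sP y) (sP u) ok.
  exists (u^-1, u * y^-1)%g; last by rewrite /= mulKg !invgK.
  apply/allpairsP; exists (u^-1, u * y^-1)%g; rewrite !mem_enum; split=> //=.
    apply/coset_minP => i j ij e; rewrite invgK -!(nthP _ k0).
    by apply: c1 => //; rewrite sal.
  rewrite -[(_ * _)%g]invgK; apply: youngV; apply/youngP => i.
  rewrite invMg invgK permM -(nthP y k0 i).
  have [|j [jlt e ->]] := c2 i; first by rewrite sal.
  rewrite sal in jlt.
  by rewrite -[j]/(nat_of_ord (Ordinal jlt)) nthP permK.
move=> [_ /allpairsP[[u w] [/= + + ->]] [-> ->]]; rewrite !mem_enum => uc wy.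
rewrite perm_seq_perm andbT; apply/(blocks_okP k0) => //.
rewrite sal; move/coset_minP: uc => uc; split=> [i j ij lt e|i lt].
  have lti := ltn_trans ij lt.
  rewrite -[i]/(nat_of_ord (Ordinal lti)) -[j]/(nat_of_ord (Ordinal lt)) !nthP.
  exact: uc.
exists ((w^-1)%g (Ordinal lt)).
have /youngP wVy : (w^-1)%g \in young n al by apply: youngV.
split; [exact: ltn_ord | exact: wVy |].
by rewrite (nthP _ k0 (Ordinal lt)) (nthP _ k0 ((w^-1)%g (Ordinal lt))) invMg permM.
Qed.

End BlockLists.

(** * Induced characters as sums of products of minors *)

Section BlockDecomposition.
Variables (F : fieldType) (v : F) (n : nat) (A : algType F).
Variable t : 'I_n -> 'I_n -> A.
Hypothesis v_neq0 : v != 0.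
Hypothesis t_anti : forall i j k l : 'I_n, (i < j)%N -> (k < l)%N ->
  t j k * t i l = t i l * t j k.
Hypothesis t_diag : forall i j k l : 'I_n, (i < j)%N -> (k < l)%N ->
  t j l * t i k = t i k * t j l + (v - v^-1) *: (t i l * t j k).
Local Notation H := (hecke (v ^+ 2) n).
Local Notation T := (@T F (v ^+ 2) n).
Implicit Types (i j k : 'I_n) (J K : {set 'I_n}) (u w y x : 'S_n) (al : seq nat).

Definition word (r s : seq 'I_n) : A := \prod_(p <- zip r s) t p.1 p.2.

Lemma word_cat r s r' s' : size r = size s ->
  word (r ++ r') (s ++ s') = word r s * word r' s'.
Proof. by move=> e; rewrite /word zip_cat // big_cat. Qed.

Lemma word_perm_seq y u : word (perm_seq (y^-1)%g) (perm_seq (u^-1)%g) = perm_word t y u.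
Proof.
rewrite /word /perm_seq zip_map big_map /perm_word /=.
by rewrite enumT.
Qed.

Lemma minor_perms z cs K : size cs = #|K| ->
  minor z t cs K = \sum_(r <- permutations (enum K)) z ^+ seq_inv r *: word r cs.
Proof.
elim: cs K => [|c cs IH] K sK.
  have -> : K = set0 by apply: cards0_eq.
  by rewrite enum_set0 big_seq1 scale1r /word big_nil.
have pE : perm_eq (permutations (enum K))
    [seq a :: r | a : 'I_n <- enum K, r <- permutations (rem a (enum K))].
  by have := @permutationsE _ (enum K); rewrite undup_id ?enum_uniq // -cardE -sK; apply.
rewrite (perm_big _ pE) big_allpairs_dep /= big_enum.
apply: eq_bigr => a aK.
have -> : rem a (enum K) = enum (K :\ a).
  rewrite rem_filter ?enum_uniq //; apply/esym/eq_enum_set => [|k].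
    apply: sorted_filter; first by move=> x y z'; apply: ltn_trans.
    exact: enum_set_sorted.
  by rewrite mem_filter mem_enum !inE.
rewrite IH; last by move: sK; rewrite (cardsD1 a) aK => -[].
rewrite mulr_sumr scaler_sumr big_seq [RHS]big_seq; apply: eq_bigr => r.
rewrite mem_permutations => pr.
have -> : word (a :: r) (c :: cs) = t a c * word r cs by rewrite /word /= big_cons.
rewrite -scalerAr scalerA -exprD; congr (z ^+ (_ + _) *: _).
move/seq.permP: pr => ->; rewrite (nltD1 _ aK) ltnn add0n /nlt.
rewrite -size_filter cardE; congr size; apply: eq_enum_set => [|k].
  apply: sorted_filter; first by move=> x y z'; apply: ltn_trans.
  exact: enum_set_sorted.
by rewrite mem_filter mem_enum !inE andbC.
Qed.

Fixpoint split_sum z al J : A :=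
  if al is a :: al' then
    \sum_(K : {set 'I_n} | (K \subset J) && (#|K| == a))
      principal z t K * split_sum z al' (J :\: K)
  else (J == set0)%:R.

(** Inversions between different blocks are the same for rows and columns, so the difference counts
    those inside the blocks; the truncated subtraction is exact by [block_lists_perm]. *)
Lemma split_sum_lists z al J : split_sum z al J =
  \sum_(p <- block_lists al J) z ^+ (seq_inv p.1 - seq_inv p.2) *: word p.1 p.2.
Proof.
elim: al J => [|a al IH] J /=.
  case: eqP => _; last by rewrite big_nil.
  by rewrite big_seq1 scale1r /word big_nil.
rewrite big_allpairs_dep /block_heads big_allpairs_dep /= big_enum /=.
rewrite [RHS](eq_bigl (fun K : {set 'I_n} => (K \subset J) && (#|K| == a))); last first.
  by move=> K; rewrite inE.
apply: eq_bigr => K KJ; rewrite IH /principal minor_perms -?cardE //.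
rewrite mulr_suml big_seq [RHS]big_seq; apply: eq_bigr => r; rewrite mem_permutations => pr.
rewrite mulr_sumr big_seq [RHS]big_seq; apply: eq_bigr => p hp.
have [h1 _ h2] := block_lists_perm hp.
rewrite -scalerAl -scalerAr scalerA -exprD word_cat ?(perm_size pr) //.
congr (z ^+ _ *: _); have := seq_inv_perm_cat pr h1.
rewrite (seq_inv_sorted (enum_set_sorted K)) addn0 => e.
have aux (m b d k f : nat) : (m + d = b + k + f -> d <= f -> k + (f - d) = m - b)%N by lia.
exact: aux e h2.
Qed.

Variable c : F.
Hypothesis c_quad : c ^+ 2 = (v ^+ 2 - 1) * c + v ^+ 2.

(** The words are indexed by u minimal and x in the Young subgroup, with weight (c / v)^{l(x)} as
    lengths add. Once they are straightened, the coefficient of t^{e,w} is the trace of T_w on the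
    induced module, up to v^{-l(w)}. *)
Lemma split_sum_ind al : sumn al = n ->
  split_sum (c / v) al [set: 'I_n] =
  \sum_w (v ^- len w * ind_char (fun w => c ^+ len w) al (T w : H)) *: \prod_k t k (w k).
Proof.
move=> sal; rewrite split_sum_lists (perm_big _ (block_lists_perms sal)) big_map /=.
rewrite big_allpairs_dep /= big_enum /=.
transitivity (\sum_(u in coset_min n al) \sum_(x in young n al)
   (c / v) ^+ len x *: perm_word t (u * x) u).
  apply: eq_bigr => u uc; rewrite big_enum; apply: eq_bigr => x xy.
  rewrite word_perm_seq -!len_perm_seq !lenV.
  by rewrite (len_block_increasing (coset_minP _ _ uc) xy) addKn.
transitivity (\sum_(w : 'S_n) \sum_(u in coset_min n al) \sum_(x in young n al)
    (v ^- len w * ((T w * T u) (u * x)%g * c ^+ len x)) *: \prod_k t k (w k)); last first.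
  apply: eq_bigr => w _; rewrite ind_charE mulr_sumr scaler_suml.
  by apply: eq_bigr => u _; rewrite mulr_sumr scaler_suml.
rewrite [RHS]exchange_big /=; apply: eq_bigr => u uc.
rewrite [RHS]exchange_big /=; apply: eq_bigr => x xy.
rewrite -(perm_word_expand v_neq0 t_anti t_diag) scaler_sumr; apply: eq_bigr => w _.
rewrite scalerA; congr (_ *: _); rewrite /hval.
rewrite (len_block_increasing (coset_minP _ _ uc) xy).
rewrite exprD expr_div_n.
move: ((T w * T u) (u * x)%g) => e.
by field; rewrite !expf_neq0.
Qed.

End BlockDecomposition.

(** * Independence of the monomials t^{e,w} *)

Lemma enum_adj n (i j : 'I_n) : adj i j ->
  enum 'I_n = take i (enum 'I_n) ++ i :: j :: drop j.+1 (enum 'I_n).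
Proof.
move=> ij; have ji : (j < n)%N by [].
rewrite -{1}(cat_take_drop i (enum 'I_n)); congr (_ ++ _).
have sz : size (enum 'I_n) = n by rewrite size_enum_ord.
rewrite (drop_nth i) ?sz // nth_ord_enum -(eqP ij) (drop_nth i) ?sz //.
by rewrite nth_ord_enum.
Qed.

Section WordFunctional.
Variables (F : fieldType) (v : F) (n : nat).
Hypothesis v_neq0 : v != 0.
Local Notation T := (@T F (v ^+ 2) n).
Implicit Types (i j k l : 'I_n) (u w x y : 'S_n) (s : seq ('I_n * 'I_n)).

Definition pair_word y u : seq ('I_n * 'I_n) :=
  [seq ((y^-1)%g k, (u^-1)%g k) | k <- enum 'I_n].

Lemma pair_word_inj y u y' u' : pair_word y u = pair_word y' u' -> (y, u) = (y', u').
Proof.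
move/eq_in_map => e; have h k : ((y^-1)%g k, (u^-1)%g k) = ((y'^-1)%g k, (u'^-1)%g k).
  by apply: e; rewrite mem_enum.
congr (_, _); apply: invg_inj; apply/permP => k; by case: (h k).
Qed.

(** Brings a relation applied inside a word within reach of [hval_swap]: exchanging two neighbouring
    rows or columns multiplies y or u by a simple transposition. *)
Lemma pair_word_split y u s1 p1 p2 s2 : s1 ++ p1 :: p2 :: s2 = pair_word y u ->
  exists i j, [/\ adj i j, p1 = ((y^-1)%g i, (u^-1)%g i), p2 = ((y^-1)%g j, (u^-1)%g j),
    pair_word (y * tperm i j) u = s1 ++ (p2.1, p1.2) :: (p1.1, p2.2) :: s2 &
    pair_word y (u * tperm i j) = s1 ++ (p1.1, p2.2) :: (p2.1, p1.2) :: s2].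
Proof.
move=> e; have := congr1 size e; rewrite /pair_word size_cat size_map size_enum_ord /= => sz.
have lt1 : (size s1 < n)%N by lia.
have lt2 : ((size s1).+1 < n)%N by lia.
have [i iE] : exists i : 'I_n, i = size s1 :> nat by exists (Ordinal lt1).
have [j jE] : exists j : 'I_n, j = (size s1).+1 :> nat by exists (Ordinal lt2).
have ij : adj i j by rewrite /adj iE jE.
have szt : size s1 = size (take i (enum 'I_n)).
  by rewrite size_takel ?iE // size_enum_ord ltnW.
have en := enum_adj ij; move: szt en (enum_uniq 'I_n) e.
move: (take i _) (drop j.+1 _) => X Y szt en; rewrite /pair_word en => un.
rewrite !map_cat /= => /eqP; rewrite eqseq_cat ?size_map // !eqseq_cons.
case/andP => /eqP e1 /and3P[/eqP -> /eqP -> /eqP e2].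
have out k : k \in X ++ Y -> (tperm i j) k = k.
  move: un; rewrite mem_cat.
  rewrite cat_uniq => /and3P[_ /hasPn h1 /andP[h2 /andP[h3 _]]] hk.
  have iX : i \notin X by apply: h1; rewrite inE eqxx.
  have jX : j \notin X by apply: h1; rewrite !inE eqxx orbT.
  have iY : i \notin Y by apply: contra h2; rewrite inE => ->; rewrite orbT.
  by apply: tpermD; apply: contraTneq hk => <-; rewrite negb_or ?iX ?iY ?jX ?h3.
exists i, j; rewrite e1 e2 ?map_cat /=; split=> //.
  rewrite !invMg tpermV !permM tpermL tpermR; congr (_ ++ _ :: _ :: _);
  by apply/eq_in_map => k hk /=; rewrite permM out // mem_cat hk ?orbT.
rewrite !invMg tpermV !permM tpermL tpermR; congr (_ ++ _ :: _ :: _);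
by apply/eq_in_map => k hk /=; rewrite permM out // mem_cat hk ?orbT.
Qed.

(* The coefficient of t^{e,w} in the word s, as predicted by perm_word_expand;
   the words that are not of the form t_{x,y} with x, y permutations are sent to 0. *)
Definition word_coef w s : F :=
  \sum_(p : 'S_n * 'S_n | s == pair_word p.1 p.2) v ^- len w * hval (T w) p.1 p.2.

Lemma word_coefE w y u : word_coef w (pair_word y u) = v ^- len w * hval (T w) y u.
Proof.
rewrite /word_coef (big_pred1 (y, u)) // => -[y' u'] /=.
by apply/eqP/eqP => [/pair_word_inj|[-> ->]].
Qed.

Lemma word_coef0 w s : (forall y u, s <> pair_word y u) -> word_coef w s = 0.
Proof. by move=> h; apply: big_pred0 => -[y u]; apply/eqP/h. Qed.

(** Serves the row and column relations, both of whose sides vanish under the functional. *)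
Lemma word_coef_repeat w s1 p1 p2 s2 : (p1.1 == p2.1) || (p1.2 == p2.2) ->
  word_coef w (s1 ++ p1 :: p2 :: s2) = 0.
Proof.
move=> h; apply: word_coef0 => y u /pair_word_split[i [j [ij e1 e2 _ _]]].
by move: h; rewrite e1 e2 /= !(inj_eq perm_inj) orbb (negPf (adj_neq ij)).
Qed.

Lemma word_coef_rel w s1 s2 i j k l : (i < j)%N -> (k < l)%N ->
  word_coef w (s1 ++ (j, k) :: (i, l) :: s2) = word_coef w (s1 ++ (i, l) :: (j, k) :: s2) /\
  word_coef w (s1 ++ (j, l) :: (i, k) :: s2) = word_coef w (s1 ++ (i, k) :: (j, l) :: s2)
     + (v - v^-1) * word_coef w (s1 ++ (i, l) :: (j, k) :: s2).
Proof.
move=> ij kl; pose isw s := exists y u, s = pair_word y u.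
(* The words of a relation differ by exchanges of two rows or two columns: all of them are
   permutation words, or none is. *)
have base (a b c d : 'I_n) : isw (s1 ++ (a, c) :: (b, d) :: s2) ->
    isw (s1 ++ (b, c) :: (a, d) :: s2) /\ isw (s1 ++ (a, d) :: (b, c) :: s2).
  by move=> [y [u /pair_word_split[i0 [j0 [_ _ _ /= <- <-]]]]]; split; do 2!eexists.
case: (boolp.pselect (isw (s1 ++ (i, k) :: (j, l) :: s2))) => [[y [u e]]|nw]; last first.
  have nN s : ~ isw s -> word_coef w s = 0.
    by move=> h; apply: word_coef0 => y u e; apply: h; exists y, u.
  rewrite !nN ?mulr0 ?addr0 //.
  - by move=> /base[_] /base[h _]; apply: nw.
  - by move=> /base[_ h]; apply: nw.
  - by move=> /base[h _]; apply: nw.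
have [i0 [j0 [ij0 e1 e2 /= er ec]]] := pair_word_split e.
case: e1 => iE kE; case: e2 => jE lE.
have lty : ((y^-1)%g i0 < (y^-1)%g j0)%N by rewrite -iE -jE.
have ltu : ((u^-1)%g i0 < (u^-1)%g j0)%N by rewrite -kE -lE.
rewrite -er -ec e.
have [i1 [j1 [ij1 [e1 e2] [e3 e4] /= er' _]]] := pair_word_split (esym ec).
have i10 : i1 = i0 by apply: (@perm_inj _ (y^-1)%g); rewrite -e1 iE.
have j10 : j1 = j0 by apply: (@perm_inj _ (y^-1)%g); rewrite -e3 jE.
rewrite i10 j10 in er'; rewrite -er' !word_coefE !hval_swap // ltu addr0; split=> //.
rewrite invMg tpermV !permM tpermL tpermR [X in if X then _ else _]ltnNge (ltnW ltu) /=.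
by rewrite -mulgA tperm2 mulg1; ring.
Qed.

End WordFunctional.

Section Independence.
(* Local to the section: monalg and mpoly share many names. *)
Import monalg.
Variables (F : fieldType) (v : F) (n : nat).
Hypothesis v_neq0 : v != 0.
Local Notation Fr := (free_alg F n).
Local Notation T := (@T F (v ^+ 2) n).
Local Open Scope quotient_scope.
Local Notation Q := (Quotient.quot (ideal_gen (@qrel F v n Fr (@gen F n)))).
Implicit Types (w : 'S_n) (x y : Fr).

(** Here [mmap] only extends linearly a function of the words, which is not multiplicative. *)
Definition free_coef w : Fr -> F :=
  mmap idfun (fun m : {fmonom ('I_n * 'I_n)%type} => word_coef v w (m : seq _)).

Lemma free_coefU w (c : F) (m : {fmonom ('I_n * 'I_n)%type}) :
  free_coef w << c *g m >> = c * word_coef v w m.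
Proof. by rewrite /free_coef mmapU. Qed.

Lemma free_coefD w : {morph free_coef w : x y / x + y}.
Proof. by move=> x y; rewrite /free_coef mmapD. Qed.

Lemma free_coefN w : {morph free_coef w : x / - x}.
Proof. by move=> x; rewrite /free_coef mmapN. Qed.

Lemma free_coef_sum w (I : Type) (r : seq I) (f : I -> Fr) :
  free_coef w (\sum_(i <- r) f i) = \sum_(i <- r) free_coef w (f i).
Proof. by rewrite /free_coef raddf_sum. Qed.

Lemma malgUM (a b : F) (m m' : {fmonom ('I_n * 'I_n)%type}) :
  << a *g m >> * << b *g m' >> = << a * b *g mmul m m' >> :> Fr.
Proof. by rewrite malgM_def fgmulUU. Qed.

Lemma malgUZ (a b : F) (m : {fmonom ('I_n * 'I_n)%type}) :
  a *: << b *g m >> = << a * b *g m >> :> Fr.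
Proof. by rewrite -mul_malgC malgUM mul1m. Qed.

Lemma free_coefZ w a x : free_coef w (a *: x) = a * free_coef w x.
Proof.
rewrite [x]monalgE scaler_sumr !free_coef_sum mulr_sumr; apply: eq_bigr => m _.
by rewrite malgUZ !free_coefU mulrA.
Qed.

Lemma malg_sum x : exists (s : seq {fmonom ('I_n * 'I_n)%type}) (c : _ -> F),
  x = \sum_(m <- s) c m *: << m >>.
Proof.
exists (finmap.enum_fset (msupp x)), (fun m => mcoeff m x); rewrite {1}[x]monalgE.
by apply: eq_bigr => m _; rewrite malgUZ mulr1.
Qed.

Lemma free_coef_rel w r : @qrel F v n Fr (@gen F n) r ->
  forall x y, free_coef w (x * r * y) = 0.
Proof.
move=> rr.
suff key m m' : free_coef w (<< m >> * r * << m' >>) = 0.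
  move=> x y; have [sx [cx ->]] := malg_sum x; have [sy [cy ->]] := malg_sum y.
  have Z (a b : F) m m' : free_coef w (a *: << m >> * r * (b *: << m' >>)) = 0.
    rewrite -free_scaleAr -[a *: << m >> * r]scalerAl -[_ *: _ * << m' >>]scalerAl.
    by rewrite !free_coefZ key !mulr0.
  rewrite -mulrA mulr_suml free_coef_sum big1 // => m _; rewrite mulrA.
  suff L z : free_coef w (cx m *: << m >> * r * z) = 0 by exact: L.
  have [sz [cz ->]] := malg_sum z.
  have MS (z1 : Fr) (I : seq _) (f : _ -> Fr) :
      z1 * (\sum_(i <- I) f i) = \sum_(i <- I) z1 * f i by exact: mulr_sumr.
  by rewrite MS free_coef_sum big1 // => m' _; exact: Z.
have W (i j k l : 'I_n) : free_coef w (<< m >> * (gen F i j * gen F k l) * << m' >>) =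
    word_coef v w ((m : seq _) ++ (i, j) :: (k, l) :: (m' : seq _)).
  by rewrite /gen !malgUM free_coefU !mulr1 mul1r !fmM !fmU /= -!catA.
have WZ a x : free_coef w (<< m >> * (a *: x) * << m' >>) = a * free_coef w (<< m >> * x * << m' >>).
  by rewrite -[<< m >> * (a *: x)]free_scaleAr -[_ *: _ * _]scalerAl free_coefZ.
have WD x y : free_coef w (<< m >> * (x + y) * << m' >>) =
    free_coef w (<< m >> * x * << m' >>) + free_coef w (<< m >> * y * << m' >>).
  by rewrite mulrDr mulrDl free_coefD.
have WB x y : free_coef w (<< m >> * (x - y) * << m' >>) =
    free_coef w (<< m >> * x * << m' >>) - free_coef w (<< m >> * y * << m' >>).
  by rewrite mulrBr mulrBl free_coefD free_coefN.
case: rr => [i k l kl|i j k ij|i j k l ij kl|i j k l ij kl];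
  apply: etrans (WB _ _) _; apply/eqP; rewrite subr_eq0; apply/eqP.
- apply: etrans (W _ _ _ _) (esym (etrans (WZ _ _) _)); rewrite W.
  by rewrite !word_coef_repeat /= ?eqxx // mulr0.
- apply: etrans (W _ _ _ _) (esym (etrans (WZ _ _) _)); rewrite W.
  by rewrite !word_coef_repeat /= ?eqxx ?orbT // mulr0.
- apply: etrans (W _ _ _ _) (esym (etrans (W _ _ _ _) _)).
  by have [-> _] := word_coef_rel v_neq0 w m m' ij kl.
- apply: etrans (W _ _ _ _) (esym (etrans (WD _ _) _)).
  have [_ ->] := word_coef_rel v_neq0 w m m' ij kl.
  by congr (_ + _); [exact: W | apply: etrans (WZ _ _) _; rewrite W].
Qed.

Lemma free_coef_ideal w x : x \in ideal_gen (@qrel F v n Fr (@gen F n)) -> free_coef w x = 0.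
Proof.
case/ideal_genP => s [rs ->]; rewrite free_coef_sum big_seq big1 // => p /rs r.
exact: (free_coef_rel w r).
Qed.

Definition free_monomial w : Fr := \prod_(i < n) gen F i (w i).

Lemma free_coef_monomial w w' : free_coef w (free_monomial w') = (w == w')%:R.
Proof.
have -> : free_monomial w' = \prod_(p <- pair_word 1 (w'^-1)%g) gen F p.1 p.2.
  rewrite /pair_word big_map /free_monomial enumT; apply: eq_bigr => i _.
  by rewrite invg1 perm1 invgK.
have E s : exists2 m : {fmonom ('I_n * 'I_n)%type},
    \prod_(p <- s) gen F p.1 p.2 = << m >> & (m : seq _) = s.
  elim: s => [|p s [m e ms]]; first by exists mone; rewrite ?big_nil ?fm1.
  exists (mmul (fmu p) m); last by rewrite fmM fmU ms.
  by rewrite big_cons e /gen malgUM mulr1 -surjective_pairing.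
have [m -> ms] := E (pair_word 1 (w'^-1)%g).
rewrite free_coefU mul1r ms word_coefE hval1 // ffunE invgK lenV.
rewrite [w == w']eq_sym; case: eqP => [->|_]; last by rewrite !mulr0.
by rewrite mulr1 mulVf // expf_neq0.
Qed.

Lemma monomial_pi w : monomial v w = \pi_Q (free_monomial w) :> qmat v n.
Proof.
rewrite /monomial /free_monomial.
elim/big_rec2: _ => [|i x y _ ->] //.
exact: quot_mul_pi.
Qed.

(** The functionals [free_coef w] vanish on the ideal of relations and form a dual family to the
    t^{e,w}. *)
Lemma monomial_free (a : 'S_n -> F) :
  \sum_w a w *: monomial v w = 0 -> forall w, a w = 0.
Proof.
move=> e w; have : \pi_Q (\sum_w' a w' *: free_monomial w') = \pi_Q 0.
  rewrite raddf0 raddf_sum -[RHS]e; apply: eq_bigr => w' _.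
  by rewrite monomial_pi; apply: esym; exact: quot_scale_pi.
move/quot_eqP; rewrite subr0 => /(free_coef_ideal w).
rewrite free_coef_sum (bigD1 w) //= big1 ?addr0 => [|w' /negPf ne].
  by rewrite free_coefZ free_coef_monomial eqxx mulr1.
by rewrite free_coefZ free_coef_monomial eq_sym ne mulr0.
Qed.

End Independence.

(** * Commutation of the sums of products of minors *)

Section Relabelling.
Variables (F : fieldType) (v : F) (n : nat) (A : algType F).
Variable t : 'I_n -> 'I_n -> A.
Hypothesis v_neq0 : v != 0.
Hypothesis t_anti : forall i j k l : 'I_n, (i < j)%N -> (k < l)%N ->
  t j k * t i l = t i l * t j k.
Hypothesis t_diag : forall i j k l : 'I_n, (i < j)%N -> (k < l)%N ->
  t j l * t i k = t i k * t j l + (v - v^-1) *: (t i l * t j k).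
Variables (m : nat) (e : 'I_m -> 'I_n).
Hypothesis e_mono : forall i j, (e i < e j)%N = (i < j)%N.
(** [split_sum_ind] concerns the full set only; along the increasing enumeration of a subset the
    generators keep their relations, which carries the result over to every subset. *)
Let te i j := t (e i) (e j).

Lemma relabel_inj : injective e.
Proof.
move=> i j eij; apply: val_inj; case: (ltngtP i j) => //; rewrite -e_mono eij ltnn //.
Qed.

Lemma relabel_imsetD1 (K : {set 'I_m}) a : (e @: K) :\ e a = e @: (K :\ a).
Proof.
apply/setP => k; rewrite !inE; apply/andP/imsetP => [[ka /imsetP[x xK kx]]|[x]].
  by exists x; rewrite // !inE xK andbT; apply: contraNneq ka => <-; rewrite kx.
rewrite !inE => /andP[xa xK] ->; rewrite (inj_eq relabel_inj) xa; split=> //.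
exact: imset_f.
Qed.

Lemma minor_relabel z cs (K : {set 'I_m}) :
  minor z te cs K = minor z t [seq e c | c <- cs] (e @: K).
Proof.
elim: cs K => //= c cs IH K; rewrite big_imset /=; last by move=> x y _ _; apply: relabel_inj.
apply: eq_bigr => a aK; rewrite IH relabel_imsetD1; congr (_ ^+ _ *: _).
rewrite /nlt -(card_imset _ relabel_inj); apply: eq_card => k; rewrite [RHS]inE.
apply/imsetP/andP => [[x]|[/imsetP[x xK ->]]].
  by rewrite inE => /andP[xK xa] ->; rewrite e_mono imset_f.
by rewrite e_mono => xa; exists x; rewrite // inE xK.
Qed.

Lemma enum_imset_relabel (K : {set 'I_m}) : enum (e @: K) = [seq e k | k <- enum K].
Proof.
apply: eq_enum_set => [|k].
  rewrite sorted_map; have := enum_set_sorted K.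
  by apply: sub_sorted => x y; rewrite /= e_mono.
by apply/mapP/imsetP => -[x xK ->]; exists x; rewrite ?mem_enum // -mem_enum.
Qed.

Lemma split_sum_relabel z al (K : {set 'I_m}) :
  split_sum te z al K = split_sum t z al (e @: K).
Proof.
elim: al K => [|a al IH] K /=; first by rewrite imset_eq0.
rewrite [RHS](reindex_onto (fun L : {set 'I_m} => e @: L) (fun L => e @^-1: L)) /=.
  apply: eq_big => [L|L LK].
    rewrite (card_imset _ relabel_inj).
    have -> : e @^-1: (e @: L) == L.
      by apply/eqP/setP => x; rewrite inE mem_imset //; apply: relabel_inj.
    rewrite andbT; congr (_ && _); apply/subsetP/subsetP => sub x.
      by move=> /imsetP[y yL ->]; apply: imset_f; apply: sub.
    by move=> xL; have := sub _ (imset_f e xL); rewrite mem_imset //; apply: relabel_inj.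
  rewrite /principal minor_relabel enum_imset_relabel IH; congr (_ * split_sum _ _ _ _).
  apply/setP => x; rewrite !inE; apply/imsetP/andP => [[y]|[xL /imsetP[y yK xy]]].
    rewrite !inE => /andP[yL yK] ->; split; last exact: imset_f.
    by rewrite mem_imset //; apply: relabel_inj.
  by exists y; rewrite // !inE yK andbT; apply: contra xL; rewrite xy; apply: imset_f.
move=> L /andP[/subsetP sub _]; apply/setP => x; apply/imsetP/idP => [[y]|xL].
  by rewrite inE => h ->.
by have /imsetP[y yK xy] := sub _ xL; exists y; rewrite // inE -xy.
Qed.

Variable c : F.
Hypothesis c_quad : c ^+ 2 = (v ^+ 2 - 1) * c + v ^+ 2.

Lemma split_sum_swap_relabel a b : (a + b = m)%N ->
  split_sum t (c / v) [:: a; b] (e @: [set: 'I_m]) =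
  split_sum t (c / v) [:: b; a] (e @: [set: 'I_m]).
Proof.
move=> ab; rewrite -!split_sum_relabel.
have te_anti (i j k l : 'I_m) : (i < j)%N -> (k < l)%N -> te j k * te i l = te i l * te j k.
  by move=> ij kl; apply: t_anti; rewrite e_mono.
have te_diag (i j k l : 'I_m) : (i < j)%N -> (k < l)%N ->
    te j l * te i k = te i k * te j l + (v - v^-1) *: (te i l * te j k).
  by move=> ij kl; apply: t_diag; rewrite e_mono.
rewrite !(split_sum_ind v_neq0 te_anti te_diag) //=; try by rewrite addn0 // addnC.
apply: eq_bigr => w _; rewrite ind_char_swap //.
by rewrite unitrX // unitfE.
Qed.

End Relabelling.

Section Swap.
Variables (F : fieldType) (v : F) (n : nat) (A : algType F).
Variable t : 'I_n -> 'I_n -> A.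
Hypothesis v_neq0 : v != 0.
Hypothesis t_anti : forall i j k l : 'I_n, (i < j)%N -> (k < l)%N ->
  t j k * t i l = t i l * t j k.
Hypothesis t_diag : forall i j k l : 'I_n, (i < j)%N -> (k < l)%N ->
  t j l * t i k = t i k * t j l + (v - v^-1) *: (t i l * t j k).
Variable c : F.
Hypothesis c_quad : c ^+ 2 = (v ^+ 2 - 1) * c + v ^+ 2.

Lemma split_sum_card z al (J : {set 'I_n}) : #|J| != sumn al -> split_sum t z al J = 0.
Proof.
elim: al J => [|a al IH] J /=; first by rewrite cards_eq0 => /negPf ->.
move=> ne; apply: big1 => K /andP[KJ /eqP cK]; rewrite IH ?mulr0 //.
apply: contra ne => /eqP e; rewrite -e -cK addnC -(cardsID K J).
by rewrite (setIidPr KJ) addnC.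
Qed.

Lemma split_sum_swap a b (J : {set 'I_n}) :
  split_sum t (c / v) [:: a; b] J = split_sum t (c / v) [:: b; a] J.
Proof.
have [cJ|ne] := eqVneq #|J| (a + b)%N; last first.
  by rewrite !split_sum_card //= addn0 // addnC.
pose e (i : 'I_#|J|) := enum_val i.
have e_mono (i j : 'I_#|J|) : (e i < e j)%N = (i < j)%N.
  have lt (x y : 'I_#|J|) : (x < y)%N -> (e x < e y)%N.
    move=> xy; have [d _] : exists d : 'I_n, true by exists (e x).
    rewrite /e !(enum_val_nth d).
    have tr : transitive (fun i j : 'I_n => (i < j)%N) by move=> ? ? ?; apply: ltn_trans.
    by apply: (sorted_ltn_nth tr _ (enum_set_sorted J)) => //; rewrite inE -cardE.
  case: (ltngtP i j) => [/lt //|/lt h|/val_inj ->]; last by rewrite ltnn.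
  by rewrite ltnNge ltnW.
have -> : J = e @: [set: 'I_#|J|].
  apply/setP => x; apply/idP/imsetP => [xJ|[i _ ->]]; last exact: enum_valP.
  by exists (enum_rank_in xJ x); rewrite // /e enum_rankK_in.
exact: split_sum_swap_relabel.
Qed.

End Swap.

(** * The convolution algebra of functions of a subset *)

(* Convolution over the splittings of a set into two complementary parts; only
   the multilinear part of products in A is retained. *)
Definition conv (F : fieldType) (A : algType F) (n : nat) : Type :=
  {ffun {set 'I_n} -> A}.

Section Convolution.
Variables (F : fieldType) (A : algType F) (n : nat).
Local Notation C := (conv A n).
Implicit Types (f g h : C) (J K L : {set 'I_n}).

HB.instance Definition _ := GRing.Lmodule.copy C {ffun {set 'I_n} -> A}.

Definition conv_mul f g : C :=
  [ffun J : {set 'I_n} => \sum_(K : {set 'I_n} | K \subset J) f K * g (J :\: K)].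

Definition conv_one : C := [ffun J : {set 'I_n} => (J == set0)%:R].

Lemma conv_mulA : associative conv_mul.
Proof.
move=> f g h; apply/ffunP => J; rewrite !ffunE.
transitivity (\sum_(K : {set 'I_n} | K \subset J) \sum_(M : {set 'I_n} | (K \subset M) && (M \subset J))
    f K * g (M :\: K) * h (J :\: M)).
  apply: eq_bigr => K KJ; rewrite ffunE mulr_sumr.
  rewrite [RHS](reindex_onto (fun L => K :|: L) (fun M => M :\: K)) /=; last first.
    by move=> M /andP[KM _]; rewrite setDE setUIr setUCr setIT; apply/setUidPr.
  apply: eq_big => [L|L LJ].
    rewrite subsetUl /= subUset KJ /= subsetD; congr (_ && _).
    rewrite setDUl setDv set0U. by apply/setDidPl/eqP.
  rewrite setDUl setDv set0U.
  have -> : L :\: K = L by apply/setDidPl; move: LJ; rewrite subsetD => /andP[].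
  by rewrite mulrA setDDl.
rewrite (exchange_big_dep (fun M : {set 'I_n} => M \subset J)) /=; last by move=> K M _ /andP[].
apply: eq_bigr => M MJ; rewrite ffunE mulr_suml; apply: eq_bigl => K.
rewrite MJ andbT; apply/andb_idl => KM; exact: subset_trans KM MJ.
Qed.

Lemma conv_mul1l : left_id conv_one conv_mul.
Proof.
move=> f; apply/ffunP => J; rewrite ffunE (bigD1 set0) ?sub0set //= big1 => [|K /andP[_ /negPf ne]].
  by rewrite ffunE eqxx mul1r setD0 addr0.
by rewrite ffunE ne mul0r.
Qed.

Lemma conv_mul1r : right_id conv_one conv_mul.
Proof.
move=> f; apply/ffunP => J; rewrite ffunE (bigD1 J) //= big1 => [|K /andP[KJ ne]].
  by rewrite ffunE setDv eqxx mulr1 addr0.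
rewrite ffunE setD_eq0 (_ : (J \subset K) = false) ?mulr0 //.
by apply: contraNF ne => JK; rewrite eqEsubset KJ.
Qed.

Lemma conv_mulDl : left_distributive conv_mul +%R.
Proof.
move=> f g h; apply/ffunP => J; rewrite !ffunE -big_split.
by apply: eq_bigr => K _; rewrite ffunE mulrDl.
Qed.

Lemma conv_mulDr : right_distributive conv_mul +%R.
Proof.
move=> f g h; apply/ffunP => J; rewrite !ffunE -big_split.
by apply: eq_bigr => K _; rewrite ffunE mulrDr.
Qed.

Lemma conv_1neq0 : conv_one != 0.
Proof. by apply/eqP => /ffunP/(_ set0)/eqP; rewrite !ffunE eqxx oner_eq0. Qed.

HB.instance Definition _ := GRing.Zmodule_isNzRing.Build C
  conv_mulA conv_mul1l conv_mul1r conv_mulDl conv_mulDr conv_1neq0.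

Lemma conv_scaleAl (a : F) f g : a *: (f * g) = (a *: f) * g.
Proof.
apply/ffunP => J; rewrite !ffunE scaler_sumr; apply: eq_bigr => K _.
by rewrite ffunE scalerAl.
Qed.

HB.instance Definition _ := GRing.Lmodule_isLalgebra.Build F C conv_scaleAl.

Lemma conv_scaleAr (a : F) f g : a *: (f * g) = f * (a *: g).
Proof.
apply/ffunP => J; rewrite !ffunE scaler_sumr; apply: eq_bigr => K _.
by rewrite ffunE scalerAr.
Qed.

HB.instance Definition _ := GRing.Lalgebra_isAlgebra.Build F C conv_scaleAr.

Lemma convE f g J : (f * g) J = \sum_(K : {set 'I_n} | K \subset J) f K * g (J :\: K).
Proof. exact: ffunE. Qed.

Definition slice (f : {set 'I_n} -> A) (k : nat) : C :=
  [ffun J : {set 'I_n} => if #|J| == k then f J else 0].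

Lemma slice_mul (f : {set 'I_n} -> A) k g J : (slice f k * g) J =
  \sum_(K : {set 'I_n} | (K \subset J) && (#|K| == k)) f K * g (J :\: K).
Proof.
rewrite convE [RHS]big_mkcondr; apply: eq_bigr => K _.
by rewrite ffunE; case: ifP => // _; rewrite mul0r.
Qed.

(** Ordered set partitions of an arbitrary J, in a recursive form that follows the convolution
    product factor by factor. *)
Fixpoint is_osp_on (J : {set 'I_n}) (lam : seq nat) (I : seq {set 'I_n}) : bool :=
  match lam, I with
  | a :: lam', K :: I' => [&& K \subset J, #|K| == a & is_osp_on (J :\: K) lam' I']
  | [::], [::] => J == set0
  | _, _ => false
  end.

Lemma is_osp_onE J lam I : is_osp_on J lam I =
  [&& [seq #|K| | K : {set 'I_n} <- I] == lam,
      pairwise (fun K L : {set 'I_n} => [disjoint K & L]) I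
    & \bigcup_(K <- I) K == J].
Proof.
elim: lam J I => [|a lam IH] J [|K I] //=; first by rewrite big_nil eq_sym.
rewrite IH eqseq_cons big_cons.
set U := \bigcup_(L <- I) L.
have allE : all (fun L : {set 'I_n} => [disjoint K & L]) I = [disjoint K & U].
  rewrite /U; elim: I {IH U} => [|L I IHI] /=.
    by rewrite big_nil -setI_eq0 setI0 eqxx.
  by rewrite big_cons IHI -!setI_eq0 setIUr setU_eq0.
have e : (K \subset J) && (U == J :\: K) = [disjoint K & U] && (K :|: U == J).
  apply/andP/andP => [[KJ /eqP ->]|[dis /eqP <-]].
    rewrite -setI_eq0 setIDA setIC -setIDA setDv setI0 eqxx; split=> //.
    by rewrite -{2}(setID J K) (setIidPr KJ).
  rewrite subsetUl setDUl setDv set0U; split=> //; apply/eqP/esym/setDidPl.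
  by rewrite disjoint_sym.
rewrite allE; move: e; case: (K \subset J); case: (U == _); case: [disjoint _ & _];
  case: (_ :|: _ == _); case: (#|K| == a); case: (pairwise _ I);
  by case: (_ == lam).
Qed.

Lemma big_tuple_cons (V : nmodType) (S : finType) k (P : pred (seq S)) (G : seq S -> V) :
  \sum_(I : k.+1.-tuple S | P I) G I =
  \sum_(x : S) \sum_(I : k.-tuple S | P (x :: I)) G (x :: I).
Proof.
rewrite pair_big_dep /=.
rewrite (reindex (fun p : S * k.-tuple S => [tuple of p.1 :: p.2])) /=.
  by apply: eq_bigl => -[x I].
exists (fun I : k.+1.-tuple S => (thead I, [tuple of behead I])) => [[x I] _|I _] /=.
  by congr pair; apply: val_inj.
by apply: val_inj; case/tupleP: I.
Qed.

Lemma osp_sum (f : {set 'I_n} -> A) lam J :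
  \sum_(I : (size lam).-tuple {set 'I_n} | is_osp_on J lam I) \prod_(K <- I) f K =
  (\prod_(a <- lam) slice f a) J.
Proof.
elim: lam J => [|a lam IH] J.
  rewrite big_nil ffunE (eq_bigr (fun=> 1)) => [|I _]; last first.
    by rewrite (tuple0 I) big_nil.
  rewrite big_mkcond (big_pred1 [tuple]) => [|I]; last by apply/esym/eqP/tuple0.
  by rewrite /=; case: eqP.
rewrite big_cons slice_mul [LHS](big_tuple_cons _ (is_osp_on J (a :: lam)) (fun I : seq {set 'I_n} => \prod_(K <- I) f K)).
rewrite [RHS]big_mkcond; apply: eq_bigr => K _ /=.
rewrite -IH; case: ifP => KJ; last by rewrite big_pred0 // => I; rewrite andbA KJ.
rewrite mulr_sumr; apply: eq_big => [I|I _]; first by rewrite andbA KJ.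
by rewrite big_cons.
Qed.

Lemma mul_slice (f : {set 'I_n} -> A) k g J : (g * slice f k) J =
  \sum_(K : {set 'I_n} | (K \subset J) && (#|K| == k)) g (J :\: K) * f K.
Proof.
rewrite convE [RHS]big_mkcondr /=.
rewrite (reindex_onto (fun K => J :\: K) (fun K => J :\: K)) /=; last first.
  by move=> K KJ; rewrite setDDr setDv set0U; apply/setIidPr.
apply: eq_big => [K|K /andP[_ /eqP ->]].
  rewrite subsetDl setDDr setDv set0U; apply/eqP/idP => [<-|]; first exact: subsetIl.
  by move/setIidPr.
by rewrite ffunE; case: ifP => // _; rewrite mulr0.
Qed.

Lemma osp_sum_rev (f : {set 'I_n} -> A) lam J :
  \sum_(I : (size lam).-tuple {set 'I_n} | is_osp_on J lam I) \prod_(K <- rev I) f K =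
  (\prod_(a <- rev lam) slice f a) J.
Proof.
elim: lam J => [|a lam IH] J.
  rewrite big_nil ffunE (eq_bigr (fun=> 1)) => [|I _]; last first.
    by rewrite (tuple0 I) big_nil.
  rewrite big_mkcond (big_pred1 [tuple]) => [|I]; last by apply/esym/eqP/tuple0.
  by rewrite /=; case: eqP.
rewrite rev_cons -cats1 big_cat big_seq1 /= mul_slice.
rewrite [LHS](big_tuple_cons _ (is_osp_on J (a :: lam)) (fun I : seq {set 'I_n} => \prod_(K <- rev I) f K)).
rewrite [RHS]big_mkcond; apply: eq_bigr => K _ /=.
rewrite -IH; case: ifP => KJ; last by rewrite big_pred0 // => I; rewrite andbA KJ.
rewrite mulr_suml; apply: eq_big => [I|I _]; first by rewrite andbA KJ.
by rewrite rev_cons -cats1 big_cat big_seq1.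
Qed.

Lemma split_sum_conv z (t : 'I_n -> 'I_n -> A) al J :
  split_sum t z al J = (\prod_(a <- al) slice (principal z t) a) J.
Proof.
elim: al J => [|a al IH] J /=; first by rewrite big_nil ffunE.
by rewrite big_cons slice_mul; apply: eq_bigr => K _; rewrite IH.
Qed.

End Convolution.

Section CommutingMmap.
Variables (F : fieldType) (S : algType F) (n : nat) (h : 'I_n -> S).
Hypothesis hC : forall i j, h i * h j = h j * h i.

(** Commutation of the images of the variables replaces commutativity of the target. *)
Lemma mmap_comm_mul (p q : {mpoly F[n]}) :
  mmap (GRing.in_alg S) h (p * q) = mmap (GRing.in_alg S) h p * mmap (GRing.in_alg S) h q.
Proof.
have h1M m1 m2 : mmap1 h (m1 + m2) = mmap1 h m1 * mmap1 h m2.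
  rewrite /mmap1 -prodrM_comm => [|i j _ _]; last exact/commrX/commr_sym/commrX/hC.
  by apply: eq_bigr => i _; rewrite mnmDE exprD.
rewrite mpolyME raddf_sum big_allpairs /= [in RHS]/mmap mulr_suml.
apply: eq_bigr => m1 _; rewrite mulr_sumr; apply: eq_bigr => m2 _.
rewrite mmapZ mmapX h1M /= !mulr_algl.
by rewrite -scalerAl -scalerAr scalerA.
Qed.

End CommutingMmap.

(** * Identities between the E_k, the D_k and the D'_k *)

Section SliceIdentities.
Variables (F : fieldType) (A : algType F) (n : nat).
Local Notation C := (conv A n).
Implicit Types (f g : {set 'I_n} -> A) (J K : {set 'I_n}).

Lemma slice_sum_left f g (y : F) k J :
  (\sum_(j < k.+1) y ^+ j *: (slice f j * slice g (k - j)) : C) J =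
  if #|J| == k
  then \sum_(K : {set 'I_n} | K \subset J) y ^+ #|K| *: (f K * g (J :\: K)) else 0.
Proof.
rewrite sum_ffunE; under eq_bigr do rewrite ffunE slice_mul scaler_sumr.
case: eqP => [cJ|ne].
  rewrite (exchange_big_dep (fun K => K \subset J)) /=; last by move=> j K _ /andP[].
  apply: eq_bigr => K KJ.
  have lt : (#|K| < k.+1)%N by rewrite ltnS -cJ subset_leq_card.
  rewrite (big_pred1 (Ordinal lt)) => [|j]; last by rewrite /= KJ -val_eqE eq_sym.
  by rewrite ffunE cardsD (setIidPr KJ) cJ eqxx.
rewrite big1 // => j _; rewrite big1 // => K /andP[KJ /eqP cK].
rewrite ffunE cardsD (setIidPr KJ) cK; case: eqP => [e|]; last by rewrite mulr0 scaler0.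
case: ne; have := subset_leq_card KJ; have := ltn_ord j; rewrite cK ltnS => h1 h2.
by rewrite -(subnK h2) e subnK.
Qed.

Lemma slice_sum_right f g (y : F) k J :
  (\sum_(j < k.+1) y ^+ j *: (slice f (k - j) * slice g j) : C) J =
  if #|J| == k
  then \sum_(K : {set 'I_n} | K \subset J) y ^+ #|K| *: (f (J :\: K) * g K) else 0.
Proof.
rewrite sum_ffunE; under eq_bigr do rewrite ffunE mul_slice scaler_sumr.
case: eqP => [cJ|ne].
  rewrite (exchange_big_dep (fun K => K \subset J)) /=; last by move=> j K _ /andP[].
  apply: eq_bigr => K KJ.
  have lt : (#|K| < k.+1)%N by rewrite ltnS -cJ subset_leq_card.
  rewrite (big_pred1 (Ordinal lt)) => [|j]; last by rewrite /= KJ -val_eqE eq_sym.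
  by rewrite ffunE cardsD (setIidPr KJ) cJ eqxx.
rewrite big1 // => j _; rewrite big1 // => K /andP[KJ /eqP cK].
rewrite ffunE cardsD (setIidPr KJ) cK; case: eqP => [e|]; last by rewrite mul0r scaler0.
case: ne; have := subset_leq_card KJ; have := ltn_ord j; rewrite cK ltnS => h1 h2.
by rewrite -(subnK h2) e subnK.
Qed.

Lemma slice0 f : f set0 = 1 -> slice f 0 = 1 :> C.
Proof.
move=> f0; apply/ffunP => J; rewrite !ffunE cards_eq0.
by case: eqP => [->|//].
Qed.

Lemma slice_large f k : (n < k)%N -> slice f k = 0 :> C.
Proof.
move=> nk; apply/ffunP => J; rewrite !ffunE; case: eqP => // cJ.
by have := max_card (mem J); rewrite cJ card_ord leqNgt nk.
Qed.

Variables (v : F) (t : 'I_n -> 'I_n -> A).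
Hypothesis v_neq0 : v != 0.
Hypothesis t_anti : forall i j k l : 'I_n, (i < j)%N -> (k < l)%N ->
  t j k * t i l = t i l * t j k.
Hypothesis t_diag : forall i j k l : 'I_n, (i < j)%N -> (k < l)%N ->
  t j l * t i k = t i k * t j l + (v - v^-1) *: (t i l * t j k).

Definition Eslice (z : F) k : C := slice (principal z t) k.
Definition Dslice k : C := slice (fun J => diag_word t (enum J)) k.
Definition DRslice k : C := slice (fun J => rev_diag_word t (enum J)) k.

Lemma Eslice_comm c i j : c ^+ 2 = (v ^+ 2 - 1) * c + v ^+ 2 ->
  Eslice (c / v) i * Eslice (c / v) j = Eslice (c / v) j * Eslice (c / v) i.
Proof.
move=> cq; apply/ffunP => J.
have := split_sum_swap v_neq0 t_anti t_diag cq i j J.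
by rewrite !split_sum_conv !big_cons !big_nil !mulr1.
Qed.

Lemma Eslice0 z : Eslice z 0 = 1.
Proof. by apply: slice0; rewrite /principal enum_set0. Qed.

Lemma Dslice0 : Dslice 0 = 1.
Proof. by apply: slice0; rewrite enum_set0 /diag_word big_nil. Qed.

Lemma DRslice0 : DRslice 0 = 1.
Proof. by apply: slice0; rewrite enum_set0 /rev_diag_word big_nil. Qed.

(** [minor_diag_sum] with y = z^{-2} - 1, for which y z^2 = 1 - z^2 = - kap z and 1 + y = z^{-2}.
    For z = -1 / v this factor is q, for z = v it is q^{-1}. *)
Lemma Dslice_Eslice z k : z ^+ 2 = (v - v^-1) * z + 1 ->
  (z ^- 2) ^+ k *: Dslice k =
  \sum_(j < k.+1) (z ^- 2 - 1) ^+ j *: (Dslice (k - j) * Eslice z j).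
Proof.
move=> zq; have z0 : z != 0.
  by apply: contra_eq_neq zq => ->; rewrite expr0n mulr0 add0r eq_sym oner_eq0.
apply/ffunP => J; rewrite slice_sum_right !ffunE; case: eqP => [<-|]; last by rewrite scaler0.
have yz : (z ^- 2 - 1) * z = - (v - v^-1).
  apply: (mulIf z0); have -> : (z ^- 2 - 1) * z * z = 1 - z ^+ 2 by field.
  by rewrite zq; ring.
have := minor_diag_sum zq t_anti t_diag J yz.
by rewrite [1 + _]addrC subrK => <-.
Qed.

Lemma Dslice_DRslice k : (0 < k)%N ->
  \sum_(j < k.+1) (-1) ^+ j *: (Dslice j * DRslice (k - j)) = 0.
Proof.
move=> k_gt0; apply/ffunP => J; rewrite slice_sum_left ffunE; case: eqP => // cJ.
by apply: diag_rev_diag_sum; rewrite -card_gt0 cJ.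
Qed.

End SliceIdentities.

(** * Series given by their logarithmic derivative *)

(* P is the series with constant term 1 and logarithmic derivative
   \sum_i (pi i) 'X^i, up to degree N. *)
Definition log_deriv (R : comNzRingType) (N : nat) (P : {poly R}) (pi : nat -> R) : Prop :=
  P`_0 = 1 /\ forall k, (k < N)%N -> P`_k.+1 *+ k.+1 = \sum_(i < k.+1) P`_(k - i) * pi i.

Section LogDerivative.
Variables (R : comNzRingType) (N : nat).
Implicit Types (P Q : {poly R}) (pi rho : nat -> R).

(** Leibniz rule. Only degrees up to k matter, so pi and rho are replaced by the polynomials PI and
    RO. *)
Lemma log_derivM P Q pi rho : log_deriv N P pi -> log_deriv N Q rho ->
  log_deriv N (P * Q) (fun i => pi i + rho i).
Proof.
move=> [P0 P1] [Q0 Q1]; split; first by rewrite coefM big_ord1 /= P0 Q0 mulr1.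
move=> k kN; rewrite -coef_deriv derivM coefD.
pose PI := \poly_(i < k.+1) pi i; pose RO := \poly_(i < k.+1) rho i.
have dE (S : {poly R}) (sig : nat -> R) j : log_deriv N S sig -> (j <= k)%N ->
    S^`()`_j = (S * \poly_(i < k.+1) sig i)`_j.
  move=> [_ S1] jk; rewrite coef_deriv S1 ?(leq_ltn_trans jk) // coefMr.
  apply: eq_bigr => i _; rewrite coef_poly ltnS.
  by rewrite (leq_trans _ jk) // -ltnS.
have -> : (P^`() * Q)`_k = (P * PI * Q)`_k.
  rewrite !coefM; apply: eq_bigr => j _; rewrite (dE _ pi j) // -ltnS //.
have -> : (P * Q^`())`_k = (P * (Q * RO))`_k.
  by rewrite !coefM; apply: eq_bigr => j _; rewrite (dE _ rho (k - j)%N) // leq_subr.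
rewrite -coefD (_ : _ + _ = P * Q * (PI + RO)); last by ring.
rewrite coefMr; apply: eq_bigr => i _.
by rewrite coefD !coef_poly ltn_ord.
Qed.

Lemma log_deriv_prod (I : Type) (r : seq I) (P : I -> {poly R}) (pi : I -> nat -> R) :
  (forall j, log_deriv N (P j) (pi j)) ->
  log_deriv N (\prod_(j <- r) P j) (fun i => \sum_(j <- r) pi j i).
Proof.
move=> h; elim: r => [|j r IH].
  split; first by rewrite big_nil coef1.
  by move=> k _; rewrite big_nil coef1 mul0rn big1 // => i _; rewrite big_nil mulr0.
rewrite big_cons; have [h0 h1] := log_derivM (h j) IH; split=> // k kN.
by rewrite h1 //; apply: eq_bigr => i _; rewrite big_cons.
Qed.

Lemma log_deriv_scale (y : R) P pi : log_deriv N P pi ->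
  log_deriv N (\poly_(i < N.+1) (y ^+ i * P`_i)) (fun i => y ^+ i.+1 * pi i).
Proof.
move=> [P0 P1]; split; first by rewrite coef_poly mul1r.
move=> k kN; rewrite coef_poly ltnS kN -mulrnAr P1 // mulr_sumr.
apply: eq_bigr => i _; rewrite coef_poly.
have ik : (i <= k)%N by rewrite -ltnS.
rewrite (_ : (k - i < N.+1)%N = true); last by lia.
by rewrite -{1}(subnK ik) -addnS exprD; ring.
Qed.

Lemma log_deriv_ext P pi rho : (forall i, (i < N)%N -> pi i = rho i) ->
  log_deriv N P pi -> log_deriv N P rho.
Proof.
move=> e [P0 P1]; split=> // k kN; rewrite P1 //; apply: eq_bigr => i _.
by rewrite e // (leq_ltn_trans _ kN) // -ltnS.
Qed.

(** The recursion is unitriangular in pi, hence solvable without division; solving it for P instead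
    divides by k + 1. *)
Lemma log_deriv_exists_pi P : P`_0 = 1 -> exists pi, log_deriv N P pi.
Proof.
move=> P0; suff [pi h] : exists pi : nat -> R, forall k, (k < N)%N ->
    P`_k.+1 *+ k.+1 = \sum_(i < k.+1) P`_(k - i) * pi i by exists pi.
elim: N => [|M [pi IH]]; first by exists (fun=> 0).
pose x := P`_M.+1 *+ M.+1 - \sum_(i < M) P`_(M - i) * pi i.
exists (fun i => if i == M then x else pi i) => k; rewrite ltnS leq_eqVlt => /orP[/eqP ->|kM].
  rewrite big_ord_recr /= subnn P0 mul1r eqxx.
  rewrite (eq_bigr (fun i : 'I_M => P`_(M - i) * pi i)) => [|i _].
    by rewrite addrC subrK.
  by rewrite ltn_eqF.
rewrite IH //; apply: eq_bigr => i _; rewrite ltn_eqF //.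
by rewrite (leq_ltn_trans _ kM) // -ltnS.
Qed.

Lemma log_deriv_unique P Q pi : (forall k (x : R), x *+ k.+1 = 0 -> x = 0) ->
  log_deriv N P pi -> log_deriv N Q pi -> forall k, (k <= N)%N -> P`_k = Q`_k.
Proof.
move=> tf [P0 P1] [Q0 Q1] k; have [m] := ubnP k; elim: m k => // m IH [|k] km kN.
  by rewrite P0 Q0.
apply/eqP; rewrite -subr_eq0; apply/eqP/(tf k); rewrite mulrnBl P1 // Q1 // -sumrB.
apply: big1 => i _; rewrite IH ?subrr //; last by rewrite (leq_trans (leq_subr _ _)) // ltnW.
by rewrite (leq_ltn_trans (leq_subr _ _)).
Qed.

Lemma log_deriv_pi_unique P pi rho : log_deriv N P pi -> log_deriv N P rho ->
  forall i, (i < N)%N -> pi i = rho i.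
Proof.
move=> [P0 P1] [_ P2] i; have [m] := ubnP i; elim: m i => // m IH i im iN.
have := P1 i iN; rewrite (P2 i iN) !big_ord_recr /= subnn P0 !mul1r.
rewrite (eq_bigr (fun j : 'I_i => P`_(i - j) * pi j)) => [/addrI -> //|j _].
have ji := ltn_ord j; have jm : (j < m)%N by lia.
by rewrite IH //; apply: ltn_trans iN.
Qed.

End LogDerivative.

Lemma log_deriv_map (R S : comNzRingType) (f : {rmorphism R -> S}) N P pi :
  log_deriv N P pi -> log_deriv N (map_poly f P) (fun i => f (pi i)).
Proof.
move=> [P0 P1]; split; first by rewrite coef_map /= P0 rmorph1.
move=> k kN; rewrite coef_map -rmorphMn /= P1 // rmorph_sum.
by apply: eq_bigr => i _; rewrite rmorphM coef_map.
Qed.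

Lemma log_deriv_exists (F : fieldType) (R : comAlgType F) N (pi : nat -> R) :
  (forall k, k.+1%:R != 0 :> F) ->
  exists P : {poly R}, (size P <= N.+1)%N /\ log_deriv N P pi.
Proof.
move=> F0; suff [a a0 h] : exists2 a : nat -> R, a 0%N = 1 & forall k, (k < N)%N ->
    a k.+1 *+ k.+1 = \sum_(i < k.+1) a (k - i)%N * pi i.
  exists (\poly_(i < N.+1) a i); split; first exact: size_poly.
  split; first by rewrite coef_poly.
  move=> k kN; rewrite coef_poly ltnS kN h //; apply: eq_bigr => i _.
  rewrite coef_poly (_ : (k - i < N.+1)%N = true) //.
  by rewrite ltnS (leq_trans (leq_subr _ _)) // ltnW.
elim: N => [|M [a a0 IH]]; first by exists (fun=> 1).
pose x : R := (M.+1%:R : F)^-1 *: \sum_(i < M.+1) a (M - i)%N * pi i.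
exists (fun k => if k == M.+1 then x else a k) => // k; rewrite ltnS leq_eqVlt => /orP[/eqP ->|kM].
  rewrite eqxx -scaler_nat scalerA divff ?F0 // scale1r.
  by apply: eq_bigr => i _; rewrite ltn_eqF // ltnS leq_subr.
rewrite ltn_eqF // IH //; apply: eq_bigr => i _.
by rewrite ltn_eqF // ltnS (leq_trans (leq_subr _ _)) // ltnW.
Qed.

(** * Plethysm *)

Lemma comp_mpoly_assoc (F : fieldType) n k l (P : {mpoly F[n]})
    (lq : n.-tuple {mpoly F[k]}) (lr : k.-tuple {mpoly F[l]}) :
  (P \mPo lq) \mPo lr = P \mPo [tuple tnth lq i \mPo lr | i < n].
Proof.
rewrite [P \mPo lq]comp_mpolyE [RHS]comp_mpolyE raddf_sum /=; apply: eq_bigr => m _.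
rewrite comp_mpolyZ rmorph_prod /=; congr (_ *: _); apply: eq_bigr => i _.
by rewrite rmorphXn tnth_mktuple.
Qed.

Lemma mulrn_eq0_mpoly (R : comNzRingType) n :
  (forall k (x : R), x *+ k.+1 = 0 -> x = 0) ->
  forall k (x : {mpoly R[n]}), x *+ k.+1 = 0 -> x = 0.
Proof.
move=> tf k x e; apply/mpolyP => m; rewrite mcoeff0; apply: (tf k).
by rewrite -mcoeffMn e mcoeff0.
Qed.

Section SymmetricPolynomials.
Variables (F : fieldType) (n : nat).
Hypothesis F0 : forall k, k.+1%:R != 0 :> F.
Local Notation R0 := {mpoly F[n]}.

Definition nvar (i : nat) : R0 := if insub i is Some j then 'X_j else 0.

Lemma nvarE (i : 'I_n) : nvar i = 'X_i.
Proof. by rewrite /nvar valK. Qed.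

Lemma mulrn_eq0_field k (x : F) : x *+ k.+1 = 0 -> x = 0.
Proof. by move/eqP; rewrite -mulr_natr mulf_eq0 (negPf (F0 k)) orbF => /eqP. Qed.

Definition mulrn_eq0_R0 := mulrn_eq0_mpoly (n := n) mulrn_eq0_field.

Lemma log_deriv_linear (R : comNzRingType) (y : R) N :
  log_deriv N (1 + y *: 'X) (fun i => (-1) ^+ i * y ^+ i.+1).
Proof.
have c k : (1 + y *: 'X)`_k = (k == 0%N)%:R + y *+ (k == 1%N).
  by rewrite coefD coef1 coefZ coefX mulr_natr.
split; first by rewrite c addr0.
move=> k _; rewrite c /= add0r.
case: k => [|k] /=; first by rewrite big_ord1 c addr0 /= !mul1r.
rewrite mul0rn big_ord_recr big_ord_recr /= big1 => [|i _].
  by rewrite subSnn subnn !c /= !addr0 add0r add0r !exprS; ring.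
have lt := ltn_ord i; rewrite c (_ : (k.+1 - i == 0)%N = false); last by lia.
by rewrite (_ : (k.+1 - i == 1)%N = false) ?addr0 ?mul0r //; lia.
Qed.

Lemma mesym_coef k : (\prod_(j < n) (1 + 'X_j *: 'X) : {poly R0})`_k = mesym n F k.
Proof.
rewrite bigA_distr coef_sum.
transitivity (\sum_(J in {set 'I_n}) (if #|~: J| == k then \prod_(i in ~: J) 'X_i else 0 : R0)).
  apply: eq_bigr => J _.
  have -> : \prod_i (if i \in J then 1 else 'X_i *: 'X) =
     (\prod_(i in ~: J) 'X_i) *: 'X^#|~: J| :> {poly R0}.
    rewrite (eq_bigr (fun i => if i \in ~: J then 'X_i *: 'X else 1)); last first.
      by move=> i _; rewrite inE; case: (i \in J).
    by rewrite -big_mkcond /= scaler_prod prodr_const.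
  by rewrite coefZ coefXn mulr_natr eq_sym; case: eqP.
rewrite -big_mkcond /= (reindex_inj (@setC_inj _)) /= /mesym.
by apply: eq_big => J; rewrite setCK // inE.
Qed.

Definition power_sums : n.-tuple R0 := [tuple powersum F n i.+1 | i < n].

(** Newton's identities. *)
Lemma log_deriv_mesym :
  log_deriv n (\prod_(j < n) (1 + 'X_j *: 'X) : {poly R0})
    (fun i => (-1) ^+ i * powersum F n i.+1).
Proof.
have := log_deriv_prod (index_enum 'I_n) (fun j => log_deriv_linear ('X_j : R0) n).
by apply: log_deriv_ext => i _; rewrite mulr_sumr.
Qed.

(** In characteristic 0 the p_k and the e_k are polynomials in one another, which carries the
    independence of the e_k over to the p_k. *)
Lemma power_sums_free (P : R0) : P \mPo power_sums = 0 -> P = 0.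
Proof.
(* Here the variable i stands for p_{i+1}, and ew gives e_{i+1} in terms of the power sums. *)
have [W [_ HW]] := @log_deriv_exists F R0 n (fun i => (-1) ^+ i * nvar i) F0.
pose ew : n.-tuple R0 := [tuple W`_i.+1 | i < n].
have ew_ps (Q : R0) : (Q \mPo ew) \mPo power_sums = Q \mPo [tuple mesym n F i.+1 | i < n].
  rewrite comp_mpoly_assoc; congr (_ \mPo _); apply: eq_from_tnth => i.
  rewrite !tnth_mktuple -mesym_coef -coef_map /=.
  apply: (log_deriv_unique mulrn_eq0_R0 _ log_deriv_mesym) => //.
  have := log_deriv_map (comp_mpoly power_sums) HW; apply: log_deriv_ext => k kn /=.
  rewrite rmorphM rmorphXn rmorphN rmorph1 /= -[k]/(nat_of_ord (Ordinal kn)) nvarE.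
  by rewrite comp_mpolyXU -tnth_nth tnth_mktuple.
(* Conversely, with the variable i standing for e_{i+1}, N gives p_{i+1}. *)
pose E : {poly R0} := \poly_(k < n.+1) (if k is i.+1 then nvar i else 1).
have [rho Hrho] : exists rho, log_deriv n E rho.
  by apply: log_deriv_exists_pi; rewrite coef_poly.
pose N : n.-tuple R0 := [tuple (-1) ^+ i * rho i | i < n].
have NewE (i : 'I_n) : tnth N i \mPo ew = 'X_i.
  rewrite tnth_mktuple rmorphM rmorphXn rmorphN rmorph1 /=.
  have [h0 h1] := log_deriv_map (comp_mpoly ew) Hrho.
  have EW k : (k <= n)%N -> (map_poly (comp_mpoly ew) E)`_k = W`_k.
    move=> kn; rewrite coef_map /= coef_poly ltnS kn; case: k kn => [|k] kn.
      by rewrite rmorph1; case: HW.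
    rewrite -[k]/(nat_of_ord (Ordinal kn)) nvarE.
    by rewrite comp_mpolyXU -tnth_nth tnth_mktuple.
  have H : log_deriv n W (fun i => rho i \mPo ew).
    split; first by case: HW.
    move=> k kn; have := h1 k kn; rewrite EW // => ->; apply: eq_bigr => j _.
    by rewrite EW // (leq_trans (leq_subr _ _)) // ltnW.
  rewrite (log_deriv_pi_unique H HW) // nvarE mulrA -exprD addnn -mul2n exprM.
  by rewrite sqrrN expr1n expr1n mul1r.
have PN (Q : R0) : Q = (Q \mPo N) \mPo ew.
  rewrite comp_mpoly_assoc -{1}(comp_mpoly_id Q); congr (_ \mPo _).
  by apply: eq_from_tnth => i; rewrite [RHS]tnth_mktuple NewE tnth_mktuple.
rewrite (PN P) ew_ps => /msym_fundamental_un0 ->.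
by rewrite comp_mpoly0.
Qed.

Lemma plethysm_eq (c : nat -> F) (f g : mpoly n F) : is_plethysm c f g -> plethysm c f = g.
Proof.
move=> fg; rewrite /plethysm; case: boolp.pselect => [ex|]; last by case; exists g.
case: (boolp.cid ex) => g' [P' [f' g'E]] /=; case: fg => P [fP ->]; rewrite g'E.
congr (_ \mPo _); apply/eqP; rewrite -subr_eq0; apply/eqP/power_sums_free.
by rewrite raddfB /= -f' -fP subrr.
Qed.

(** One factor of the Cauchy kernel, the polynomial variable recording the degree so that the
    coefficient of degree n can be extracted. *)
Definition bounded_series (R : comNzRingType) (a : {poly R}) (j : 'I_n) : {poly {mpoly R[n]}} :=
  \poly_(k < n.+1) ('X_j ^+ k * (map_poly (@mpolyC n R) a)`_k).

Lemma bounded_series_coef (R : comNzRingType) (a : {poly R}) m :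
  ((\prod_(j < n) bounded_series a j)`_n)@_m =
  if mdeg m == n then \prod_(j < n) a`_(m j) else 0.
Proof.
rewrite (eq_bigr (fun j => \sum_(k < n.+1) (a`_k *: 'X_j ^+ k : {mpoly R[n]}) *: 'X^k)); last first.
  move=> j _; rewrite /bounded_series poly_def; apply: eq_bigr => k _.
  by rewrite coef_map /= mulrC mul_mpolyC.
rewrite bigA_distr_bigA coef_sum.
pose mm (f : {ffun 'I_n -> 'I_n.+1}) : 'X_{1..n} := [multinom (f j : nat) | j < n].
have fE (f : {ffun 'I_n -> 'I_n.+1}) :
    ((\prod_(j < n) ((a`_(f j) *: 'X_j ^+ (f j) : {mpoly R[n]}) *: 'X^(f j)))`_n)@_m =
    if (mm f == m) && (mdeg m == n) then \prod_(j < n) a`_(m j) else 0.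
  rewrite scaler_prod scaler_prod coefZ.
  have -> : \prod_(j < n) 'X^(f j) = 'X^(mdeg (mm f)) :> {poly {mpoly R[n]}}.
    rewrite mdegE -prodrXr; apply: eq_bigr => j _.
    by rewrite mnmE.
  have -> : \prod_(j < n) 'X_j ^+ f j = 'X_[mm f] :> {mpoly R[n]}.
    by rewrite mpolyXE_id; apply: eq_bigr => j _; rewrite mnmE.
  rewrite coefXn mulr_natr mcoeffMn mcoeffZ mcoeffX; case: eqP => [<-|_] /=.
    rewrite mulr1 [n == _]eq_sym; case: eqP => _; rewrite ?mulr0n // mulr1n.
    by apply: eq_bigr => j _; rewrite mnmE.
  by rewrite mulr0 mul0rn.
rewrite raddf_sum (eq_bigr _ (fun f _ => fE f)); case: eqP => dm; last first.
  by apply: big1 => f _; rewrite andbF.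
have mj j : (m j < n.+1)%N by rewrite ltnS -{2}dm mdegE (bigD1 j) //= leq_addr.
pose f0 := [ffun j => Ordinal (mj j)].
have mf0 : mm f0 = m by apply/mnmP => j; rewrite mnmE ffunE.
rewrite (bigD1 f0) //= mf0 eqxx [X in _ + X]big1 ?addr0 // => f ne.
case: eqP => //= e; case/eqP: ne; apply/ffunP => j; apply: val_inj.
by rewrite ffunE /= -e mnmE.
Qed.

(* The elementary symmetric functions e_k, k <= n, as free generators: the
   variables of {mpoly F[n]}. *)
Definition generic_series : {poly R0} :=
  \poly_(k < n.+1) (if k is i.+1 then nvar i else 1).

(* f is the image under y of the Cauchy kernel \prod_j \sum_k e_k X_j^k. The
   logarithmic derivative of the latter is \sum_k p_k(X) pi_k, so that rescaling
   p_k(X) amounts to rescaling pi_k. *)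
Lemma generic_plethysm (y : {linear R0 -> F^o}) (c : nat -> F) pi (d : {poly R0}) (f : mpoly n F) m :
  log_deriv n generic_series pi ->
  log_deriv n d (fun i => c i.+1 *: pi i) ->
  (forall m, f@_m = if mdeg m == n then y (\prod_(j < n) generic_series`_(m j)) else 0) ->
  (plethysm c f)@_m = if mdeg m == n then y (\prod_(j < n) d`_(m j)) else 0.
Proof.
move=> Hpi Hd fE.
(* W_n expresses universally the degree n coefficient of a series by those of its logarithmic
   derivative. It is evaluated at the products of p_{i+1} and a multiple of pi_i; applying y to the
   pi_i leaves the polynomial P in the power sums, the same for every rescaling b. *)
have [W [_ HW]] := @log_deriv_exists F R0 n nvar F0.
pose P : R0 := \sum_(m' <- msupp W`_n) (W`_n@_m' * y (\prod_(i < n) pi i ^+ m' i)) *: 'X_[m'].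
have key (b : nat -> F) (a : {poly R0}) k : log_deriv n a (fun i => b i.+1 *: pi i) ->
    (P \mPo [tuple b i.+1 *: powersum F n i.+1 | i < n])@_k =
    if mdeg k == n then y (\prod_(j < n) a`_(k j)) else 0.
  move=> Ha.
  (* Two alphabets: the X_j are the outer variables, the e_k those of the coefficient ring. *)
  pose iota : R0 -> {mpoly R0[n]} := map_mpoly (@mpolyC n F).
  pose x i : {mpoly R0[n]} := iota (powersum F n i.+1) * (b i.+1 *: pi i)%:MP.
  pose th : R0 -> {mpoly R0[n]} := mmap (@mpolyC n R0 \o @mpolyC n F) (fun i : 'I_n => x i).
  have H1 := log_deriv_prod (index_enum 'I_n) (fun j : 'I_n =>
    log_deriv_scale ('X_j : {mpoly R0[n]}) (log_deriv_map (@mpolyC n R0) Ha)).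
  have H2 : log_deriv n (map_poly th W) (fun i => x i).
    have := log_deriv_map [the {rmorphism R0 -> {mpoly R0[n]}} of th] HW.
    apply: log_deriv_ext => i lt /=.
    by rewrite -[i]/(nat_of_ord (Ordinal lt)) nvarE /th mmapX mmap1U.
  have H3 : log_deriv n (\prod_(j < n) bounded_series a j) x.
    apply: log_deriv_ext H1 => i lt /=; rewrite /x -mulr_suml; congr (_ * _).
    rewrite /iota /powersum raddf_sum; apply: eq_bigr => j _.
    by rewrite /= rmorphXn /= map_mpolyX.
  have e : (\prod_(j < n) bounded_series a j)`_n = th W`_n.
    have tf := mulrn_eq0_mpoly (n := n) mulrn_eq0_R0.
    by rewrite (log_deriv_unique tf H3 H2 (leqnn n)) coef_map.
  have thE : th W`_n = \sum_(m' <- msupp W`_n) (W`_n@_m')%:MP%:MP *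
      (iota (\prod_(i < n) powersum F n i.+1 ^+ m' i) *
       ((\prod_(i < n) b i.+1 ^+ m' i) *: \prod_(i < n) pi i ^+ m' i)%:MP).
    apply: eq_bigr => m' _; congr (_ * _); rewrite /mmap1.
    rewrite -scaler_prod rmorph_prod /iota rmorph_prod -big_split.
    by apply: eq_bigr => i _; rewrite /x exprMn -exprZn !rmorphXn.
  have -> : (if mdeg k == n then y (\prod_(j < n) a`_(k j)) else 0) =
      y (((\prod_(j < n) bounded_series a j)`_n)@_k).
    by rewrite bounded_series_coef; case: ifP => _; rewrite ?raddf0.
  rewrite e thE /P (raddf_sum (comp_mpoly _)) 2!(raddf_sum (mcoeff k)) (raddf_sum y) /=.
  apply: eq_bigr => m' _.
  rewrite comp_mpolyZ comp_mpolyX mcoeffZ mcoeffCM mulrC [iota _ * _]mulrC mcoeffCM.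
  rewrite /iota mcoeff_map_mpoly /= [_ * (_@__)%:MP]mulrC !mul_mpolyC !linearZ /=.
  rewrite (eq_bigr (fun i : 'I_n => (b i.+1 *: powersum F n i.+1) ^+ m' i)); last first.
    by move=> i _; rewrite tnth_mktuple.
  rewrite (eq_bigr (fun i : 'I_n => b i.+1 ^+ m' i *: powersum F n i.+1 ^+ m' i)); last first.
    by move=> i _; rewrite exprZn.
  by rewrite scaler_prod mcoeffZ /GRing.scale /=; ring.
(* The rescaling b = 1 recovers f from P, and b = c gives its plethysm. *)
have H1 : log_deriv n generic_series (fun i => 1 *: pi i).
  by apply: log_deriv_ext Hpi => i _; rewrite scale1r.
have -> : plethysm c f = P \mPo [tuple c i.+1 *: powersum F n i.+1 | i < n].
  apply: plethysm_eq; exists P; split=> //; apply/mpolyP => k.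
  rewrite fE -(key (fun=> 1) _ _ H1); congr ((_ \mPo _)@_k).
  by apply: eq_from_tnth => i; rewrite !tnth_mktuple scale1r.
exact: key.
Qed.

End SymmetricPolynomials.

(** * Specialization at q = 1 *)

Section HeckeMap.
Variables (n : nat) (R S : comUnitRingType) (f : {rmorphism R -> S}) (q : R).
Implicit Types (u w x : 'S_n).

Definition hecke_map (Z : hecke q n) : hecke (f q) n := [ffun w => f (Z w)].

Lemma hecke_map_T w : hecke_map (T q w) = T (f q) w.
Proof. by apply/ffunP => x; rewrite !ffunE rmorph_nat. Qed.

Lemma hecke_map_mulT (Z : hecke q n) u : hecke_map (Z * T q u) = hecke_map Z * T (f q) u.
Proof.
elim/perm_ind_right: u => [|i j u ij lt IH]; first by rewrite !mulr1.
rewrite (T_mulSr q ij lt).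
rewrite (T_mulSr (f q) ij lt).
rewrite [Z * _]mulrA [hecke_map Z * _]mulrA.
rewrite -IH.
apply/ffunP => x; rewrite [LHS]ffunE (T_mul_coef _ _ ij) (T_mul_coef _ _ ij).
case: ifP => _; rewrite !ffunE.
  by rewrite rmorphM.
by rewrite rmorphD rmorphM rmorphB rmorph1.
Qed.

Lemma ind_char_map lam w :
  f (ind_char (fun x => (-1) ^+ len x) lam (T q w)) =
  ind_char (fun x => (-1) ^+ len x) lam (T (f q) w).
Proof.
have E (R' : comUnitRingType) (q' : R') (D : hecke q' n) :
    ind_char (fun x => (-1) ^+ len x) lam D =
    \sum_(u in coset_min n lam) \sum_(x in young n lam) (D * T q' u) (u * x)%g * (-1) ^+ len x.
  by rewrite [RHS]big_enum_val /=; apply: eq_bigr => i _; rewrite mxE.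
rewrite !E rmorph_sum; apply: eq_bigr => u _; rewrite rmorph_sum; apply: eq_bigr => x _.
by rewrite rmorphM rmorphXn rmorphN rmorph1 -hecke_map_T -hecke_map_mulT ffunE.
Qed.

End HeckeMap.

Section GroupAlgebra.
Variables (n : nat) (R : comUnitRingType).
Implicit Types (u w x : 'S_n).

Lemma T1_mul w u : T (1 : R) w * T 1 u = T 1 (w * u).
Proof.
elim/perm_ind_right: u => [|i j u ij lt IH]; first by rewrite mulr1 mulg1.
rewrite T_mulSr // mulrA IH T_mulTs // /mulT_Ts mulgA.
by case: ifP => // _; rewrite scale1r subrr scale0r addr0.
Qed.

Lemma sign_len w : (-1) ^+ len w = (-1) ^+ (odd_perm w) :> R.
Proof.
elim/perm_ind_left: w => [|i j w ij lt IH]; first by rewrite len1 odd_perm1.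
rewrite len_sl // lt exprS IH odd_permM odd_tperm (adj_neq ij) /=.
by rewrite signrN mulN1r.
Qed.

(** A coset contributes when w fixes it, and conjugation preserves the sign. *)
Lemma ind_char_T1 lam w :
  ind_char (fun x => (-1) ^+ len x) lam (T (1 : R) w) =
  (-1) ^+ (odd_perm w) *+ #|[set u in coset_min n lam | (u^-1 * w * u)%g \in young n lam]|.
Proof.
transitivity (\sum_(u in coset_min n lam) \sum_(x in young n lam)
   (T (1 : R) w * T 1 u) (u * x)%g * (-1) ^+ len x).
  by rewrite [RHS]big_enum_val /=; apply: eq_bigr => i _; rewrite mxE.
rewrite -sumr_const [RHS](eq_bigl (fun u => (u \in coset_min n lam) &&
    ((u^-1 * w * u)%g \in young n lam))); last by move=> u; rewrite inE.
rewrite [RHS]big_mkcondr /=; apply: eq_bigr => u _; rewrite T1_mul.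
have cond x : (T (1 : R) (w * u)) (u * x)%g = (x == u^-1 * w * u)%g%:R.
  rewrite ffunE; congr (nat_of_bool _)%:R.
  by rewrite -[RHS](inj_eq (mulgI u)) -mulgA mulKVg.
case: ifPn => wy; last first.
  apply: big1 => x xy; rewrite cond; case: eqP => [e|_]; last by rewrite mul0r.
  by rewrite -e xy in wy.
rewrite (bigD1 (u^-1 * w * u)%g) //= big1 ?addr0 => [|x /andP[_ /negPf ne]].
  rewrite cond eqxx mul1r sign_len; congr (_ ^+ _).
  by rewrite !odd_permM odd_permV addbC addbA addbb addFb.
by rewrite cond ne mul0r.
Qed.

End GroupAlgebra.

(** * A permutation of cycle type nu in the Young subgroup of nu *)

Section BlockCycle.
Variables (n : nat) (nu : seq nat).
Hypotheses (nu0 : 0%N \notin nu) (sum_nu : sumn nu = n).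
Local Notation blk := (reshape_index nu).
Local Notation ofs := (reshape_offset nu).

Lemma nth_nu_gt0 b : (b < size nu)%N -> (0 < nth 0 nu b)%N.
Proof. by move=> lt; rewrite lt0n; apply: contraNneq nu0 => <-; apply: mem_nth. Qed.

Lemma blk_lt (i : 'I_n) : (blk i < size nu)%N.
Proof. by apply: reshape_indexP; rewrite sum_nu. Qed.

Lemma ofs_lt (i : 'I_n) : (ofs i < nth 0 nu (blk i))%N.
Proof. by apply: reshape_offsetP; rewrite sum_nu. Qed.

Lemma flatten_index_lt b c : (b < size nu)%N -> (c < nth 0 nu b)%N ->
  (flatten_index nu b c < n)%N.
Proof. by move=> h1 h2; rewrite -sum_nu; apply: flatten_indexP. Qed.

Lemma block_eq_ord (i j : 'I_n) : blk i = blk j -> ofs i = ofs j -> i = j.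
Proof.
by move=> e1 e2; apply: val_inj; rewrite /= -(reshape_indexK nu i) -(reshape_indexK nu j) e1 e2.
Qed.

Lemma block_cycle_lt (i : 'I_n) :
  (flatten_index nu (blk i) ((ofs i).+1 %% nth 0 nu (blk i)) < n)%N.
Proof. by apply: flatten_index_lt; rewrite ?blk_lt // ltn_mod nth_nu_gt0 // blk_lt. Qed.

Definition block_cycle_fun i : 'I_n := Ordinal (block_cycle_lt i).

Lemma block_cycle_blk i : blk (block_cycle_fun i) = blk i.
Proof. by rewrite /= flatten_indexKl // ltn_mod nth_nu_gt0 // blk_lt. Qed.

Lemma block_cycle_ofs i : ofs (block_cycle_fun i) = ((ofs i).+1 %% nth 0 nu (blk i))%N.
Proof. by rewrite /= flatten_indexKr // ltn_mod nth_nu_gt0 // blk_lt. Qed.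

Lemma block_cycle_inj : injective block_cycle_fun.
Proof.
move=> i j e; have eb : blk i = blk j by rewrite -(block_cycle_blk i) e block_cycle_blk.
apply: block_eq_ord => //; have := block_cycle_ofs i; rewrite e block_cycle_ofs eb.
have := ofs_lt i; have := ofs_lt j; rewrite eb.
move: (ofs i) (ofs j) (nth _ _ _) => a b m bm am.
case: (ltngtP a.+1 m) => [h1|h1|h1]; last 1 first.
- rewrite -h1 modnn; case: (ltngtP b.+1 m) => [h2|h2|h2].
  + by rewrite h1 modn_small.
  + by lia.
  + by lia.
- case: (ltngtP b.+1 m) => [h2|h2|h2].
  + by rewrite !modn_small // => -[].
  + by lia.
  + by rewrite -h2 modnn modn_small ?h2.
- by lia.
Qed.

Definition block_cycle : 'S_n := perm block_cycle_inj.

Lemma block_cycle_young : block_cycle \in young n nu.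
Proof. by apply/youngP => i; rewrite permE block_cycle_blk. Qed.

Definition block_start_ord b (lt : (b < size nu)%N) : 'I_n :=
  Ordinal (flatten_index_lt lt (nth_nu_gt0 lt)).

Lemma block_cycle_invariant (X : Type) (f : 'I_n -> X) :
  (forall i, f (block_cycle i) = f i) -> forall i j : 'I_n, blk i = blk j -> f i = f j.
Proof.
move=> inv; have key (i : 'I_n) : f i = f (block_start_ord (blk_lt i)).
  have [o] := ubnP (ofs i); elim: o i => // o IH i le.
  case eo : (ofs i) => [|o'].
    congr f; apply: block_eq_ord; rewrite /= ?flatten_indexKl ?flatten_indexKr ?nth_nu_gt0 ?blk_lt //.
  have lt' : (o' < nth 0 nu (blk i))%N by apply: leq_trans (ofs_lt i); rewrite eo.
  pose j := Ordinal (flatten_index_lt (blk_lt i) lt').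
  have bj : blk j = blk i by rewrite /= flatten_indexKl.
  have oj : ofs j = o' by rewrite /= flatten_indexKr.
  have -> : i = block_cycle j.
    apply: block_eq_ord; rewrite permE ?block_cycle_blk ?block_cycle_ofs ?bj ?oj //.
    by rewrite modn_small // -eo ofs_lt.
  rewrite inv IH; last by rewrite oj -ltnS -eo.
  have bc : blk (block_cycle j) = blk j by rewrite permE block_cycle_blk.
  by congr f; apply: val_inj; rewrite -[LHS]/(flatten_index nu (blk j) 0) -bc.
by move=> i j e; rewrite key [RHS]key; congr f; apply: val_inj; rewrite /= e.
Qed.

Lemma card_block b : (b < size nu)%N -> #|[set i : 'I_n | blk i == b]| = nth 0 nu b.
Proof.
move=> lt; pose g (c : 'I_(nth 0 nu b)) := Ordinal (flatten_index_lt lt (ltn_ord c)).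
have gI : injective g.
  move=> c d /(congr1 (fun i : 'I_n => ofs i)) /=; rewrite !flatten_indexKr //.
  exact: val_inj.
rewrite -[RHS]card_ord -(card_imset _ gI); apply: eq_card => i; rewrite inE.
apply/eqP/imsetP => [e|[c _ ->]]; last by rewrite /= flatten_indexKl.
have oi : (ofs i < nth 0 nu b)%N by rewrite -e ofs_lt.
exists (Ordinal oi) => //; apply: val_inj.
by rewrite /= -e reshape_indexK.
Qed.

End BlockCycle.

(** Each cycle is sent by u into a single block of lam, which defines a map g from the blocks of nu
    onto those of lam. If there are equally many, g is bijective and preserves sizes. *)
Lemma block_cycle_conj_young n (lam nu : seq nat) (nu0 : 0%N \notin nu) (sum_nu : sumn nu = n)
    (u : 'S_n) : is_part n lam -> sorted geq nu ->
  (u^-1 * block_cycle nu0 sum_nu * u)%g \in young n lam ->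
  (size lam <= size nu)%N /\ (size lam = size nu -> lam = nu).
Proof.
move=> /and3P[so_lam lam0 /eqP sum_lam] so_nu /youngP uy.
pose f (i : 'I_n) := reshape_index lam (u i).
have fnu (i j : 'I_n) : reshape_index nu i = reshape_index nu j -> f i = f j.
  apply: (@block_cycle_invariant n nu nu0 sum_nu _ f) => k.
  have := uy (u k); rewrite !permM permK.
  by rewrite /f.
pose start b (lt : (b < size nu)%N) := block_start_ord nu0 sum_nu lt.
have f_lt i : (f i < size lam)%N by apply: blk_lt.
pose g (b : 'I_(size nu)) : 'I_(size lam) := Ordinal (f_lt (start b (ltn_ord b))).
have gE (i : 'I_n) : f i = g (Ordinal (blk_lt sum_nu i)).
  by apply: fnu; rewrite /= flatten_indexKl // nth_nu_gt0 // blk_lt.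
have g_surj c : exists b, g b = c.
  pose i := (u^-1)%g (block_start_ord lam0 sum_lam (ltn_ord c)).
  exists (Ordinal (blk_lt sum_nu i)); apply: val_inj; transitivity (f i).
    by rewrite (gE i).
  by rewrite /f permKV /= flatten_indexKl // nth_nu_gt0.
have imT : g @: setT = setT.
  by apply/setP => c; rewrite !inE; have [b <-] := g_surj c; apply: imset_f.
have sz : (size lam <= size nu)%N.
  by rewrite -[size lam]card_ord -[size nu]card_ord -cardsT -imT -cardsT leq_imset_card.
split=> // eq_sz.
have gI : injective g.
  have /imset_injP h : #|g @: setT| == #|[set: 'I_(size nu)]|.
    by rewrite imT !cardsT !card_ord eq_sz.
  by move=> a b; apply: h; rewrite inE.
have nuE (b : 'I_(size nu)) : nth 0%N nu b = nth 0%N lam (g b).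
  rewrite -(card_block sum_nu) // -(card_block sum_lam) //.
  rewrite -(card_imset _ (@perm_inj _ u)); apply: eq_card => i; rewrite inE.
  apply/imsetP/eqP => [[j]|e].
    rewrite inE => /eqP e ->; rewrite -/(f j) gE; congr (nat_of_ord (g _)).
    exact: val_inj.
  exists ((u^-1)%g i); rewrite ?permKV // inE; apply/eqP.
  have : g (Ordinal (blk_lt sum_nu ((u^-1)%g i))) = g b.
    by apply: val_inj; transitivity (f ((u^-1)%g i)); [rewrite gE | rewrite /f permKV e].
  by move/gI/(congr1 val).
apply: (@sorted_eq _ geq) => //.
- by move=> a b c h1 h2; apply: leq_trans h2 h1.
- by move=> a b /andP[h1 h2]; apply/eqP; rewrite eqn_leq; apply/andP.
rewrite perm_sym.
have -> : nu = [seq nth 0%N lam (g b) | b <- enum 'I_(size nu)].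
  apply: (@eq_from_nth _ 0%N); first by rewrite size_map size_enum_ord.
  move=> i lt; rewrite (nth_map (Ordinal lt)) ?size_enum_ord //.
  by rewrite -nuE nth_enum_ord.
have e2 : [seq nth 0%N lam c | c <- [seq nat_of_ord c | c <- enum 'I_(size lam)]] = lam.
  by rewrite val_enum_ord map_nth_iota0 // take_size.
rewrite -[X in perm_eq _ X]e2 -map_comp (map_comp (fun c : 'I_(size lam) => nth 0%N lam c) g).
apply: perm_map; apply: uniq_perm; rewrite ?map_inj_uniq -?enumT ?enum_uniq //.
move=> c; rewrite mem_enum; have [b <-] := g_surj c.
by apply: map_f; rewrite mem_enum.
Qed.

(** * Freeness of the characters epsilon^mu *)

Lemma partsP n (mu : intpart n) : is_part n (parts mu).
Proof. exact: (svalP mu). Qed.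

Lemma parts_inj n : injective (@parts n).
Proof.
move=> [mu hmu] [nu hnu] e; apply: val_inj => /=; apply: val_inj => /=.
exact: (inj_map val_inj e).
Qed.

Lemma parts_nonzero n (mu : intpart n) : 0%N \notin parts mu.
Proof. by case/and3P: (partsP mu). Qed.

Lemma parts_sum n (mu : intpart n) : sumn (parts mu) = n.
Proof. by case/and3P: (partsP mu) => _ _ /eqP. Qed.

Section CharacterTable.
Variable n : nat.
Local Notation N := #|{: intpart n}|.

Definition cycle_rep (mu : intpart n) : 'S_n :=
  block_cycle (parts_nonzero mu) (parts_sum mu).

Definition epsilon_table (R : comUnitRingType) (q : R) : 'M[R]_N :=
  \matrix_(i, j) ind_char (fun w => (-1) ^+ len w) (parts (enum_val i))
     (T q (cycle_rep (enum_val j))).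

Lemma epsilon_table_map (R S : comUnitRingType) (f : {rmorphism R -> S}) q :
  map_mx f (epsilon_table q) = epsilon_table (f q).
Proof. by apply/matrixP => i j; rewrite !mxE ind_char_map. Qed.

(* At q = 1, epsilon^lam vanishes on the cycle type mu unless lam is coarser than
   mu; the table is triangular for the number of parts. *)
Lemma epsilon_table1_unit : epsilon_table (1 : rat) \in unitmx.
Proof.
rewrite -row_free_unit; apply: inj_row_free => k kM.
apply/eqP; apply: contraT => /rV0Pn[i0 ki0].
(* In the column of a partition with the fewest parts among those of nonzero coefficient, only the
   diagonal entry survives; it is nonzero because u = 1 is counted. *)
case: (@arg_minnP _ i0 (fun i => k 0 i != 0) (fun i => size (parts (enum_val i))) ki0).
move=> i ki imin; have /rowP/(_ i) := kM; rewrite !mxE (bigD1 i) //= big1 ?addr0 => [|j ji].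
  rewrite mxE ind_char_T1 => /eqP; rewrite mulf_eq0 (negPf ki) /= -mulr_natl mulf_eq0.
  rewrite signr_eq0 orbF Num.Theory.pnatr_eq0 cards_eq0 => /eqP/setP/(_ 1%g).
  rewrite in_set0 in_set invg1 mul1g mulg1 [X in _ && X]block_cycle_young andbT in_set.
  move=> /negbT; case/negP; apply/forall_inP => w _.
  by rewrite mul1g len1.
rewrite mxE ind_char_T1.
have [->|kj] := eqVneq (k 0 j) 0; first by rewrite mul0r.
rewrite (_ : [set _ in _ | _] = set0) ?cards0 ?mulr0n ?mulr0 //.
apply/setP => u; rewrite in_set0 [LHS]in_set; apply/negbTE/negP => /andP[_ hu].
have /and3P[so _ _] := partsP (enum_val i).
have [sz eq_sz] := block_cycle_conj_young (partsP (enum_val j)) so hu.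
have e : size (parts (enum_val j)) = size (parts (enum_val i)).
  by apply/eqP; rewrite eqn_leq sz imin.
by move: ji; rewrite (enum_val_inj (parts_inj (eq_sz e))) eqxx.
Qed.

(** The determinant is a polynomial in q^{1/2} whose value at 1 is the nonzero determinant of the
    previous table. *)
Lemma epsilon_table_unit : epsilon_table (qhalf ^+ 2) \in unitmx.
Proof.
have -> : qhalf ^+ 2 = tofrac ('X ^+ 2 : {poly rat}) by rewrite tofracXn.
rewrite -(epsilon_table_map (@tofrac _)) unitmxE det_map_mx unitfE tofrac_eq0.
apply/eqP => det0; have := epsilon_table1_unit.
have {1}-> : 1 = horner_eval (1 : rat) ('X ^+ 2) by rewrite /horner_eval hornerXn expr1n.
rewrite -(epsilon_table_map (horner_eval (1 : rat))) unitmxE det_map_mx det0.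
by rewrite raddf0 unitr0.
Qed.

Lemma epsilonE (F : fieldType) (q : F) lam D :
  epsilon q n lam D = ind_char (fun w => (-1) ^+ len w) lam D.
Proof. by rewrite lfunE. Qed.

Lemma epsilon_tuple_free : free (epsilon_tuple (qhalf ^+ 2) n).
Proof.
apply/freeP => k k0 i.
pose kr : 'rV[Qv]_N := \row_i k i.
suff /rowP/(_ i) : kr = 0 by rewrite !mxE.
apply: (can_inj (mulmxK epsilon_table_unit)); rewrite mul0mx; apply/rowP => j; rewrite !mxE.
have /lfunP/(_ (T (qhalf ^+ 2) (cycle_rep (enum_val j)))) := k0.
rewrite sum_lfunE zero_lfunE => e; rewrite -[RHS]e; apply: eq_bigr => l _.
by rewrite !mxE scale_lfunE /epsilon_tuple -tnth_nth tnth_mktuple epsilonE.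
Qed.

End CharacterTable.

(** * Transfer of symmetric functions to the convolution algebra *)

Section Transfer.
Variables (F : fieldType) (n : nat).
Local Notation R0 := {mpoly F[n]}.
Local Notation E := (generic_series F n).

(** The condition on alpha and beta says that a(yX) and a(X) b(xX) have the same logarithmic
    derivative; the conclusion compares their coefficients of degree k. *)
Lemma log_deriv_relation (a b : {poly R0}) (alpha beta : nat -> R0) (x y : F) k :
  (forall k, k.+1%:R != 0 :> F) ->
  log_deriv n a alpha -> log_deriv n b beta ->
  (forall i, (i < n)%N -> y ^+ i.+1 *: alpha i = alpha i + x ^+ i.+1 *: beta i) ->
  (k <= n)%N ->
  y ^+ k *: a`_k = \sum_(j < k.+1) x ^+ j *: (a`_(k - j) * b`_j).
Proof.
move=> F0 Ha Hb e kn.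
have sc (z : F) i (g : R0) : z%:A ^+ i * g = z ^+ i *: g.
  by rewrite exprZn expr1n mulr_algl.
have Hy := log_deriv_scale y%:A Ha; have Hx := log_derivM Ha (log_deriv_scale x%:A Hb).
have Hy' := log_deriv_ext (fun i lt => etrans (sc y i.+1 (alpha i)) (etrans (e i lt)
  (congr1 (+%R (alpha i)) (esym (sc x i.+1 (beta i)))))) Hy.
have := log_deriv_unique (mulrn_eq0_R0 F0) Hy' Hx kn.
rewrite coef_poly ltnS kn sc => ->; rewrite coefMr; apply: eq_bigr => j _.
rewrite coef_poly (_ : (j < n.+1)%N) ?sc ?scalerAr //.
exact: leq_trans (ltn_ord j) _.
Qed.

Variables (S : algType F) (h : nat -> S).
Hypothesis hC : forall i j : 'I_n, h i.+1 * h j.+1 = h j.+1 * h i.+1.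
Hypothesis h0 : h 0 = 1.

Definition transfer : R0 -> S := mmap (GRing.in_alg S) (fun i : 'I_n => h i.+1).

Lemma transferM p q : transfer (p * q) = transfer p * transfer q.
Proof. exact: mmap_comm_mul. Qed.

Lemma transferD p q : transfer (p + q) = transfer p + transfer q.
Proof. exact: mmapD. Qed.

Lemma transferZ a p : transfer (a *: p) = a *: transfer p.
Proof. by rewrite /transfer mmapZ mulr_algl. Qed.

Lemma transfer1 : transfer 1 = 1.
Proof. by rewrite /transfer -mpolyC1 mmapC /= scale1r. Qed.

Lemma transfer_sum (I : Type) (r : seq I) (P : pred I) (g : I -> R0) :
  transfer (\sum_(i <- r | P i) g i) = \sum_(i <- r | P i) transfer (g i).
Proof.
by apply: (big_morph _ transferD); rewrite -(scale0r (1 : R0)) transferZ scale0r.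
Qed.

Lemma transfer_prod (I : Type) (r : seq I) (g : I -> R0) :
  transfer (\prod_(i <- r) g i) = \prod_(i <- r) transfer (g i).
Proof. exact: (big_morph _ transferM transfer1). Qed.

Lemma transfer_gen k : (k <= n)%N -> transfer E`_k = h k.
Proof.
move=> kn; rewrite coef_poly ltnS kn; case: k kn => [|k] kn; first by rewrite transfer1.
by rewrite -[k]/(nat_of_ord (Ordinal kn)) nvarE /transfer mmapX mmap1U.
Qed.

Variables (a b : {poly R0}) (X Y : nat -> S) (x y : F).
Hypothesis ab : forall k, (k <= n)%N ->
  y ^+ k *: a`_k = \sum_(j < k.+1) x ^+ j *: (a`_(k - j) * b`_j).
Hypothesis XY : forall k, (0 < k)%N ->
  y ^+ k *: X k = \sum_(j < k.+1) x ^+ j *: (X (k - j)%N * Y j).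

Let abT k : (k <= n)%N ->
  y ^+ k *: transfer a`_k =
  \sum_(j < k.+1) x ^+ j *: (transfer a`_(k - j) * transfer b`_j).
Proof.
move=> kn; rewrite -transferZ ab // transfer_sum; apply: eq_bigr => j _.
by rewrite transferZ transferM.
Qed.

(** The unknown of degree k occurs on the left and in the term j = 0, hence with the total
    coefficient y^k - 1. *)
Lemma transfer_left : (forall k, (0 < k)%N -> y ^+ k != 1) ->
  a`_0 = 1 -> b`_0 = 1 -> X 0 = 1 -> Y 0 = 1 ->
  (forall k, (k <= n)%N -> transfer b`_k = Y k) ->
  forall k, (k <= n)%N -> transfer a`_k = X k.
Proof.
move=> yk a0 b0 X0 Y0 bY k; have [m] := ubnP k; elim: m k => // m IH [|k] km kn.
  by rewrite a0 transfer1 X0.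
have tail : \sum_(j < k.+1) x ^+ bump 0 j *:
      (transfer a`_(k.+1 - bump 0 j) * transfer b`_(bump 0 j)) =
    \sum_(j < k.+1) x ^+ bump 0 j *: (X (k.+1 - bump 0 j)%N * Y (bump 0 j)).
  apply: eq_bigr => j _; have lt := ltn_ord j; rewrite /bump add1n bY; last by lia.
  by rewrite IH //; lia.
have : (y ^+ k.+1 - 1) *: transfer a`_k.+1 = (y ^+ k.+1 - 1) *: X k.+1.
  rewrite !scalerBl !scale1r (abT kn) (XY (ltn0Sn k)) [LHS]addrC [RHS]addrC.
  rewrite big_ord_recl [X in _ = _ + X]big_ord_recl tail /= !expr0 !scale1r !subn0.
  by rewrite b0 transfer1 Y0 !mulr1 !addKr.
by move/scalerI; apply; rewrite subr_eq0 yk.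
Qed.

(** Here the unknown of degree k occurs only in the term j = k, with coefficient x^k. *)
Lemma transfer_right : x != 0 -> a`_0 = 1 -> b`_0 = 1 -> X 0 = 1 -> Y 0 = 1 ->
  (forall k, (k <= n)%N -> transfer a`_k = X k) ->
  forall k, (k <= n)%N -> transfer b`_k = Y k.
Proof.
move=> x0 a0 b0 X0 Y0 aX k; have [m] := ubnP k; elim: m k => // m IH [|k] km kn.
  by rewrite b0 transfer1 Y0.
have tail : \sum_(j < k.+1) x ^+ j *: (transfer a`_(k.+1 - j) * transfer b`_j) =
    \sum_(j < k.+1) x ^+ j *: (X (k.+1 - j)%N * Y j).
  apply: eq_bigr => j _; have lt := ltn_ord j; rewrite IH //; [|lia|lia].
  by rewrite aX //; lia.
have := abT kn; rewrite aX // (XY (ltn0Sn k)) big_ord_recr [X in _ = X -> _]big_ord_recr /=.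
rewrite tail !subnn a0 X0 transfer1 !mul1r => /addrI/scalerI -> //.
exact: expf_neq0.
Qed.

End Transfer.

(** * Partitions as exponents *)

Section Exponents.
Variable n : nat.
Implicit Types (m : 'X_{1..n}) (s lam : seq nat).

Definition mult_mon s : 'X_{1..n} := [multinom count_mem i.+1 s | i < n].

(** With the variable i standing for e_{i+1}, the monomial of exponent m is e_mu for mu = part_of
    m. *)
Definition part_of m : seq nat :=
  sort geq (flatten [seq nseq (m i) i.+1 | i <- enum 'I_n]).

Lemma count_part_of m (i : 'I_n) : count_mem i.+1 (part_of m) = m i.
Proof.
rewrite count_sort count_flatten -map_comp sumnE big_map big_enum /=.
rewrite (bigD1 i) //= count_nseq /= eqxx mul1n big1 ?addn0 // => j ji.
by rewrite count_nseq /= eqSS val_eqE (negPf ji).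
Qed.

Lemma mem_part_of m a : a \in part_of m -> exists i : 'I_n, a = i.+1.
Proof.
rewrite mem_sort => /flatten_mapP[i _]; rewrite mem_nseq => /andP[_ /eqP ->].
by exists i.
Qed.

Lemma part_of_le m : all (leq^~ n) (part_of m).
Proof. by apply/allP => a /mem_part_of[i ->]. Qed.

Lemma mult_monK : cancel part_of mult_mon.
Proof. by move=> m; apply/mnmP => i; rewrite mnmE count_part_of. Qed.

Lemma sort_geq_perm s1 s2 : perm_eq s1 s2 -> sort geq s1 = sort geq s2.
Proof.
move=> p; apply: (@sorted_eq _ geq).
- by move=> y x z xy yz; apply: leq_trans yz xy.
- by move=> x y /anti_leq.
- by apply: sort_sorted => x y; apply: leq_total.
- by apply: sort_sorted => x y; apply: leq_total.
- by rewrite perm_sort perm_sym perm_sort perm_sym.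
Qed.

Lemma part_of_mult_mon s : all (leq^~ n) s ->
  part_of (mult_mon s) = sort geq [seq k <- s | k != 0%N].
Proof.
move=> /allP sn; apply: sort_geq_perm; rewrite -(perm_sort geq).
apply/allP => a; rewrite mem_cat /= => ain.
have [i ->] : exists i : 'I_n, a = i.+1.
  case/orP: ain => [/mem_part_of //|]; rewrite mem_filter => /andP[a0 /sn].
  by case: a a0 => // a _ lt; exists (Ordinal lt).
rewrite count_part_of mnmE; apply/eqP; rewrite count_filter; apply: eq_count => k /=.
by case: eqP => [->|].
Qed.

Lemma part_of_is_part m : is_part n (part_of m) = (sumn (part_of m) == n).
Proof.
rewrite /is_part sort_sorted => [|x y]; last exact: leq_total.
by case: (boolP (0%N \in _)) => // /mem_part_of[].
Qed.

Lemma mdeg_part_of m : (mdeg m <= sumn (part_of m))%N.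
Proof.
rewrite (perm_sumn (permEl (perm_sort _ _))) sumn_flatten mdegE.
rewrite -map_comp sumnE big_map big_enum leq_sum // => i _ /=.
by rewrite sumn_nseq mulSn leq_addr.
Qed.

Lemma is_part_le lam : is_part n lam -> all (leq^~ n) lam.
Proof.
case/and3P => _ _ /eqP <-; apply/allP => a.
elim: lam => //= b s IH; rewrite inE => /orP[/eqP ->|/IH]; first exact: leq_addr.
by move/leq_trans; apply; apply: leq_addl.
Qed.

Lemma size_is_part lam : is_part n lam -> (size lam <= n)%N.
Proof.
case/and3P => _ l0 /eqP <-; elim: lam l0 => //= a s IH.
by rewrite inE negb_or eq_sym -lt0n => /andP[a0 /IH]; lia.
Qed.

Lemma partsE lam : is_part n lam -> exists mu : intpart n, parts mu = lam.
Proof.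
move=> lp; have sz := size_is_part lp; have /allP le := is_part_le lp.
have sb : (size [seq inord a : 'I_n.+1 | a <- lam] <= n)%N by rewrite size_map.
have e : [seq val i | i <- Bseq sb] = lam.
  rewrite /= -map_comp -[RHS]map_id; apply/eq_in_map => a /le an /=.
  by rewrite inordK.
have lp' : is_part n [seq val i | i <- Bseq sb] by rewrite e.
by exists (Sub (Bseq sb) lp').
Qed.

End Exponents.

(** * The functionals epsilon_LLT *)

Section EpsilonFunctional.
Variables (F : fieldType) (q : F) (n : nat).
Local Notation R0 := {mpoly F[n]}.
Local Notation E := (generic_series F n).
Local Notation H := (hecke q n).
Implicit Types (D : H) (m : 'X_{1..n}) (s lam : seq nat).

Lemma gen_prod s : all (leq^~ n) s -> \prod_(a <- s) E`_a = 'X_[mult_mon n s].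
Proof.
elim: s => [_|a s IH /andP[an /IH e]].
  by rewrite big_nil -mpolyX0; congr 'X_[_]; apply/mnmP => i; rewrite mnmE mnm0E.
rewrite big_cons e coef_poly ltnS an; case: a an => [_|a an].
  by rewrite mul1r; congr 'X_[_]; apply/mnmP => i; rewrite !mnmE.
rewrite -[a]/(nat_of_ord (Ordinal an)) nvarE -mpolyXD; congr 'X_[_].
by apply/mnmP => i; rewrite mnmDE mnm1E !mnmE /= eqSS.
Qed.

Lemma mpolyX_part_of m : 'X_[m] = \prod_(a <- part_of m) E`_a.
Proof. by rewrite gen_prod ?part_of_le // mult_monK. Qed.

(** In the weight, e_k counts for k. The bound on the degree of m loses nothing, by
    [mdeg_part_of]. *)
Definition weight_part (V : lmodType F) (b : 'X_{1..n} -> V) (g : R0) : V :=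
  \sum_(m : 'X_{1..n < n.+1} | sumn (part_of m) == n) g@_m *: b m.

Lemma weight_part_linear (V : lmodType F) (b : 'X_{1..n} -> V) : linear (weight_part b).
Proof.
move=> a f g; rewrite /weight_part scaler_sumr -big_split; apply: eq_bigr => m _ /=.
by rewrite mcoeffD mcoeffZ scalerDl scalerA.
Qed.

HB.instance Definition _ (V : lmodType F) (b : 'X_{1..n} -> V) :=
  GRing.isLinear.Build F R0 V *:%R (weight_part b) (weight_part_linear b).

Lemma weight_partX (V : lmodType F) (b : 'X_{1..n} -> V) m :
  weight_part b 'X_[m] = if sumn (part_of m) == n then b m else 0.
Proof.
rewrite /weight_part; case: eqP => sm; last first.
  apply: big1 => m' /eqP sm'; rewrite mcoeffX; case: eqP => [e|]; last by rewrite scale0r.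
  by case: sm; rewrite e.
have lt : (mdeg m < n.+1)%N by rewrite ltnS (leq_trans (mdeg_part_of m)) // sm.
rewrite (bigD1 (BMultinom lt)) /= ?sm // mcoeffX eqxx scale1r big1 ?addr0 //.
move=> m' /andP[_ ne]; rewrite mcoeffX; case: eqP => [e|]; last by rewrite scale0r.
by case/eqP: ne; apply: val_inj.
Qed.

Lemma weight_part_ext (V : lmodType F) (b : 'X_{1..n} -> V) (phi : R0 -> V) g :
  linear phi -> (forall m, phi 'X_[m] = if sumn (part_of m) == n then b m else 0) ->
  phi g = weight_part b g.
Proof.
move=> lphi phiX; have phi0 : phi 0 = 0.
  by have := lphi (-1) 0 0; rewrite scaler0 addr0 scaleN1r addNr.
have phiD : {morph phi : x y / x + y} by move=> x y; rewrite -[x]scale1r lphi !scale1r.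
rewrite (mpolyE g) (big_morph phi phiD phi0) linear_sum; apply: eq_bigr => m _.
by rewrite linearZ /= weight_partX -phiX -[_ *: _]addr0 lphi phi0 addr0.
Qed.

(** The functional e_mu |-> epsilon^mu(D), which maps the Cauchy kernel to [Yq D]. *)
Definition eps_functional D : R0 -> F^o :=
  weight_part (fun m => epsilon q n (part_of m) D : F^o).

HB.instance Definition _ D := GRing.Linear.copy (eps_functional D)
  (weight_part (fun m => epsilon q n (part_of m) D : F^o)).

Lemma eps_functionalX D m :
  eps_functional D 'X_[m] =
  if sumn (part_of m) == n then epsilon q n (part_of m) D else 0.
Proof. exact: weight_partX. Qed.

Lemma sumn_nonzero s : sumn [seq k <- s | k != 0%N] = sumn s.
Proof. by elim: s => //= [[|a]] s /= ->. Qed.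

Lemma eps_functional_prod D s : all (leq^~ n) s ->
  eps_functional D (\prod_(a <- s) E`_a) =
  if sumn s == n then epsilon q n (sort geq [seq k <- s | k != 0%N]) D else 0.
Proof.
move=> sn; rewrite gen_prod // eps_functionalX part_of_mult_mon //.
by rewrite (perm_sumn (permEl (perm_sort _ _))) sumn_nonzero.
Qed.

Lemma Yq_coef D m :
  (Yq D)@_m = if mdeg m == n then eps_functional D (\prod_(j < n) E`_(m j)) else 0.
Proof.
have mE : \prod_(j < n) E`_(m j) = \prod_(a <- m : seq nat) E`_a.
  by rewrite (big_nth 0%N) size_tuple big_mkord; apply: eq_bigr => j _; rewrite -tnth_nth.
have sm : sumn (m : seq nat) = mdeg m.
  by rewrite sumnE mdegE (big_nth 0%N) size_tuple big_mkord; apply: eq_bigr => j _; rewrite -tnth_nth.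
rewrite /Yq raddf_sum /=.
have msE (mu : intpart n) : (msymfun F n (parts mu))@_m =
    (perm_eq [seq k <- (m : seq nat) | k != 0%N] (parts mu))%:R.
  rewrite /msymfun raddf_sum /= (eq_bigr (fun m' : 'X_{1..n < n.+1} => (bmnm m' == m)%:R)); last first.
    by move=> m' _; rewrite mcoeffX.
  case: (boolP (perm_eq _ _)) => p; last first.
    by apply: big1 => m' p'; case: eqP => // e; rewrite e in p'; rewrite p' in p.
  have lt : (mdeg m < n.+1)%N.
    by rewrite -sm -(sumn_nonzero m) (perm_sumn p) parts_sum.
  rewrite (bigD1 (BMultinom lt)) //= eqxx big1 ?addr0 // => m' /andP[_ ne].
  by case: eqP => // e; case/eqP: ne; apply: val_inj.
case: eqP => dm; last first.
  apply: big1 => mu _; rewrite mcoeffZ msE; case: (boolP (perm_eq _ _)); last by rewrite mulr0.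
  by move=> p; case: dm; rewrite -sm -(sumn_nonzero m) (perm_sumn p) parts_sum.
have mn : all (leq^~ n) (m : seq nat).
  by apply/allP => _ /tnthP[j ->]; apply: leq_trans (eq_leq dm); rewrite mdegE (bigD1 j) //= leq_addr.
rewrite mE eps_functional_prod // sm dm eqxx.
have lp : is_part n (sort geq [seq k <- (m : seq nat) | k != 0%N]).
  rewrite -(part_of_mult_mon mn) part_of_is_part part_of_mult_mon //.
  by rewrite (perm_sumn (permEl (perm_sort _ _))) sumn_nonzero sm dm.
have [mu muE] := partsE lp; rewrite -muE (bigD1 mu) //= mcoeffZ msE.
rewrite muE perm_sym perm_sort perm_refl mulr1 big1 ?addr0 // => nu ne.
rewrite mcoeffZ msE; case: (boolP (perm_eq _ _)) => [p|]; last by rewrite mulr0.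
case/eqP: ne; apply: parts_inj; rewrite muE (sort_geq_perm p).
by rewrite sorted_sort ?(proj1 (andP (partsP nu))) // => y x z xy yz; apply: leq_trans yz xy.
Qed.

Hypothesis F0 : forall k, k.+1%:R != 0 :> F.

(** The plethysm turns e_a into d_a inside the functional, and (q - 1)^n is distributed over the
    parts of lam. *)
Lemma epsilon_LLT_prod D lam pi (d : {poly R0}) : is_part n lam ->
  log_deriv n E pi -> log_deriv n d (fun i => (q ^+ i.+1 - 1)^-1 *: pi i) ->
  epsilon_LLT lam D = eps_functional D (\prod_(a <- lam) ((q - 1) ^+ a *: d`_a)).
Proof.
move=> lp Hpi Hd; rewrite /epsilon_LLT /coef_msymfun /Zq mcoeffZ.
have := generic_plethysm F0 (c := fun k => (q ^+ k - 1)^-1) _ Hpi Hd (Yq_coef D).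
move=> ->; have sz := size_is_part lp; have [d0 _] := Hd.
(* Padding lam with zeros up to n entries is harmless when zero contributes the neutral element; in
   particular d_0 = 1. *)
have lE (V : Type) (idx : V) (op : Monoid.law idx) (g : nat -> V) : g 0%N = idx ->
    \big[op/idx]_(a <- lam) g a = \big[op/idx]_(j < n) g (nth 0%N lam j).
  move=> g0; rewrite (big_nth 0%N) -(big_mkord predT (fun j => g (nth 0%N lam j))).
  rewrite [RHS](@big_cat_nat _ _ _ (size lam)) //= [X in op _ X]big1_seq ?Monoid.mulm1 // => j.
  by rewrite mem_index_iota => /andP[_ /andP[lt _]]; rewrite nth_default.
have -> : mdeg [multinom nth 0%N lam i | i < n] = n.
  rewrite mdegE; transitivity (sumn lam); last by case/and3P: lp => _ _ /eqP.
  by rewrite sumnE (lE nat 0%N addn id) //; apply: eq_bigr => j _; rewrite mnmE.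
rewrite eqxx scaler_prod linearZ; congr (_ * eps_functional D _).
  rewrite prodrXr; congr (_ ^+ _); case/and3P: lp => _ _ /eqP; by rewrite sumnE.
rewrite (lE _ 1 _ (fun a => d`_a)) //.
by apply: eq_bigr => j _; rewrite mnmE.
Qed.

End EpsilonFunctional.

(** * Immanants *)

Lemma is_osp_on_card n (J : {set 'I_n}) lam I : is_osp_on J lam I -> sumn lam = #|J|.
Proof.
elim: lam J I => [|a lam IH] J [|K I] //=; first by move/eqP->; rewrite cards0.
case/and3P => KJ /eqP <- /IH ->.
by rewrite cardsD (setIidPr KJ) subnKC // subset_leq_card.
Qed.

Lemma slice_prod_eq0 (F : fieldType) (A : algType F) n (f : {set 'I_n} -> A) s (J : {set 'I_n}) :
  sumn s != #|J| -> (\prod_(a <- s) slice f a : conv A n) J = 0.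
Proof.
move=> ne; rewrite -osp_sum big1 // => I /is_osp_on_card e.
by rewrite e eqxx in ne.
Qed.

Section ImmanantTransfer.
Variables (F : fieldType) (v : F) (n : nat) (A : algType F) (t : 'I_n -> 'I_n -> A).
Hypothesis v_neq0 : v != 0.
Hypothesis t_anti : forall i j k l : 'I_n, (i < j)%N -> (k < l)%N ->
  t j k * t i l = t i l * t j k.
Hypothesis t_diag : forall i j k l : 'I_n, (i < j)%N -> (k < l)%N ->
  t j l * t i k = t i k * t j l + (v - v^-1) *: (t i l * t j k).
Hypothesis F0 : forall k, k.+1%:R != 0 :> F.
Hypothesis q_order : forall k, (0 < k)%N -> (v ^+ 2) ^+ k != 1.

Local Notation q := (v ^+ 2).
Local Notation C := (conv A n).
Local Notation R0 := {mpoly F[n]}.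
Local Notation E := (generic_series F n).
Local Notation mon w := (\prod_(k < n) t k (w k)).
Local Notation T := (@T F q n).
Local Notation EpsS := (Eslice t (-1 / v) : nat -> C).
Local Notation EtaS := (Eslice t (q / v) : nat -> C).

Lemma EpsS_comm i j : EpsS i * EpsS j = EpsS j * EpsS i.
Proof. by apply: (Eslice_comm v_neq0 t_anti t_diag); ring. Qed.

Lemma immanant_transfer (g : R0) :
  \sum_w (v ^- len w * eps_functional (T w) g) *: mon w = transfer EpsS g setT.
Proof.
have EC (i j : 'I_n) : EpsS i.+1 * EpsS j.+1 = EpsS j.+1 * EpsS i.+1.
  exact: EpsS_comm.
have E0 : EpsS 0 = 1 := Eslice0 t _.
have X m : \sum_w (v ^- len w * eps_functional (T w) 'X_[m]) *: mon w =
    transfer EpsS 'X_[m] setT.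
  have -> : transfer EpsS 'X_[m] = \prod_(a <- part_of m) EpsS a.
    rewrite mpolyX_part_of (transfer_prod EC) big_seq [RHS]big_seq.
    by apply: eq_bigr => a /(allP (part_of_le m)); apply: transfer_gen.
  case: (eqVneq (sumn (part_of m)) n) => sm; last first.
    rewrite slice_prod_eq0 ?cardsT ?card_ord // big1 // => w _.
    by rewrite eps_functionalX (negPf sm) mulr0 scale0r.
  rewrite -split_sum_conv (split_sum_ind v_neq0 t_anti t_diag _ sm).
  by apply: eq_bigr => w _; rewrite eps_functionalX sm eqxx epsilonE.
rewrite {2}(mpolyE g) transfer_sum // sum_ffunE (eq_bigr (fun m => g@_m *:
    \sum_w (v ^- len w * eps_functional (T w) 'X_[m]) *: mon w)); last first.
  by move=> m _; rewrite X transferZ ffunE.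
under [RHS]eq_bigr do rewrite scaler_sumr.
rewrite [RHS]exchange_big; apply: eq_bigr => w _ /=.
rewrite {1}(mpolyE g) linear_sum mulr_sumr scaler_suml; apply: eq_bigr => m _ /=.
by rewrite linearZ /= scalerA mulrCA.
Qed.

(** As pi_i = (-1)^i p_{i+1}, the series h of complete functions has logarithmic derivative (-1)^i
    pi_i, and d that of the (q-1)^k e_k[X/(q-1)]. *)
Variables (pi : nat -> R0) (d h : {poly R0}).
Hypothesis E_pi : log_deriv n E pi.
Hypothesis d_pi : log_deriv n d (fun i => ((q - 1) ^+ i.+1 / (q ^+ i.+1 - 1)) *: pi i).
Hypothesis h_pi : log_deriv n h (fun i => (- (-1) ^+ i.+1) *: pi i).

Local Notation D := (Dslice t : nat -> C).
Local Notation DR := (DRslice t : nat -> C).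

(** The recursion for z = -1 / v, thus y = q and x = q - 1, has its symmetric counterpart between d
    and e. *)
Lemma transfer_eps_d k : (k <= n)%N -> transfer EpsS d`_k = D k.
Proof.
have EC (i j : 'I_n) : EpsS i.+1 * EpsS j.+1 = EpsS j.+1 * EpsS i.+1.
  exact: EpsS_comm.
have z2 : (-1 / v) ^- 2 = q by rewrite expr_div_n sqrrN expr1n div1r invrK.
apply: (transfer_left EC (a := d) (b := E) (Y := EpsS) (x := q - 1) (y := q)).
- move=> k' kn; apply: log_deriv_relation F0 d_pi E_pi _ kn => i _.
  rewrite scalerA -scalerDl; congr (_ *: _).
  have : q ^+ i.+1 - 1 != 0 by rewrite subr_eq0 q_order.
  by move: (q ^+ i.+1) ((q - 1) ^+ i.+1) => x y h0; field.
- move=> k' _; have := @Dslice_Eslice _ _ _ v t t_anti t_diag (-1 / v) k'.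
  by rewrite z2; apply; field.
- exact: q_order.
- by case: d_pi.
- by case: E_pi.
- exact: Dslice0.
- exact: Eslice0.
- by move=> k' kn; apply: transfer_gen => //; apply: Eslice0.
Qed.

(** The other root, z = q / v, gives y = q^{-1} and x = q^{-1} - 1. The same d satisfies this
    recursion against h, so the image of d determines that of h. *)
Lemma transfer_eps_h k : (k <= n)%N -> transfer EpsS h`_k = EtaS k.
Proof.
have EC (i j : 'I_n) : EpsS i.+1 * EpsS j.+1 = EpsS j.+1 * EpsS i.+1.
  exact: EpsS_comm.
have z2 : (q / v) ^- 2 = q^-1 by rewrite expr2 mulfK.
apply: (transfer_right EC (a := d) (b := h) (X := D) (x := q^-1 - 1) (y := q^-1)).
- move=> k' kn; apply: log_deriv_relation F0 d_pi h_pi _ kn => i _.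
  rewrite !scalerA -scalerDl; congr (_ *: _).
  have : q ^+ i.+1 - 1 != 0 by rewrite subr_eq0 q_order.
  have -> : q^-1 - 1 = - (q - 1) / q by field.
  rewrite expr_div_n exprVn [(- (q - 1)) ^+ _]exprNn mulrN.
  have -> : (-1) ^+ i.+1 * (q - 1) ^+ i.+1 / q ^+ i.+1 * (-1) ^+ i.+1 = (q - 1) ^+ i.+1 / q ^+ i.+1.
    by rewrite mulrC mulrA mulrA -exprD addnn -mul2n exprM sqrrN !expr1n mul1r.
  have : q ^+ i.+1 != 0 by rewrite !expf_neq0.
  by move: (q ^+ i.+1) ((q - 1) ^+ i.+1) => x y h1 h0; field; rewrite h1.
- move=> k' _; have := @Dslice_Eslice _ _ _ v t t_anti t_diag (q / v) k'.
  by rewrite z2; apply; field.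
- rewrite subr_eq0; apply: contra_neq (q_order (ltn0Sn 0)) => e.
  by rewrite expr1 -[q]invrK e invr1.
- by case: d_pi.
- by case: h_pi.
- exact: Dslice0.
- exact: Eslice0.
- by move=> k' kn; apply: transfer_eps_d.
Qed.

Lemma Dslice_comm i j : D i * D j = D j * D i.
Proof.
have EC (a b : 'I_n) : EpsS a.+1 * EpsS b.+1 = EpsS b.+1 * EpsS a.+1.
  exact: EpsS_comm.
case: (leqP i n) => [i_n|lt]; last by rewrite [D i]slice_large // mul0r mulr0.
case: (leqP j n) => [j_n|lt]; last by rewrite [D j]slice_large // mul0r mulr0.
by rewrite -!transfer_eps_d // -2!(transferM EC) [d`_i * _]mulrC.
Qed.

Lemma transfer_D_h k : (k <= n)%N -> transfer D h`_k = DR k.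
Proof.
have DC (i j : 'I_n) : D i.+1 * D j.+1 = D j.+1 * D i.+1 by exact: Dslice_comm.
(* With y = 0 the left side is 1 for k = 0 and vanishes for k > 0: this is the relation \sum_j
   (-1)^j e_{k-j} h_j = 0. *)
apply: (transfer_right DC (a := E) (b := h) (X := D) (x := -1) (y := 0)).
- move=> k' kn; apply: log_deriv_relation F0 E_pi h_pi _ kn => i _.
  rewrite expr0n scale0r scalerA mulrN -exprD addnn -mul2n exprM sqrrN !expr1n.
  by rewrite scaleN1r subrr.
- move=> k' k0; have := @Dslice_DRslice _ _ n t _ k0.
  move/(congr1 ( *:%R ((-1) ^+ k'))); rewrite scaler0 scaler_sumr => e.
  rewrite expr0n eqn0Ngt k0 scale0r -[LHS]e (reindex_inj rev_ord_inj) /=.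
  apply: eq_bigr => j _; have lt := ltn_ord j; rewrite scalerA -exprD.
  rewrite subSS subKn // -signr_odd oddD oddB // addbA addbb addFb signr_odd //.
- by rewrite oppr_eq0 oner_eq0.
- by case: E_pi.
- by case: h_pi.
- exact: Dslice0.
- exact: DRslice0.
- by move=> k' kn; apply: transfer_gen => //; apply: Dslice0.
Qed.

End ImmanantTransfer.

Lemma hom_hecke_ext (F : fieldType) (q : F) n (f g : 'Hom(hecke q n, F^o)) :
  (forall w, f (T q w) = g (T q w)) -> f = g.
Proof.
move=> fg; apply/lfunP => x; rewrite (hecke_sum x) !linear_sum.
by apply: eq_bigr => w _; rewrite !linearZ /= fg.
Qed.

Section LLTImmanants.
Variables (F : fieldType) (v : F) (n : nat).
Hypothesis v_neq0 : v != 0.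
Hypothesis F0 : forall k, k.+1%:R != 0 :> F.
Hypothesis q_order : forall k, (0 < k)%N -> (v ^+ 2) ^+ k != 1.
Hypothesis eps_free : free (epsilon_tuple (v ^+ 2) n).

Local Notation q := (v ^+ 2).
Local Notation A := (qmat v n).
Local Notation t := (@tgen F v n).
Local Notation C := (conv A n).
Local Notation R0 := {mpoly F[n]}.
Local Notation E := (generic_series F n).
Local Notation T := (@T F q n).
Local Notation EpsS := (Eslice t (-1 / v) : nat -> C).
Local Notation EtaS := (Eslice t (q / v) : nat -> C).
Local Notation D := (Dslice t : nat -> C).
Local Notation DR := (DRslice t : nat -> C).
Implicit Types (lam : seq nat).

Let t_anti := @tgen_anti F v n.
Let t_diag := @tgen_diag F v n.

(* d' consists of the e_k[X/(q-1)] and h of the complete homogeneous functions. *)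
Lemma hall_series : exists pi (d' d h : {poly R0}),
  [/\ log_deriv n E pi,
      log_deriv n d' (fun i => (q ^+ i.+1 - 1)^-1 *: pi i),
      log_deriv n d (fun i => ((q - 1) ^+ i.+1 / (q ^+ i.+1 - 1)) *: pi i),
      log_deriv n h (fun i => (- (-1) ^+ i.+1) *: pi i)
    & forall k, (k <= n)%N -> d`_k = (q - 1) ^+ k *: d'`_k].
Proof.
have E0 : E`_0 = 1 by rewrite coef_poly.
have [pi Hpi] := log_deriv_exists_pi n E0.
have [d' [_ Hd']] := @log_deriv_exists F R0 n (fun i => (q ^+ i.+1 - 1)^-1 *: pi i) F0.
have [h [_ Hh]] := @log_deriv_exists F R0 n (fun i => (- (-1) ^+ i.+1) *: pi i) F0.
have sc i (g : R0) : (q - 1)%:A ^+ i * g = (q - 1) ^+ i *: g.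
  by rewrite exprZn expr1n mulr_algl.
exists pi, d', (\poly_(i < n.+1) ((q - 1)%:A ^+ i * d'`_i)), h; split=> //.
  apply: log_deriv_ext (log_deriv_scale (q - 1)%:A Hd') => i _.
  by rewrite sc scalerA.
by move=> k kn; rewrite coef_poly ltnS kn sc.
Qed.

Lemma Imm_epsilon_LLT lam : is_part n lam ->
  Imm (v := v) (n := n) (epsilon_LLT lam) = (\prod_(a <- lam) D a) setT.
Proof.
move=> lp; have [pi [d' [d [h [Epi d'pi dpi hpi dE]]]]] := hall_series.
have EC (i j : 'I_n) : EpsS i.+1 * EpsS j.+1 = EpsS j.+1 * EpsS i.+1.
  exact: EpsS_comm.
transitivity (transfer EpsS (\prod_(a <- lam) ((q - 1) ^+ a *: d'`_a)) setT).
  rewrite -(immanant_transfer v_neq0 t_anti t_diag) /Imm; apply: eq_bigr => w _.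
  by rewrite (epsilon_LLT_prod F0 _ lp Epi d'pi).
rewrite (transfer_prod EC); congr ((_ : C) _).
rewrite big_seq [RHS]big_seq; apply: eq_bigr => a /(allP (is_part_le lp)) an.
by rewrite -dE // (transfer_eps_d v_neq0 t_anti t_diag F0 q_order Epi dpi).
Qed.

Lemma LLT_epsilon lam x : is_part n lam -> LLT (epsilon q n lam) x = epsilon_LLT lam x.
Proof.
case/partsE => mu <-.
have epsE : epsilon q n (parts mu) = (epsilon_tuple q n)`_(enum_rank mu).
  by rewrite -tnth_nth tnth_mktuple enum_rankK.
rewrite /LLT (bigD1 mu) //= epsE coord_free // eqxx mul1r big1 ?addr0 // => nu ne.
by rewrite coord_free // (inj_eq (can_inj enum_rankK)) eq_sym (negPf ne) mul0r.
Qed.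

Lemma LLT_sum (I : finType) (P : pred I) (b : I -> F) (mu : I -> seq nat) x :
  (forall i, P i -> is_part n (mu i)) ->
  LLT (\sum_(i | P i) b i *: epsilon q n (mu i)) x =
  \sum_(i | P i) b i * epsilon_LLT (mu i) x.
Proof.
move=> mup; rewrite [RHS](eq_bigr (fun i => b i * LLT (epsilon q n (mu i)) x)); last first.
  by move=> i /mup p; rewrite LLT_epsilon.
rewrite /LLT; under [RHS]eq_bigr do rewrite mulr_sumr.
rewrite [RHS]exchange_big; apply: eq_bigr => nu _ /=.
rewrite linear_sum mulr_suml; apply: eq_bigr => i _ /=.
by rewrite linearZ /= mulrA.
Qed.

Lemma Imm_LLT_eta lam : is_part n lam ->
  Imm (v := v) (n := n) (LLT (eta q n lam)) = (\prod_(a <- rev lam) DR a) setT.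
Proof.
move=> lp; have [pi [d' [d [h [Epi d'pi dpi hpi dE]]]]] := hall_series.
have EC (i j : 'I_n) : EpsS i.+1 * EpsS j.+1 = EpsS j.+1 * EpsS i.+1.
  exact: EpsS_comm.
have DC (i j : 'I_n) : D i.+1 * D j.+1 = D j.+1 * D i.+1.
  exact: (Dslice_comm v_neq0 t_anti t_diag F0 q_order Epi dpi).
have ln := allP (is_part_le lp).
have sl : sumn lam = n by case/and3P: lp => _ _ /eqP.
pose g : R0 := \prod_(a <- lam) h`_a.
have gE : transfer EpsS g = \prod_(a <- lam) EtaS a.
  rewrite (transfer_prod EC) big_seq [RHS]big_seq; apply: eq_bigr => a /ln an.
  exact: (transfer_eps_h v_neq0 t_anti t_diag F0 q_order Epi dpi hpi).
have etaT w : eta q n lam (T w) = eps_functional (T w) g.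
  have e : \sum_w (v ^- len w * eta q n lam (T w) -
      v ^- len w * eps_functional (T w) g) *: monomial v w = 0.
    transitivity (transfer EpsS g setT - transfer EpsS g setT); last by rewrite subrr.
    rewrite {1}gE -split_sum_conv (split_sum_ind v_neq0 t_anti t_diag _ sl).
    rewrite -(immanant_transfer v_neq0 t_anti t_diag) -sumrB.
    by apply: eq_bigr => w' _; rewrite scalerBl lfunE.
  have /eqP := monomial_free v_neq0 e w.
  rewrite -mulrBr mulf_eq0 subr_eq0 invr_eq0 expf_eq0 (negPf v_neq0) andbF /=.
  by move/eqP.
have etaE : eta q n lam = \sum_(m : 'X_{1..n < n.+1} | is_part n (part_of m))
    g@_m *: epsilon q n (part_of m).
  apply: hom_hecke_ext => w; rewrite etaT sum_lfunE.
  by apply: eq_big => m; [rewrite part_of_is_part | rewrite scale_lfunE].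
(* The product over lam is reversed inside the commutative polynomial ring, before the transfer. *)
have -> : \prod_(a <- rev lam) DR a = transfer D g.
  rewrite /g -(perm_big _ (permEl (perm_rev lam))) (transfer_prod DC).
  apply: eq_big_seq => a; rewrite mem_rev => /ln an; apply: esym.
  exact: (transfer_D_h v_neq0 t_anti t_diag F0 q_order Epi dpi hpi).
transitivity (\sum_(m : 'X_{1..n < n.+1} | is_part n (part_of m))
    g@_m *: Imm (v := v) (n := n) (epsilon_LLT (part_of m))).
  under [RHS]eq_bigr do rewrite scaler_sumr.
  rewrite [RHS]exchange_big; apply: eq_bigr => w _ /=.
  rewrite etaE LLT_sum // mulr_sumr scaler_suml; apply: eq_bigr => m _.
  by rewrite scalerA mulrCA.
(* The value at [n] of the transfer is linear in g and kills the monomials of weight other than n,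
   so it is determined by the products of the D_a attached to the e_mu. *)
rewrite (weight_part_ext (b := fun m => (\prod_(a <- part_of m) D a : C) setT)
  (phi := fun g => transfer D g setT)); first last.
- move=> m; have -> : transfer D 'X_[m] = \prod_(a <- part_of m) D a.
    rewrite mpolyX_part_of (transfer_prod DC); apply: eq_big_seq => a.
    by move/(allP (part_of_le m)) => an; apply: transfer_gen => //; apply: Dslice0.
  by case: eqP => // /eqP sm; rewrite slice_prod_eq0 // cardsT card_ord.
- by move=> c x y; rewrite transferD transferZ !ffunE.
rewrite /weight_part; apply: eq_big => m; first by rewrite part_of_is_part.
by move=> mp; rewrite Imm_epsilon_LLT.
Qed.

End LLTImmanants.

Lemma qhalf_neq0 : qhalf != 0.
Proof. by rewrite tofrac_eq0 polyX_eq0. Qed.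

Lemma Qv_char0 k : k.+1%:R != 0 :> Qv.
Proof.
rewrite -(rmorph_nat (@tofrac {poly rat})) tofrac_eq0 -polyC1 -polyCMn polyC_eq0.
by rewrite Num.Theory.pnatr_eq0.
Qed.

Lemma qhalf_order k : (0 < k)%N -> (qhalf ^+ 2) ^+ k != 1.
Proof.
move=> k0; rewrite -exprM -rmorphXn -(rmorph1 (@tofrac {poly rat})) /=.
rewrite tofrac_eq; apply/eqP => /(congr1 (fun p : {poly rat} => size p)).
by rewrite size_polyXn size_poly1; case: k k0.
Qed.

Theorem theorem3p5 (n : nat) (lam : seq nat) (lam_part : is_part n lam) :
  Imm (v := qhalf) (n := n) (epsilon_LLT lam) =
    \sum_(I : (size lam).-tuple {set 'I_n} | is_osp lam I)
      \prod_(J <- I) diag_up qhalf J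
  /\
  Imm (v := qhalf) (n := n) (LLT (eta (qhalf ^+ 2) n lam)) =
    \sum_(I : (size lam).-tuple {set 'I_n} | is_osp lam I)
      \prod_(J <- rev I) diag_down qhalf J.
Proof.
split.
  rewrite (Imm_epsilon_LLT qhalf_neq0 Qv_char0 qhalf_order) // -osp_sum.
  by apply: eq_bigl => I; rewrite is_osp_onE.
have fr := epsilon_tuple_free n.
rewrite (Imm_LLT_eta qhalf_neq0 Qv_char0 qhalf_order fr) // -osp_sum_rev.
by apply: eq_bigl => I; rewrite is_osp_onE.
Qed.
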